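(* Let $A\in C^\infty_{\mathbb R}(S^1)$. For $m,\ell\ge1$, $$(\dot Z_A)_{\ell,m}:=\langle\dot Z_Ae_m^+,e_\ell^-\rangle=i\sqrt{m\ell}\,\widehat A(-(m+\ell)).$$ Equivalently, for every $m\ge1$, $$\dot Z_Ae_m^+=i\sum_{\ell\ge1}\sqrt{m\ell}\,\widehat A(-(m+\ell))\,e_\ell^- .$$
   Context: $H^{1/2}(S^1)$ is the Hilbert space of (classes modulo constants of) complex-valued functions $u$ on $S^1$ with inner product $\langle u,v\rangle=\sum_{n\ne0}|n|\widehat u(n)\overline{\widehat v(n)}$, where $\widehat u(n)=\frac1{2\pi}\int_0^{2\pi}u(e^{i\theta})e^{-in\theta}d\theta$. $H^{1/2}_+$ and $H^{1/2}_-$ are the closed spans of $\{e^{in\theta}:n\ge1\}$ and $\{e^{-in\theta}:n\ge1\}$, with orthogonal projections $P_\pm$; their orthonormal bases are $e_m^+=e^{im\theta}/\sqrt m$ and $e_\ell^-=e^{-i\ell\theta}/\sqrt\ell$ ($m,\ell\ge1$). For an orientation-preserving $C^\infty$ diffeomorphism $h$ of $S^1$, $V_hu=u\circ h$ is bounded and invertible on $H^{1/2}(S^1)$; put $A_h=P_+V_h|_{H^{1/2}_+}$, $B_h=P_-V_h|_{H^{1/2}_+}$. $A_h$ is an isomorphism of $H^{1/2}_+$ and $Z_h=B_hA_h^{-1}:H^{1/2}_+\to H^{1/2}_-$. A smooth path $h_t$ in $\mathrm{Diff}_+(S^1)$ (real $t$ near $0$, $h_0=\mathrm{id}$) has initial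 vector field $A\in C^\infty_{\mathbb R}(S^1)$ if, with angular lifts $h_t(e^{i\theta})=e^{i\varphi_t(\theta)}$, one has $\varphi_t(\theta)=\theta+tA(\theta)+o(t)$ in $C^\infty(S^1)$. For such a path the operator-norm derivative $\dot Z_A=\frac{d}{dt}\big|_{t=0}Z_{h_t}\in\mathrm B(H^{1/2}_+,H^{1/2}_-)$ (bounded linear operators) exists and depends only on $A$. *)

(* Defs.v *)
From HB Require Import structures.
From mathcomp Require Import all_boot all_order all_algebra.
From mathcomp.real_closed Require Import complex.
From mathcomp Require Import all_classical all_reals all_analysis.
Set Implicit Arguments.
Unset Strict Implicit.
Unset Printing Implicit Defensive.
Import Order.TTheory GRing.Theory Num.Theory.
Import numFieldNormedType.Exports.
Local Open Scope classical_set_scope.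
Local Open Scope ring_scope.
Local Open Scope complex_scope.

Definition circle (R : realType) : Type := {z : R[i] | `|z| == 1}.

Lemma norm_expi (R : realType) (x : R) : `|cos x +i* sin x| == 1 :> R[i].
Proof. by rewrite normc_def /= cos2Dsin2 sqrtr1. Qed.

Definition expi (R : realType) (x : R) : circle R :=
  exist (fun z : R[i] => `|z| == 1) _ (norm_expi x).

(* Elements of H^{1/2}(S^1) are represented by functions; equality of classes
   is [class_eq] below. *)
Definition cfun (R : realType) : Type := circle R -> R[i].

(* The character e^{i n theta}, as z |-> z ^ n on the circle. *)
Definition chi (R : realType) (n : int) : cfun R := fun z => sval z ^ n.

Definition smooth (R : realType) (f : R -> R) : Prop :=
  forall (n : nat) (x : R), derivable (derive1n n f) x 1.

Definition smooth_field (R : realType) (A : circle R -> R) : Prop :=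
  smooth (fun x => A (expi x)).

Definition is_lift (R : realType) (h : circle R -> circle R) (f : R -> R)
    : Prop :=
  forall x, h (expi x) = expi (f x).

Definition smooth_map (R : realType) (h : circle R -> circle R) : Prop :=
  exists2 f : R -> R, smooth f & is_lift h f.

Definition orientation_preserving (R : realType) (h : circle R -> circle R)
    : Prop :=
  exists2 f : R -> R, smooth f /\ is_lift h f & forall x, 0 < derive1 f x.

Definition diff_plus (R : realType) (h : circle R -> circle R) : Prop :=
  [/\ smooth_map h,
      exists2 g, smooth_map g & cancel h g /\ cancel g h
    & orientation_preserving h].

(* Iterated partial derivatives of a function of (t, x) along a word:
   [true] differentiates in t, [false] in x. *)
Fixpoint partials (R : realType) (w : seq bool) (f : R -> R -> R)
    : R -> R -> R :=
  match w with
  | [::] => f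
  | true :: w' => fun t x => derive1 (fun s => partials w' f s x) t
  | false :: w' => fun t x => derive1 (partials w' f t) x
  end.

Definition jointly_smooth (R : realType) (d : R) (f : R -> R -> R) : Prop :=
  forall (w : seq bool) (t x : R), `|t| < d ->
    [/\ {for (t, x), continuous (fun p : R * R => partials w f p.1 p.2)},
        derivable (fun s => partials w f s x) t 1
      & derivable (partials w f t) x 1].

(* [h] is a smooth path in Diff_+(S^1), defined for t near 0, with h_0 = id and
   initial vector field [A]; the last clause is the expansion
   phi_t(x) = x + t A(x) + o(t) in the topology of C^oo(S^1). *)
Definition path_with_field (R : realType) (h : R -> circle R -> circle R)
    (A : circle R -> R) : Prop :=
  exists (phi : R -> R -> R) (d : R),
  [/\ 0 < d,
      forall t, `|t| < d -> diff_plus (h t) /\ is_lift (h t) (phi t),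
      h 0 = id,
      jointly_smooth d phi
    & forall (k : nat) (e : R), 0 < e -> \forall t \near (0 : R), forall x,
        `|derive1n k (fun y => phi t y - (y + t * A (expi y))) x| <= e * `|t|].

Definition circle_int (R : realType) (f : R -> R[i]) : R[i] :=
  (\int[lebesgue_measure]_(x in `[0, 2 * pi]) complex.Re (f x))
  +i* (\int[lebesgue_measure]_(x in `[0, 2 * pi]) complex.Im (f x)).

Definition fourier (R : realType) (u : cfun R) (n : int) : R[i] :=
  ((2 * pi)^-1)%:C
  * circle_int (fun x => u (expi x) * chi (- n) (expi x)).

Definition square_integrable (R : realType) (f : R -> R) : Prop :=
  measurable_fun [set: R] f /\
  lebesgue_measure.-integrable `[0, 2 * pi] (fun x => ((f x) ^+ 2)%:E).

Definition series_sum (R : realType) (a : nat -> R[i]) : R[i] :=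
  limn (series (fun k => complex.Re (a k)))
  +i* limn (series (fun k => complex.Im (a k))).

(* The k-th term groups the frequencies n = k + 1 and n = - (k + 1). *)
Definition inner_term (R : realType) (u v : cfun R) (k : nat) : R[i] :=
  k.+1%:R * (fourier u k.+1%:Z * (fourier v k.+1%:Z)^*%C
             + fourier u (- k.+1%:Z) * (fourier v (- k.+1%:Z))^*%C).

Definition inner (R : realType) (u v : cfun R) : R[i] :=
  series_sum (inner_term u v).

Definition hnorm (R : realType) (u : cfun R) : R :=
  Num.sqrt (complex.Re (inner u u)).

(* Junk-value pitfall: [inner] and [hnorm] are meaningful on [H12] only. *)
Definition H12 (R : realType) : set (cfun R) := [set u |
  [/\ square_integrable (fun x => complex.Re (u (expi x))),
      square_integrable (fun x => complex.Im (u (expi x)))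
    & cvgn (series (fun k => complex.Re (inner_term u u k)))]].

(* Equality in H^{1/2}(S^1): almost everywhere and modulo constants. *)
Definition class_eq (R : realType) (u v : cfun R) : Prop :=
  exists c : R[i], {ae lebesgue_measure, forall x, u (expi x) = v (expi x) + c}.

Definition czero (R : realType) : cfun R := fun=> 0.
Definition cadd (R : realType) (u v : cfun R) : cfun R := fun z => u z + v z.
Definition csub (R : realType) (u v : cfun R) : cfun R := fun z => u z - v z.
Definition hscale (R : realType) (a : R[i]) (u : cfun R) : cfun R :=
  fun z => a * u z.

Definition closed_span (R : realType) (b : nat -> cfun R) : set (cfun R) :=
  [set u | H12 u /\ forall e : R, 0 < e ->
     exists (N : nat) (c : nat -> R[i]),
       hnorm (csub u (fun z => \sum_(k < N) c k * b k z)) < e].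

Definition Hplus (R : realType) : set (cfun R) :=
  closed_span (fun k => chi k.+1%:Z).
Definition Hminus (R : realType) : set (cfun R) :=
  closed_span (fun k => chi (- k.+1%:Z)).

Definition e_plus (R : realType) (m : nat) : cfun R :=
  hscale ((Num.sqrt (m%:R : R))^-1)%:C (chi m%:Z).
Definition e_minus (R : realType) (l : nat) : cfun R :=
  hscale ((Num.sqrt (l%:R : R))^-1)%:C (chi (- l%:Z)).

(* A representative of the orthogonal projection of [u] onto [E]. *)
Definition proj (R : realType) (E : set (cfun R)) (u : cfun R) : cfun R :=
  xget (@czero R) [set w | E w /\ forall v, E v -> inner (csub u w) v = 0].

Definition Vop (R : realType) (h : circle R -> circle R) (u : cfun R)
    : cfun R := u \o h.

Definition Aop (R : realType) (h : circle R -> circle R) (u : cfun R)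
    : cfun R := proj (@Hplus R) (Vop h u).

Definition Bop (R : realType) (h : circle R -> circle R) (u : cfun R)
    : cfun R := proj (@Hminus R) (Vop h u).

(* A representative of A_h^{-1} w. *)
Definition Ainv (R : realType) (h : circle R -> circle R) (w : cfun R)
    : cfun R :=
  xget (@czero R) [set v | Hplus v /\ class_eq (Aop h v) w].

Definition Zop (R : realType) (h : circle R -> circle R) (w : cfun R)
    : cfun R := Bop h (Ainv h w).

(* Operator norm on H^{1/2}_+, as an extended real. *)
Definition opnorm (R : realType) (T : cfun R -> cfun R) : \bar R :=
  ereal_sup [set (hnorm (T u))%:E | u in [set u | Hplus u /\ hnorm u <= 1]].

(* T induces an element of B(H^{1/2}_+, H^{1/2}_-). *)
Definition bounded_operator (R : realType) (T : cfun R -> cfun R) : Prop :=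
  [/\ forall u, Hplus u -> Hminus (T u),
      forall u v, Hplus u -> Hplus v -> class_eq u v -> class_eq (T u) (T v),
      forall a u v, Hplus u -> Hplus v ->
        class_eq (T (cadd (hscale a u) v)) (cadd (hscale a (T u)) (T v))
    & (opnorm T < +oo)%E].

(* T = d/dt Z_{h_t} at t = 0 in operator norm. *)
Definition is_Zdot (R : realType) (h : R -> circle R -> circle R)
    (T : cfun R -> cfun R) : Prop :=
  bounded_operator T /\
  opnorm (fun u => csub (hscale (t^-1)%:C (csub (Zop (h t) u) (Zop (h 0) u)))
                        (T u)) @[t --> 0^'] --> 0%E.

Definition field_hat (R : realType) (A : circle R -> R) (n : int) : R[i] :=
  fourier (fun z => (A z)%:C) n.

(* Main.v *)
Require Import Defs.
From HB Require Import structures.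
From mathcomp Require Import all_boot all_order all_algebra.
From mathcomp.real_closed Require Import complex.
From mathcomp Require Import all_classical all_reals all_analysis.
From mathcomp Require Import measurable_realfun ring lra zify.
Set Implicit Arguments.
Unset Strict Implicit.
Unset Printing Implicit Defensive.
Import Order.TTheory GRing.Theory Num.Theory.
Import numFieldNormedType.Exports.
Local Open Scope classical_set_scope.
Local Open Scope ring_scope.
Local Open Scope complex_scope.

(** The formula is a first-order computation. To first order in [t], the mode
    [z ^ m] composed with [h_t] is [exp (i m x) (1 + i m t A)], so its coefficient
    at a frequency [n] other than [m] is [t i m] times the coefficient of [A] at
    [n - m] ([fc_mode_expansion]). For [n = - l] this is an entry of the block
    [B_h]. At [t = 0] the block [B_h] vanishes and [A_h] is the identity, hence the
    derivative of [B_h A_h^-1] is that of [B_h]; normalising the modes produces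
    the square roots.

    The inverse of [A_h] is never computed. The operator [Z_h] is evaluated at the
    moving vector [A_h v], for [v] a small multiple of a mode, where
    [Z_h (A_h v) = B_h v] ([Zop_Aop]); this requires only that [A_h] be injective.
    Convergence in operator norm is uniform on the unit ball and thus applies to
    [A_h v], while [Zdot (A_h v)] tends to [Zdot v] because [Zdot] is bounded and
    [A_h v] tends to [v] in norm ([Zdot_mode]). These norms are estimated by
    Bessel's inequality for the derivative ([hnorm_half_le]).

    For injectivity ([composition_injective]), let [d] be in the positive half and
    suppose that [d \o h] has no positive frequencies. Composition with [h]
    preserves the symplectic form, so the sum of [n |d_n|^2] equals minus the
    sum of [l |b_l|^2], where [b_l] is the coefficient of [d \o h] at [- l]; both
    vanish. As [d] need not be smooth, the identity is proved for truncations of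
    [d] ([symplectic_identity]), and the limit is justified by the fast decay of
    the off-diagonal block, which comes from two integrations by parts against a
    phase of speed at least a multiple of [k + l] ([kernel_decay],
    [offdiagonal_decay]).

    Elements of the space are only square integrable. The coefficients of
    [d \o h] are therefore written as pairings of [d] with smooth functions, by a
    change of variables for Borel functions ([circle_int_substitution]), and
    such pairings are computed by Fourier inversion with a rate
    ([fourier_pairing]). Membership in the two halves and orthogonal projections
    are translated into conditions on coefficients ([HsP], [proj_specP]). *)

Local Notation "f ^` ()" := (derive1 f) : ring_scope.

Local Notation cadd := Defs.cadd.
Local Notation czero := Defs.czero.
Local Notation proj := Defs.proj.

(** * Complex numbers and the circle *)

Notation normc := ComplexField.Normc.normc.

Section Modulus.
Context {R : realType}.
Implicit Types z w : R[i].

Lemma normc_ge0 z : 0 <= normc z.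
Proof. by case: z => a b /=; exact: sqrtr_ge0. Qed.

Lemma normcB z w : normc (z - w) <= normc z + normc w.
Proof. by rewrite (le_trans (le_normcD _ _))// normcN. Qed.

Lemma normc_sqr z : normc z ^+ 2 = complex.Re z ^+ 2 + complex.Im z ^+ 2.
Proof. by case: z => a b /=; rewrite sqr_sqrtr// addr_ge0// sqr_ge0. Qed.

Lemma normc_Re z : `|complex.Re z| <= normc z.
Proof.
by rewrite -(ler_pXn2r (n := 2))// ?nnegrE ?normc_ge0// normc_sqr real_normK ?num_real// lerDl sqr_ge0.
Qed.

Lemma normc_Im z : `|complex.Im z| <= normc z.
Proof.
by rewrite -(ler_pXn2r (n := 2))// ?nnegrE ?normc_ge0// normc_sqr real_normK ?num_real// lerDr sqr_ge0.
Qed.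

Lemma normc_le_ReIm z : normc z <= `|complex.Re z| + `|complex.Im z|.
Proof.
rewrite -(ler_pXn2r (n := 2))// ?nnegrE ?normc_ge0 ?addr_ge0// normc_sqr.
rewrite sqrrD !real_normK ?num_real// lerD2r lerDl mulrn_wge0// mulr_ge0//.
Qed.

Lemma normcR (a : R) : normc a%:C = `|a|.
Proof. by rewrite /= expr0n addr0 sqrtr_sqr. Qed.

Lemma normc_nat n : normc (n%:R : R[i]) = n%:R.
Proof. by rewrite -[n%:R](rmorph_nat (real_complex R)) normcR ger0_norm. Qed.

Lemma normcJ z : normc z^*%C = normc z.
Proof. by case: z => a b /=; rewrite sqrrN. Qed.

Lemma normc_i : normc ('i : R[i]) = 1.
Proof. by rewrite /= expr0n expr1n add0r sqrtr1. Qed.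

Lemma mulcJ z : z * z^*%C = (normc z ^+ 2)%:C.
Proof. case: z => a b; rewrite normc_sqr; apply/eqP; rewrite eq_complex/=.
by apply/andP; split; apply/eqP; ring. Qed.

Lemma normc_sum (I : Type) (r : seq I) (P : pred I) (F : I -> R[i]) :
  normc (\sum_(i <- r | P i) F i) <= \sum_(i <- r | P i) normc (F i).
Proof.
elim/big_ind2 : _ => // [|x1 x2 y1 y2 h1 h2]; first by rewrite ComplexField.Normc.normc0.
by rewrite (le_trans (le_normcD _ _))// lerD.
Qed.

Lemma cReM z w :
  complex.Re (z * w) = complex.Re z * complex.Re w - complex.Im z * complex.Im w.
Proof. by case: z w => [a b] [c d]. Qed.

Lemma cImM z w :
  complex.Im (z * w) = complex.Re z * complex.Im w + complex.Im z * complex.Re w.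
Proof. by case: z w => [a b] [c d]. Qed.

Lemma cReD z w : complex.Re (z + w) = complex.Re z + complex.Re w.
Proof. by case: z w => [a b] [c d]. Qed.

Lemma cImD z w : complex.Im (z + w) = complex.Im z + complex.Im w.
Proof. by case: z w => [a b] [c d]. Qed.

Lemma cReB z w : complex.Re (z - w) = complex.Re z - complex.Re w.
Proof. by case: z w => [a b] [c d]. Qed.

Lemma cImB z w : complex.Im (z - w) = complex.Im z - complex.Im w.
Proof. by case: z w => [a b] [c d]. Qed.

Lemma complex_ext z w : complex.Re z = complex.Re w ->
  complex.Im z = complex.Im w -> z = w.
Proof. by case: z w => [a b] [c d] /= -> ->. Qed.

Lemma normc_eq0 z : (forall e : R, 0 < e -> normc z <= e) -> z = 0.
Proof.
move=> h; apply: ComplexField.Normc.eq0_normc; apply/eqP.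
rewrite eq_le normc_ge0 andbT leNgt; apply/negP => z0.
have z20 : 0 < normc z / 2 by rewrite divr_gt0.
have := h _ z20; lra.
Qed.

Definition eI (x : R) : R[i] := cos x +i* sin x.

Lemma eI0 : eI 0 = 1.
Proof. by rewrite /eI cos0 sin0. Qed.

Lemma eID x y : eI (x + y) = eI x * eI y.
Proof. by rewrite /eI cosD sinD; simpc; congr (_ +i* _); rewrite addrC. Qed.

Lemma eIJ x : (eI x)^*%C = eI (- x).
Proof. by rewrite /eI cosN sinN. Qed.

Lemma normc_eI x : normc (eI x) = 1.
Proof. by rewrite /= cos2Dsin2 sqrtr1. Qed.

Lemma eIMN x : eI x * eI (- x) = 1.
Proof. by rewrite -eID subrr eI0. Qed.

Lemma eI_neq0 x : eI x != 0.
Proof. by apply/eqP => h; move: (eIMN x); rewrite h mul0r => /eqP; rewrite eq_sym oner_eq0. Qed.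

Lemma eIV x : (eI x)^-1 = eI (- x).
Proof. by apply: (mulfI (eI_neq0 x)); rewrite eIMN mulfV// eI_neq0. Qed.

Lemma eI_exprz x (n : int) : eI x ^ n = eI (n%:~R * x).
Proof.
have nat k : eI x ^+ k = eI (k%:R * x).
  elim: k => [|k IH]; first by rewrite expr0 mul0r eI0.
  by rewrite exprS IH -eID -natr1 mulrDl mul1r addrC.
case: n => k; first by rewrite -exprnP nat.
by rewrite NegzE -exprnN nat eIV mulrNz mulNr.
Qed.

Lemma chi_expi (n : int) x : chi n (expi x) = eI (n%:~R * x).
Proof. by rewrite /chi /= -/(eI x) eI_exprz. Qed.

Lemma eI2pi : eI (2 * pi) = 1.
Proof. by rewrite mulr_natl /eI cos2pi sin2pi. Qed.

Lemma eIn2pi (n : int) : eI (n%:~R * (2 * pi)) = 1.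
Proof. by rewrite -eI_exprz eI2pi exp1rz. Qed.

Lemma expi_eI x y : eI x = eI y -> expi x = expi y.
Proof. by move=> h; apply: eq_exist; rewrite -/(eI x) -/(eI y). Qed.

Lemma expiD2pi x : expi (x + 2 * pi) = expi x :> circle R.
Proof. by apply: expi_eI; rewrite eID eI2pi mulr1. Qed.

End Modulus.

#[global] Arguments ComplexField.Normc.normc : simpl never.
#[global] Arguments eI : simpl never.

(** * Smooth functions of a real variable *)

Section RealCalculus.
Context {R : realType}.
Implicit Types (f g : R -> R) (x : R).

(** Derivatives are computed by exhibiting them pointwise; this form turns the
    outcome into an equation between functions, as iteration requires. *)
Lemma is_derive1_fun f g : (forall x : R, is_derive x 1 f (g x)) -> f^`() = g.
Proof. by move=> h; apply/funext => x; rewrite derive1E derive_val. Qed.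

Lemma derivable_is_derive1 f x : derivable f x 1 -> is_derive x 1 f (f^`() x).
Proof. by move=> h; rewrite derive1E; exact: derivableP. Qed.

(** Smoothness up to order [n + 1], peeling off the innermost derivative: the
    form in which sums, products and compositions are handled by induction. *)
Fixpoint Ck n f : Prop :=
  (forall x, derivable f x 1) /\ (if n is n'.+1 then Ck n' f^`() else True).

Lemma Ck_le n f : Ck n.+1 f -> Ck n f.
Proof. by elim: n f => [|n IH] f /= [h1 h2]; split=> //; apply: IH. Qed.

Lemma smoothP f : smooth f <-> forall n, Ck n f.
Proof.
split=> [h n|h n x].
  elim: n f h => [|n IH] f h; first by split => // x; apply: (h 0%N).
  split; first by move=> x; apply: (h 0%N).
  by apply: IH => k x; rewrite -derive1Sn; exact: h.
elim: n f h => [|n IH] f h; first by case: (h 0%N).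
by rewrite derive1Sn; apply: IH => k; case: (h k.+1).
Qed.

Lemma smooth_derivable f : smooth f -> forall x, derivable f x 1.
Proof. by move=> h x; exact: (h 0%N). Qed.

Lemma smooth_derive1 f : smooth f -> smooth f^`().
Proof. by move=> h n x; rewrite -derive1Sn; exact: h. Qed.

Lemma smooth_is_derive f x : smooth f -> is_derive x 1 f (f^`() x).
Proof. by move=> h; apply: derivable_is_derive1; exact: smooth_derivable. Qed.

Lemma smooth_continuous f : smooth f -> continuous f.
Proof.
by move=> h x; apply/differentiable_continuous/derivable1_diffP/smooth_derivable.
Qed.

Lemma is_derive1D f g df dg x : is_derive x 1 f df -> is_derive x 1 g dg ->
  is_derive x 1 (fun y => f y + g y) (df + dg).
Proof. by move=> hf hg; apply: is_deriveD. Qed.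

Lemma is_derive1N f df x : is_derive x 1 f df ->
  is_derive x 1 (fun y => - f y) (- df).
Proof. by move=> hf; apply: is_deriveN. Qed.

Lemma is_derive1B f g df dg x : is_derive x 1 f df -> is_derive x 1 g dg ->
  is_derive x 1 (fun y => f y - g y) (df - dg).
Proof. by move=> hf hg; apply: is_deriveB. Qed.

Lemma is_derive1M f g df dg x : is_derive x 1 f df -> is_derive x 1 g dg ->
  is_derive x 1 (fun y => f y * g y) (df * g x + f x * dg).
Proof.
move=> hf hg; apply: is_derive_eq.
by rewrite /GRing.scale/= addrC mulrC.
Qed.

Lemma is_derive1_cst (c x : R) : is_derive x 1 (fun=> c) 0.
Proof. exact: is_derive_cst. Qed.

Lemma is_derive1_id (x : R) : is_derive x 1 (fun y : R => y) 1.
Proof. exact: is_derive_id. Qed.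

Lemma is_derive1_compose f g df dg x : is_derive (g x) 1 f df ->
  is_derive x 1 g dg -> is_derive x 1 (fun y => f (g y)) (df * dg).
Proof. by move=> hf hg; apply: (is_derive1_comp hf hg). Qed.

Lemma is_derive1_inv f df x : f x != 0 -> is_derive x 1 f df ->
  is_derive x 1 (fun y => (f y)^-1) (- (df * ((f x)^-1 * (f x)^-1))).
Proof.
move=> f0 hf; apply: (is_derive_eq (is_deriveV f0 hf)).
by rewrite /GRing.scale/= -exprVn expr2 mulrC mulrN.
Qed.

Lemma Ck_ext n f g : (forall x, f x = g x) -> Ck n f -> Ck n g.
Proof. by move=> /funext ->. Qed.

Lemma Ck_cst n (c : R) : Ck n (fun=> c).
Proof.
elim: n c => [|n IH] c; split=> //; try by move=> x; exact: derivable_cst.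
by rewrite (is_derive1_fun (is_derive1_cst c)).
Qed.

Lemma Ck_step n f g : (forall x : R, is_derive x 1 f (g x)) ->
  (if n is n'.+1 then Ck n' g else True) -> Ck n f.
Proof.
move=> h; case: n => [|n] /= hg; first by split=> // x; case: (h x).
by split; [by move=> x; case: (h x)|rewrite (is_derive1_fun h)].
Qed.

Lemma Ck_is_derive n f x : Ck n f -> is_derive x 1 f (f^`() x).
Proof. by case: n => [|n] [h _]; apply: derivable_is_derive1. Qed.

Lemma CkD n f g : Ck n f -> Ck n g -> Ck n (fun x => f x + g x).
Proof.
elim: n f g => [|n IH] f g hf hg.
all: apply: Ck_step (fun x => is_derive1D (Ck_is_derive x hf) (Ck_is_derive x hg)) _ => //.
by case: hf hg => _ hf [_ hg]; apply: IH.
Qed.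

Lemma CkM n f g : Ck n f -> Ck n g -> Ck n (fun x => f x * g x).
Proof.
elim: n f g => [|n IH] f g hf hg.
all: apply: Ck_step (fun x => is_derive1M (Ck_is_derive x hf) (Ck_is_derive x hg)) _ => //.
by apply: CkD; apply: IH; try exact: Ck_le; [case: hf|case: hg].
Qed.

Lemma CkV n f : (forall x, f x != 0) -> Ck n f -> Ck n (fun x => (f x)^-1).
Proof.
move=> f0; elim: n f f0 => [|n IH] f f0 hf.
all: apply: Ck_step (fun x => is_derive1_inv (f0 x) (Ck_is_derive x hf)) _ => //.
apply: (@Ck_ext _ (fun x => (-1) * (f^`() x * ((f x)^-1 * (f x)^-1)))).
  by move=> x; rewrite mulN1r.
apply: CkM; first exact: Ck_cst.
by apply: CkM; [case: hf|apply: CkM; apply: IH => //; exact: Ck_le].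
Qed.

Lemma Ck_comp n f g : Ck n f -> Ck n g -> Ck n (fun x => f (g x)).
Proof.
elim: n f g => [|n IH] f g hf hg.
all: apply: Ck_step (fun x => is_derive1_compose (Ck_is_derive (g x) hf) (Ck_is_derive x hg)) _ => //.
by apply: CkM; [apply: IH; [case: hf|exact: Ck_le]|case: hg].
Qed.

Lemma smooth_cst (c : R) : smooth (fun=> c).
Proof. by apply/smoothP => n; exact: Ck_cst. Qed.

Lemma smooth_id : smooth (fun x : R => x).
Proof.
apply/smoothP => n; apply: Ck_step is_derive1_id _.
by case: n => // n; exact: Ck_cst.
Qed.

Lemma smoothD f g : smooth f -> smooth g -> smooth (fun x => f x + g x).
Proof. by move=> /smoothP hf /smoothP hg; apply/smoothP => n; exact: CkD. Qed.

Lemma smoothM f g : smooth f -> smooth g -> smooth (fun x => f x * g x).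
Proof. by move=> /smoothP hf /smoothP hg; apply/smoothP => n; exact: CkM. Qed.

Lemma smoothN f : smooth f -> smooth (fun x => - f x).
Proof.
move=> hf; have -> : (fun x => - f x) = (fun x => (-1) * f x).
  by apply/funext => x; rewrite mulN1r.
by apply: smoothM => //; exact: smooth_cst.
Qed.

Lemma smoothB f g : smooth f -> smooth g -> smooth (fun x => f x - g x).
Proof. by move=> hf hg; apply: smoothD => //; exact: smoothN. Qed.

Lemma smoothV f : (forall x, f x != 0) -> smooth f -> smooth (fun x => (f x)^-1).
Proof. by move=> f0 /smoothP hf; apply/smoothP => n; exact: CkV. Qed.

Lemma smooth_comp f g : smooth f -> smooth g -> smooth (fun x => f (g x)).
Proof. by move=> /smoothP hf /smoothP hg; apply/smoothP => n; exact: Ck_comp. Qed.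

Lemma smooth_sin_cos : smooth (@sin R) /\ smooth (@cos R).
Proof.
suff h n : Ck n (@sin R) /\ Ck n (@cos R).
  by split; apply/smoothP => n; case: (h n).
elim: n => [|n [IHs IHc]]; split.
- exact: Ck_step (@is_derive_sin R) _.
- exact: Ck_step (@is_derive_cos R) _.
- exact: Ck_step (@is_derive_sin R) _.
apply: Ck_step (@is_derive_cos R) _.
apply: (@Ck_ext _ (fun x => (-1) * sin x)); first by move=> x; rewrite mulN1r.
by apply: CkM => //; exact: Ck_cst.
Qed.

(** The bound is only asked for between the endpoints, because it is used below
    with a constant that depends on them. *)
Lemma mean_value_le f g (C a b : R) : (forall x : R, is_derive x 1 f (g x)) ->
  (forall x, Num.min a b <= x <= Num.max a b -> `|g x| <= C) ->
  `|f b - f a| <= C * `|b - a|.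
Proof.
move=> hf; wlog ab : a b / a <= b => [H|] hC.
  have [ab|/ltW ba] := leP a b; first exact: H.
  by rewrite distrC [`|b - a|]distrC; apply: H => // x; rewrite minC maxC; exact: hC.
have [c|c hc ->] := MVT_segment ab (fun x _ => hf x).
  apply: continuous_subspaceT => x.
  by apply/differentiable_continuous/derivable1_diffP; case: (hf x).
rewrite normrM ler_wpM2r//; apply: hC.
by rewrite min_l// max_r//; rewrite in_itv/= in hc.
Qed.

End RealCalculus.

Section Periodic.
Context {R : realType}.

Definition per2pi (T : Type) (f : R -> T) := forall x, f (x + 2 * pi) = f x.

Lemma per2pi_int (T : Type) (f : R -> T) (n : int) x :
  per2pi f -> f (x + n%:~R * (2 * pi)) = f x.
Proof.
move=> pf; have nat k y : f (y + k%:R * (2 * pi)) = f y.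
  elim: k y => [|k IH] y; first by rewrite mul0r addr0.
  by rewrite -natr1 mulrDl mul1r addrA pf.
case: n => k; first exact: nat.
rewrite NegzE mulrNz mulNr -(nat k.+1 (x - _)).
by congr f; rewrite subrK.
Qed.

Lemma pi2_gt0 : 0 < 2 * pi :> R.
Proof. by rewrite mulr_gt0// pi_gt0. Qed.

Lemma reduce_2pi (x : R) :
  exists n : int, 0 <= x + n%:~R * (2 * pi) < 2 * pi.
Proof.
exists (- Num.floor (x / (2 * pi))).
have /andP[h1 h2] := floor_itv (x / (2 * pi)).
rewrite mulrNz mulNr subr_ge0 ltrBlDr.
rewrite -ler_pdivlMr ?pi2_gt0// h1/= -[X in _ < X + _]mul1r -mulrDl.
by rewrite -ltr_pdivrMr ?pi2_gt0// addrC -[1]/(1%:~R) -intrD.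
Qed.

Lemma per2pi_bounded (f : R -> R) : continuous f -> per2pi f ->
  exists2 C, 0 < C & forall x, `|f x| <= C.
Proof.
move=> cf pf.
have [|c _ hc] := @EVT_max R (fun x => `|f x|) 0 (2 * pi) (ltW pi2_gt0).
  apply: continuous_subspaceT => x.
  by apply: continuous_comp; [exact: cf|exact: norm_continuous].
exists (`|f c| + 1) => [|x]; first by rewrite ltr_wpDl.
have [n /andP[h0 h1]] := reduce_2pi x.
rewrite -(per2pi_int n x pf) (le_trans (hc _ _))//; last by rewrite lerDl.
by rewrite in_itv/= h0 ltW.
Qed.

Lemma per2pi_derive1 (f : R -> R) : smooth f -> per2pi f -> per2pi f^`().
Proof.
move=> sf pf x.
have pfE : (fun y => f (y + 2 * pi)) = f by apply/funext.
have h (y : R) : is_derive y 1 (fun z => f (z + 2 * pi)) (f^`() (y + 2 * pi) * (1 + 0)).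
  have h1 := is_derive1D (is_derive1_id y) (is_derive1_cst (2 * pi) y).
  exact: (@is_derive1_compose _ f (fun z => z + 2 * pi) _ _ y (smooth_is_derive (y + 2 * pi) sf) h1).
have e := is_derive1_fun h; rewrite pfE in e.
by rewrite [RHS](congr1 (fun g => g x) e) addr0 mulr1.
Qed.

End Periodic.

(** * Complex-valued smooth functions and their integrals *)

Section ComplexCalculus.
Context {R : realType}.
Implicit Types (f g : R -> R[i]) (theta a : R -> R).

Definition csmooth f :=
  smooth (fun x => complex.Re (f x)) /\ smooth (fun x => complex.Im (f x)).

Definition cD f : R -> R[i] := fun x =>
  (fun y => complex.Re (f y))^`() x +i* (fun y => complex.Im (f y))^`() x.

Lemma csmooth_ext f g : (forall x, f x = g x) -> csmooth f -> csmooth g.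
Proof. by move=> /funext ->. Qed.

Lemma csmooth_cD f : csmooth f -> csmooth (cD f).
Proof. by move=> [h1 h2]; split; [exact: smooth_derive1 h1|exact: smooth_derive1 h2]. Qed.

Lemma csmoothD f g : csmooth f -> csmooth g -> csmooth (fun x => f x + g x).
Proof.
move=> [f1 f2] [g1 g2]; split.
  by under eq_fun do rewrite cReD; exact: smoothD.
by under eq_fun do rewrite cImD; exact: smoothD.
Qed.

Lemma csmoothM f g : csmooth f -> csmooth g -> csmooth (fun x => f x * g x).
Proof.
move=> [f1 f2] [g1 g2]; split.
  by under eq_fun do rewrite cReM; apply: smoothB; exact: smoothM.
by under eq_fun do rewrite cImM; apply: smoothD; exact: smoothM.
Qed.

Lemma csmooth_cst (c : R[i]) : csmooth (fun=> c).
Proof. by split; exact: smooth_cst. Qed.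

Lemma csmoothB f g : csmooth f -> csmooth g -> csmooth (fun x => f x - g x).
Proof.
move=> hf hg; apply: (@csmooth_ext (fun x => f x + (-1) * g x)).
  by move=> x; rewrite mulN1r.
exact: csmoothD hf (csmoothM (csmooth_cst (-1)) hg).
Qed.

Lemma csmooth_conj f : csmooth f -> csmooth (fun x => (f x)^*%C).
Proof.
move=> [f1 f2]; split.
  by have -> : (fun x => complex.Re (f x)^*%C) = (fun x => complex.Re (f x))
    by apply/funext => x; case: (f x).
have -> : (fun x => complex.Im (f x)^*%C) = (fun x => - complex.Im (f x)).
  by apply/funext => x; case: (f x).
exact: smoothN.
Qed.

Lemma csmooth_real a : smooth a -> csmooth (fun x => (a x)%:C).
Proof. by move=> h; split; [exact: h|exact: smooth_cst]. Qed.

Lemma csmooth_eI theta : smooth theta -> csmooth (fun x => eI (theta x)).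
Proof.
move=> h; have [hs hc] := @smooth_sin_cos R.
by split; exact: smooth_comp.
Qed.

Lemma csmooth_comp f theta : csmooth f -> smooth theta ->
  csmooth (fun x => f (theta x)).
Proof.
move=> [f1 f2] ht; split; first exact: (smooth_comp f1 ht).
exact: (smooth_comp f2 ht).
Qed.

Lemma csmooth_sum (I : Type) (r : seq I) (F : I -> R -> R[i]) :
  (forall i, csmooth (F i)) -> csmooth (fun x => \sum_(i <- r) F i x).
Proof.
move=> h; elim: r => [|i r IH].
  by apply: (@csmooth_ext (fun=> 0)); [move=> x; rewrite big_nil|exact: csmooth_cst].
apply: (@csmooth_ext (fun x => F i x + \sum_(j <- r) F j x)).
  by move=> x; rewrite big_cons.
exact: csmoothD (h i) IH.
Qed.

Lemma cD_cst (c : R[i]) : cD (fun=> c) = fun=> 0.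
Proof.
by apply/funext => x; rewrite /cD !(is_derive1_fun (is_derive1_cst _)).
Qed.

Lemma cDD f g : csmooth f -> csmooth g ->
  cD (fun x => f x + g x) = fun x => cD f x + cD g x.
Proof.
move=> [f1 f2] [g1 g2]; apply/funext => x; rewrite /cD.
have -> : (fun y => complex.Re (f y + g y)) =
  fun y => complex.Re (f y) + complex.Re (g y) by apply/funext => y; rewrite cReD.
have -> : (fun y => complex.Im (f y + g y)) =
  fun y => complex.Im (f y) + complex.Im (g y) by apply/funext => y; rewrite cImD.
rewrite (is_derive1_fun (fun y => is_derive1D (smooth_is_derive y f1) (smooth_is_derive y g1))).
by rewrite (is_derive1_fun (fun y => is_derive1D (smooth_is_derive y f2) (smooth_is_derive y g2))).
Qed.

Lemma cDM f g : csmooth f -> csmooth g ->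
  cD (fun x => f x * g x) = fun x => cD f x * g x + f x * cD g x.
Proof.
move=> [f1 f2] [g1 g2]; apply/funext => x; rewrite /cD.
have -> : (fun y => complex.Re (f y * g y)) =
  fun y => complex.Re (f y) * complex.Re (g y) - complex.Im (f y) * complex.Im (g y).
  by apply/funext => y; rewrite cReM.
have -> : (fun y => complex.Im (f y * g y)) =
  fun y => complex.Re (f y) * complex.Im (g y) + complex.Im (f y) * complex.Re (g y).
  by apply/funext => y; rewrite cImM.
have d := smooth_is_derive.
rewrite (is_derive1_fun (fun y => is_derive1B
  (is_derive1M (d _ _ y f1) (d _ _ y g1)) (is_derive1M (d _ _ y f2) (d _ _ y g2)))).
rewrite (is_derive1_fun (fun y => is_derive1D
  (is_derive1M (d _ _ y f1) (d _ _ y g2)) (is_derive1M (d _ _ y f2) (d _ _ y g1)))).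
by apply: complex_ext; rewrite !(cReD, cImD, cReM, cImM)/=; ring.
Qed.

Lemma cDZ (c : R[i]) f : csmooth f -> cD (fun x => c * f x) = fun x => c * cD f x.
Proof.
move=> hf; rewrite (cDM (csmooth_cst c) hf).
by apply/funext => x; rewrite cD_cst mul0r add0r.
Qed.

Lemma cDB f g : csmooth f -> csmooth g ->
  cD (fun x => f x - g x) = fun x => cD f x - cD g x.
Proof.
move=> hf hg.
have -> : (fun x => f x - g x) = fun x => f x + (-1) * g x.
  by apply/funext => x; rewrite mulN1r.
rewrite (cDD hf (csmoothM (csmooth_cst (-1)) hg)) (cDZ _ hg).
by apply/funext => x; rewrite mulN1r.
Qed.

Lemma cD_sum (I : Type) (r : seq I) (F : I -> R -> R[i]) :
  (forall i, csmooth (F i)) ->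
  cD (fun x => \sum_(i <- r) F i x) = fun x => \sum_(i <- r) cD (F i) x.
Proof.
move=> h; elim: r => [|i r IH].
  have -> : (fun x => \sum_(i <- [::]) F i x) = fun=> 0.
    by apply/funext => x; rewrite big_nil.
  by rewrite cD_cst; apply/funext => x; rewrite big_nil.
have -> : (fun x => \sum_(j <- i :: r) F j x) = fun x => F i x + \sum_(j <- r) F j x.
  by apply/funext => x; rewrite big_cons.
rewrite (cDD (h i) (csmooth_sum r h)).
by rewrite IH; apply/funext => x; rewrite big_cons.
Qed.

Lemma cD_eI theta : smooth theta ->
  cD (fun x => eI (theta x)) = fun x => 'i * (theta^`() x)%:C * eI (theta x).
Proof.
move=> h; apply/funext => x; rewrite /cD /eI/=.
rewrite (is_derive1_fun (fun y => is_derive1_compose (is_derive_cos _) (smooth_is_derive y h))).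
rewrite (is_derive1_fun (fun y => is_derive1_compose (is_derive_sin _) (smooth_is_derive y h))).
by apply: complex_ext => /=; ring.
Qed.

Lemma cD_real a : smooth a -> cD (fun x => (a x)%:C) = fun x => (a^`() x)%:C.
Proof.
by move=> h; apply/funext => x; rewrite /cD/= (is_derive1_fun (is_derive1_cst _)).
Qed.

Lemma cD_comp f theta : csmooth f -> smooth theta ->
  cD (fun x => f (theta x)) = fun x => (theta^`() x)%:C * cD f (theta x).
Proof.
move=> [f1 f2] ht; apply/funext => x; rewrite /cD.
rewrite (is_derive1_fun (fun y => is_derive1_compose (smooth_is_derive _ f1) (smooth_is_derive y ht))).
rewrite (is_derive1_fun (fun y => is_derive1_compose (smooth_is_derive _ f2) (smooth_is_derive y ht))).
by apply: complex_ext => /=; ring.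
Qed.

Lemma per2pi_cD f : csmooth f -> per2pi f -> per2pi (cD f).
Proof.
move=> [f1 f2] pf x; rewrite /cD.
rewrite (per2pi_derive1 f1) ?(per2pi_derive1 f2)// => y; by rewrite pf.
Qed.

Lemma csmooth_bounded f : csmooth f -> per2pi f ->
  exists2 C, 0 < C & forall x, normc (f x) <= C.
Proof.
move=> [f1 f2] pf.
have [|C C0 hC] := per2pi_bounded (smooth_continuous f1); first by move=> x; rewrite pf.
have [|D D0 hD] := per2pi_bounded (smooth_continuous f2); first by move=> x; rewrite pf.
exists (C + D) => [|x]; first exact: addr_gt0.
by rewrite (le_trans (normc_le_ReIm _))// lerD.
Qed.

End ComplexCalculus.

Section RealIntegral.
Context {R : realType}.
Implicit Types (f g : R -> R).
Notation mu := (@lebesgue_measure R).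
Notation D := (`[0, 2 * pi]%classic : set (measurableTypeR R)).

Definition rintegrable (f : R -> R) := mu.-integrable D (EFin \o f).

Lemma mD : measurable D. Proof. exact: measurable_itv. Qed.

Lemma mu_circle : mu D = (2 * pi)%:E :> \bar R.
Proof. by rewrite lebesgue_measure_itv/= lte_fin pi2_gt0 sube0. Qed.

Lemma rintegrableD (f g : R -> R) : rintegrable f -> rintegrable g ->
  rintegrable (fun x => f x + g x).
Proof.
by move=> hf hg; have := integrableD mD hf hg; apply: eq_integrable.
Qed.

Lemma rintegrableN (f : R -> R) : rintegrable f -> rintegrable (fun x => - f x).
Proof. by move=> hf; have := integrableN hf; apply: eq_integrable. Qed.

Lemma rintegrableB (f g : R -> R) : rintegrable f -> rintegrable g ->
  rintegrable (fun x => f x - g x).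
Proof. by move=> hf hg; apply: rintegrableD => //; exact: rintegrableN. Qed.

Lemma rintegrableZ (c : R) (f : R -> R) : rintegrable f ->
  rintegrable (fun x => c * f x).
Proof.
by move=> hf; have := @integrableZl _ _ _ mu _ mD c _ hf; apply: eq_integrable.
Qed.

Lemma rintegrable_bounded (f : R -> R) (C : R) :
  measurable_fun D f -> (forall x, D x -> `|f x| <= C) -> rintegrable f.
Proof.
move=> mf hf; apply: measurable_bounded_integrable => //.
  by rewrite [X in (X < _)%E]mu_circle ltry.
exists C; split; first exact: num_real.
by move=> M CM x Dx /=; rewrite (le_trans (hf x Dx))// ltW.
Qed.

Lemma rintegrable_measurable (f : R -> R) : rintegrable f -> measurable_fun D f.
Proof. by move=> /integrableP[] /measurable_EFinP. Qed.

Lemma rintegrable_continuous (f : R -> R) : continuous f -> rintegrable f.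
Proof.
move=> cf; apply: continuous_compact_integrable; first exact: segment_compact.
exact: continuous_subspaceT.
Qed.

Lemma rintegrable_cst (c : R) : rintegrable (fun=> c).
Proof. by apply: rintegrable_continuous => x; exact: cvg_cst. Qed.

Lemma rintegrable_norm (f : R -> R) : rintegrable f -> rintegrable (fun x => `|f x|).
Proof. by move=> hf; have := integrable_norm hf; apply: eq_integrable. Qed.

Lemma rintegrableM (f g : R -> R) (C : R) : rintegrable f -> measurable_fun D g ->
  (forall x, D x -> `|g x| <= C) -> rintegrable (fun x => f x * g x).
Proof.
move=> hf mg hg.
have h : rintegrable (fun x => C * `|f x|) by apply/rintegrableZ/rintegrable_norm.
apply: (le_integrable _ _ _ h) => //.
  apply/measurable_EFinP; apply: measurable_funM => //.
  exact: rintegrable_measurable.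
move=> x Dx; rewrite lee_fin normrM mulrC.
by rewrite (le_trans _ (ler_norm _))// ler_wpM2r// hg.
Qed.

Definition rint (f : R -> R) : R := \int[mu]_(x in D) f x.

Lemma rintD f g : rintegrable f -> rintegrable g ->
  rint (fun x => f x + g x) = rint f + rint g.
Proof. by move=> hf hg; rewrite /rint RintegralD. Qed.

Lemma rintB f g : rintegrable f -> rintegrable g ->
  rint (fun x => f x - g x) = rint f - rint g.
Proof. by move=> hf hg; rewrite /rint RintegralB. Qed.

Lemma rintZ c f : rintegrable f -> rint (fun x => c * f x) = c * rint f.
Proof. by move=> hf; rewrite /rint RintegralZl. Qed.

Lemma rint_cst c : rint (fun=> c) = 2 * pi * c.
Proof.
by rewrite /rint Rintegral_cst// [X in fine X]mu_circle/= mulrC.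
Qed.

Lemma eq_rint f g : (forall x, D x -> f x = g x) -> rint f = rint g.
Proof. by move=> h; apply: eq_Rintegral => x; rewrite inE => /h. Qed.

Lemma le_rint f g : rintegrable f -> rintegrable g ->
  (forall x, D x -> f x <= g x) -> rint f <= rint g.
Proof. by move=> hf hg h; apply: le_Rintegral. Qed.

Lemma rint_ge0 f : (forall x, D x -> 0 <= f x) -> 0 <= rint f.
Proof. by move=> h; apply: Rintegral_ge0. Qed.

Lemma normr_rint f g : rintegrable f -> rintegrable g ->
  (forall x, D x -> `|f x| <= g x) -> `|rint f| <= rint g.
Proof.
move=> hf hg h; rewrite (le_trans (le_normr_Rintegral _ _))//.
by apply: le_rint => //; exact: rintegrable_norm.
Qed.

End RealIntegral.

Section ComplexIntegral.
Context {R : realType}.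
Implicit Types (f g : R -> R[i]).
Notation D := (`[0, 2 * pi]%classic : set (measurableTypeR R)).

Definition cintegrable f :=
  rintegrable (fun x => complex.Re (f x)) /\ rintegrable (fun x => complex.Im (f x)).

Definition cmeasurable f :=
  measurable_fun D (fun x => complex.Re (f x)) /\
  measurable_fun D (fun x => complex.Im (f x)).

Lemma circle_intE f : circle_int f =
  rint (fun x => complex.Re (f x)) +i* rint (fun x => complex.Im (f x)).
Proof. by []. Qed.

Lemma cintegrable_ext f g : (forall x, f x = g x) -> cintegrable f -> cintegrable g.
Proof. by move=> /funext ->. Qed.

Lemma eq_circle_int f g : (forall x, D x -> f x = g x) -> circle_int f = circle_int g.
Proof.
by move=> h; rewrite !circle_intE; congr (_ +i* _); apply: eq_rint => x Dx; rewrite h.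
Qed.

Lemma csmooth_integrable f : csmooth f -> cintegrable f.
Proof.
by move=> [f1 f2]; split; apply/rintegrable_continuous/smooth_continuous.
Qed.

Lemma csmooth_measurable f : csmooth f -> cmeasurable f.
Proof.
by move=> /csmooth_integrable[f1 f2]; split; exact: rintegrable_measurable.
Qed.

Lemma cintegrableD f g : cintegrable f -> cintegrable g ->
  cintegrable (fun x => f x + g x).
Proof.
move=> [f1 f2] [g1 g2]; split.
  by under eq_fun do rewrite cReD; exact: rintegrableD.
by under eq_fun do rewrite cImD; exact: rintegrableD.
Qed.

Lemma cintegrableM f g (C : R) : cintegrable f -> cmeasurable g ->
  (forall x, D x -> normc (g x) <= C) -> cintegrable (fun x => f x * g x).
Proof.
move=> [f1 f2] [g1 g2] hC.
have hR x : D x -> `|complex.Re (g x)| <= C.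
  by move=> Dx; rewrite (le_trans (normc_Re _))// hC.
have hI x : D x -> `|complex.Im (g x)| <= C.
  by move=> Dx; rewrite (le_trans (normc_Im _))// hC.
split.
  by under eq_fun do rewrite cReM; apply: rintegrableB; exact: (@rintegrableM _ _ _ C).
by under eq_fun do rewrite cImM; apply: rintegrableD; exact: (@rintegrableM _ _ _ C).
Qed.

Lemma cintegrable_bounded f C : cmeasurable f ->
  (forall x, D x -> normc (f x) <= C) -> cintegrable f.
Proof.
move=> [f1 f2] hC; split; apply: (@rintegrable_bounded _ _ C) => // x Dx.
  by rewrite (le_trans (normc_Re _))// hC.
by rewrite (le_trans (normc_Im _))// hC.
Qed.

Lemma cintegrableMs f g : cintegrable f -> csmooth g ->
  cintegrable (fun x => f x * g x).
Proof.
move=> hf sg; have [g1 g2] := sg.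
have bnd (h : R -> R) : smooth h -> exists C, forall x, D x -> `|h x| <= C.
  move=> sh; have [|c _ hc] := @EVT_max R (fun x => `|h x|) 0 (2 * pi) (ltW pi2_gt0).
    apply: continuous_subspaceT => x.
    by apply: continuous_comp; [exact: smooth_continuous|exact: norm_continuous].
  by exists `|h c| => x Dx; exact: hc.
have [A hA] := bnd _ g1; have [B hB] := bnd _ g2.
apply: (@cintegrableM _ _ (A + B)) => //; first exact: csmooth_measurable.
by move=> x Dx; rewrite (le_trans (normc_le_ReIm _))// lerD ?hA ?hB.
Qed.

Lemma cintegrableZ (c : R[i]) f : cintegrable f -> cintegrable (fun x => c * f x).
Proof.
move=> hf; apply: (@cintegrable_ext (fun x => f x * c)).
  by move=> x; rewrite mulrC.
exact: cintegrableMs hf (csmooth_cst c).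
Qed.

Lemma cintegrableB f g : cintegrable f -> cintegrable g ->
  cintegrable (fun x => f x - g x).
Proof.
move=> hf hg; apply: (@cintegrable_ext (fun x => f x + (-1) * g x)).
  by move=> x; rewrite mulN1r.
exact: cintegrableD hf (cintegrableZ _ hg).
Qed.

Lemma circle_intD f g : cintegrable f -> cintegrable g ->
  circle_int (fun x => f x + g x) = circle_int f + circle_int g.
Proof.
move=> [f1 f2] [g1 g2]; rewrite !circle_intE; apply: complex_ext.
  by rewrite cReD/= -rintD//; apply: eq_rint => x _; rewrite cReD.
by rewrite cImD/= -rintD//; apply: eq_rint => x _; rewrite cImD.
Qed.

Lemma circle_intZ (c : R[i]) f : cintegrable f ->
  circle_int (fun x => c * f x) = c * circle_int f.
Proof.
move=> [f1 f2]; rewrite !circle_intE; apply: complex_ext.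
  rewrite cReM/= -!rintZ// -rintB ?rintegrableZ//.
  by apply: eq_rint => x _; rewrite cReM.
rewrite cImM/= -!rintZ// -rintD ?rintegrableZ//.
by apply: eq_rint => x _; rewrite cImM.
Qed.

Lemma circle_intB f g : cintegrable f -> cintegrable g ->
  circle_int (fun x => f x - g x) = circle_int f - circle_int g.
Proof.
move=> hf hg; rewrite -mulN1r -circle_intZ// -circle_intD//; last exact: cintegrableZ.
by apply: eq_circle_int => x _; rewrite mulN1r.
Qed.

Lemma circle_int0 : circle_int (fun=> 0 : R[i]) = 0.
Proof. by rewrite circle_intE/= rint_cst mulr0. Qed.

Lemma circle_int_sum (I : Type) (r : seq I) (F : I -> R -> R[i]) :
  (forall i, cintegrable (F i)) ->
  circle_int (fun x => \sum_(i <- r) F i x) = \sum_(i <- r) circle_int (F i) /\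
  cintegrable (fun x => \sum_(i <- r) F i x).
Proof.
move=> h; elim: r => [|i r [IH1 IH2]].
  split.
    rewrite big_nil -[RHS]circle_int0.
    by apply: eq_circle_int => x _; rewrite big_nil.
  apply: (@cintegrable_ext (fun=> 0)); first by move=> x; rewrite big_nil.
  exact: csmooth_integrable (csmooth_cst 0).
rewrite big_cons -IH1 -circle_intD//; split.
  by apply: eq_circle_int => x _; rewrite big_cons.
apply: (@cintegrable_ext (fun x => F i x + \sum_(j <- r) F j x)).
  by move=> x; rewrite big_cons.
exact: cintegrableD.
Qed.

(** The factor 2 comes from estimating real and imaginary parts separately. *)
Lemma normc_circle_int f (k : R -> R) : cintegrable f -> rintegrable k ->
  (forall x, D x -> normc (f x) <= k x) -> normc (circle_int f) <= 2 * rint k.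
Proof.
move=> [f1 f2] hk h; rewrite circle_intE (le_trans (normc_le_ReIm _))//=.
rewrite mulr_natl mulr2n lerD//; apply: normr_rint => // x Dx.
  by rewrite (le_trans (normc_Re _))// h.
by rewrite (le_trans (normc_Im _))// h.
Qed.

Lemma circle_int_conj f : cintegrable f ->
  circle_int (fun x => (f x)^*%C) = (circle_int f)^*%C.
Proof.
move=> [f1 f2]; rewrite !circle_intE/=; congr (_ +i* _).
  by apply: eq_rint => x _; case: (f x).
rewrite -mulN1r -rintZ//; apply: eq_rint => x _; rewrite mulN1r.
by case: (f x).
Qed.

(** Fundamental theorem of calculus: the boundary terms cancel by periodicity. *)
Lemma circle_int_cD f : csmooth f -> per2pi f -> circle_int (cD f) = 0.
Proof.
suff key (g : R -> R) : smooth g -> per2pi g -> rint g^`() = 0.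
  move=> [f1 f2] pf; rewrite circle_intE/=.
  by rewrite (key _ f1) ?(key _ f2)// => x; rewrite pf.
move=> sg pg; rewrite /rint /Rintegral (@continuous_FTC2 _ _ g)//.
- by rewrite -EFinB/= -[in g (2 * pi)](add0r (2 * pi)) pg subrr.
- exact: pi2_gt0.
- by apply: continuous_subspaceT => x; apply: smooth_continuous; exact: smooth_derive1.
- have cg := smooth_continuous sg.
  split=> [x _| |]; first exact: smooth_derivable.
  + exact: cvg_at_right_filter (cg 0).
  + exact: cvg_at_left_filter (cg (2 * pi)).
Qed.

(** The analogue of [fourier] for functions of the angle; the functions that
    arise from lifts are defined on the line and not on the circle. *)
Definition fc f (n : int) : R[i] :=
  ((2 * pi)^-1)%:C * circle_int (fun x => f x * eI (- (n%:~R * x))).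

#[global] Arguments fc : simpl never.

Lemma fourier_fc (u : cfun R) n : fourier u n = fc (fun x => u (expi x)) n.
Proof.
rewrite /fourier /fc; congr (_ * _); apply: eq_circle_int => x _.
by rewrite chi_expi mulrNz mulNr.
Qed.

Lemma eq_fc f g n : (forall x, D x -> f x = g x) -> fc f n = fc g n.
Proof. by move=> h; congr (_ * _); apply: eq_circle_int => x /h ->. Qed.

Lemma smooth_mul (a : R) : smooth (fun x => a * x).
Proof. exact: smoothM (@smooth_cst R a) (@smooth_id R). Qed.

Lemma derive1_mul (a : R) : (fun x => a * x)^`() = fun=> a.
Proof.
rewrite (is_derive1_fun (fun y => is_derive1M (is_derive1_cst a y) (is_derive1_id y))).
by apply/funext => x; rewrite mul0r add0r mulr1.
Qed.

Lemma csmooth_eIn (a : R) : csmooth (fun x => eI (a * x)).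
Proof. exact: csmooth_eI (@smooth_mul a). Qed.

Lemma csmooth_eInN (a : R) : csmooth (fun x => eI (- (a * x))).
Proof. exact: csmooth_eI (smoothN (@smooth_mul a)). Qed.

Lemma per2pi_eIn (n : int) : per2pi (fun x : R => eI (n%:~R * x)).
Proof. by move=> x; rewrite mulrDr eID eIn2pi mulr1. Qed.

Lemma fcD f g n : cintegrable f -> cintegrable g ->
  fc (fun x => f x + g x) n = fc f n + fc g n.
Proof.
move=> hf hg; rewrite /fc -mulrDr -circle_intD; first last.
- exact: cintegrableMs hg (csmooth_eInN _).
- exact: cintegrableMs hf (csmooth_eInN _).
by congr (_ * _); apply: eq_circle_int => x _; rewrite mulrDl.
Qed.

Lemma fcZ (c : R[i]) f n : cintegrable f -> fc (fun x => c * f x) n = c * fc f n.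
Proof.
move=> hf; rewrite /fc mulrCA -(circle_intZ c (cintegrableMs hf (csmooth_eInN n%:~R))).
by congr (_ * _); apply: eq_circle_int => x _; rewrite mulrA.
Qed.

Lemma fcB f g n : cintegrable f -> cintegrable g ->
  fc (fun x => f x - g x) n = fc f n - fc g n.
Proof.
move=> hf hg; rewrite -[- fc g n]mulN1r -fcZ// -fcD//; last exact: cintegrableZ.
by apply: eq_fc => x _; rewrite mulN1r.
Qed.

Lemma fc_sum (I : Type) (r : seq I) (F : I -> R -> R[i]) n :
  (forall i, cintegrable (F i)) ->
  fc (fun x => \sum_(i <- r) F i x) n = \sum_(i <- r) fc (F i) n.
Proof.
move=> h; rewrite /fc -mulr_sumr; congr (_ * _).
have [<- _] := circle_int_sum r
  (fun i => cintegrableMs (h i) (csmooth_eInN (n%:~R))).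
by apply: eq_circle_int => x _; rewrite mulr_suml.
Qed.

Lemma normc_fc f n (k : R -> R) : cintegrable f -> rintegrable k ->
  (forall x, D x -> normc (f x) <= k x) -> normc (fc f n) <= pi^-1 * rint k.
Proof.
move=> hf hk h; rewrite /fc ComplexField.Normc.normcM normcR.
rewrite ger0_norm ?invr_ge0 ?(ltW pi2_gt0)// invfM.
have aux (p r : R) : p != 0 -> p^-1 * r = 2^-1 / p * (2 * r) by move=> p0; field.
rewrite (aux _ (rint k) (lt0r_neq0 (pi_gt0 R))).
rewrite ler_wpM2l ?mulr_ge0 ?invr_ge0 ?pi_ge0//.
apply: normc_circle_int => //; first exact: cintegrableMs hf (csmooth_eInN _).
by move=> x Dx; rewrite ComplexField.Normc.normcM normc_eI mulr1 h.
Qed.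

Lemma normc_fc_bounded f n C : cintegrable f ->
  (forall x, D x -> normc (f x) <= C) -> normc (fc f n) <= 2 * C.
Proof.
move=> hf h; rewrite (le_trans (normc_fc n hf (rintegrable_cst C) h))// rint_cst.
by rewrite mulrA (mulrC 2) mulrA mulVf ?mul1r// gt_eqF// pi_gt0.
Qed.

Lemma fc_cD f n : csmooth f -> per2pi f -> fc (cD f) n = 'i * n%:~R * fc f n.
Proof.
move=> sf pf.
have se := csmooth_eInN (n%:~R : R).
have pe : per2pi (fun x => f x * eI (- (n%:~R * x))).
  by move=> x; rewrite pf mulrDr opprD eID -[- (_ * (2 * pi))]mulNr -mulrNz eIn2pi mulr1.
have := circle_int_cD (csmoothM sf se).
have -> : cD (fun x => f x * eI (- (n%:~R * x))) = fun x =>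
    cD f x * eI (- (n%:~R * x)) - 'i * n%:~R * (f x * eI (- (n%:~R * x))).
  rewrite (cDM sf se) cD_eI; last exact: smoothN (@smooth_mul _).
  apply/funext => x; congr (_ + _).
  have -> : (fun x : R => - (n%:~R * x)) = fun x => (- n%:~R) * x.
    by apply/funext => y; rewrite mulNr.
  have e : (- n%:~R : R)%:C = - n%:~R :> R[i] by rewrite rmorphN rmorph_int.
  by rewrite derive1_mul e; ring.
rewrite circle_intB; first last.
- by apply: cintegrableZ; apply: cintegrableMs se; exact: csmooth_integrable.
- by apply: cintegrableMs se; apply: csmooth_integrable; exact: csmooth_cD.
rewrite circle_intZ; last by apply: cintegrableMs se; exact: csmooth_integrable.
by move=> /(_ pe)/subr0_eq h; rewrite /fc h mulrCA.
Qed.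

(** Two integrations by parts give quadratic decay. *)
Lemma fc_decay f (C : R) n : csmooth f -> per2pi f ->
  (forall x, normc (cD (cD f) x) <= C) -> n != 0 ->
  normc (fc f n) <= 2 * C / (n%:~R ^+ 2).
Proof.
move=> sf pf hC n0.
have sf' := csmooth_cD sf.
have h : fc (cD (cD f)) n = - (n%:~R ^+ 2) * fc f n.
  rewrite fc_cD ?fc_cD//; last exact: per2pi_cD.
  have i2 : 'i * 'i = -1 :> R[i] by rewrite -expr2 sqr_i.
  transitivity (('i * 'i) * n%:~R ^+ 2 * fc f n); first by ring.
  by rewrite i2 mulN1r.
have n2 : 0 < (n%:~R : R) ^+ 2 by rewrite exprn_even_gt0/= ?intr_eq0.
rewrite ler_pdivlMr// mulrC.
have := @normc_fc_bounded (cD (cD f)) n C (csmooth_integrable (csmooth_cD sf')) (fun x _ => hC x).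
rewrite h ComplexField.Normc.normcM normcN -(rmorph_int (real_complex R)) -rmorphXn normcR.
by rewrite ger0_norm// ltW.
Qed.

Lemma fc_eI (k n : int) : fc (fun x => eI (k%:~R * x)) n = (k == n)%:R.
Proof.
have [<-|kn] := eqVneq k n.
  rewrite /fc (@eq_circle_int _ (fun=> 1)); last by move=> x _; rewrite eIMN.
  rewrite circle_intE/= !rint_cst mulr0 mulr1.
  rewrite -[X in X = _]/((2 * pi)^-1%:C * (2 * pi)%:C) -rmorphM mulVf ?rmorph1//=; last first.
    exact: lt0r_neq0 pi2_gt0.
have := fc_cD n (csmooth_eIn k%:~R) (@per2pi_eIn k).
rewrite cD_eI; last exact: (@smooth_mul _).
rewrite derive1_mul fcZ; last exact: csmooth_integrable (csmooth_eIn _).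
rewrite rmorph_int => /eqP; rewrite -subr_eq0 -mulrBl mulf_eq0 -mulrBr mulf_eq0.
rewrite -intrB intr_eq0 subr_eq0 (negPf kn) orbF => /orP[|/eqP//].
by rewrite eq_complex/= oner_eq0 andbF.
Qed.

End ComplexIntegral.

(** * Fourier inversion for smooth functions *)

Section Bessel.
Context {R : realType}.
Implicit Types (f g : R -> R[i]).
Notation D := (`[0, 2 * pi]%classic : set (measurableTypeR R)).

Definition cbounded f := cmeasurable f /\ exists C, forall x, D x -> normc (f x) <= C.

Lemma cbounded_integrable f : cbounded f -> cintegrable f.
Proof. by move=> [mf [C hC]]; exact: cintegrable_bounded mf hC. Qed.

Lemma cmeasurableD f g : cmeasurable f -> cmeasurable g ->
  cmeasurable (fun x => f x + g x).
Proof.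
move=> [f1 f2] [g1 g2]; split.
  have -> : (fun x => complex.Re (f x + g x)) =
    (fun x => complex.Re (f x) + complex.Re (g x)) by apply/funext => x; rewrite cReD.
  exact: measurable_funD.
have -> : (fun x => complex.Im (f x + g x)) =
  (fun x => complex.Im (f x) + complex.Im (g x)) by apply/funext => x; rewrite cImD.
exact: measurable_funD.
Qed.

Lemma cmeasurableM f g : cmeasurable f -> cmeasurable g ->
  cmeasurable (fun x => f x * g x).
Proof.
move=> [f1 f2] [g1 g2]; split.
  have -> : (fun x => complex.Re (f x * g x)) = (fun x =>
      complex.Re (f x) * complex.Re (g x) - complex.Im (f x) * complex.Im (g x)).
    by apply/funext => x; rewrite cReM.
  by apply: measurable_funB; exact: measurable_funM.
have -> : (fun x => complex.Im (f x * g x)) = (fun x =>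
    complex.Re (f x) * complex.Im (g x) + complex.Im (f x) * complex.Re (g x)).
  by apply/funext => x; rewrite cImM.
by apply: measurable_funD; exact: measurable_funM.
Qed.

Lemma measurable_invr : measurable_fun [set: measurableTypeR R] (fun x : R => x^-1).
Proof.
rewrite -(setUv [set 0 : R]); apply/measurable_funU.
- exact: measurable_set1.
- by apply: measurableC; exact: measurable_set1.
split; first exact: measurable_fun_set1.
apply: open_continuous_measurable_fun.
  by apply: closed_openC; exact: accessible_closed_set1 (@hausdorff_accessible _ (@Rhausdorff R)) _.
move=> x; rewrite inE/= => /eqP x0; exact: inv_continuous.
Qed.

Lemma cmeasurableV f : cmeasurable f -> cmeasurable (fun x => (f x)^-1).
Proof.
move=> [f1 f2].
have m : measurable_fun D (fun x => (complex.Re (f x) ^+ 2 + complex.Im (f x) ^+ 2)^-1).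
  apply: (measurableT_comp measurable_invr).
  by apply: measurable_funD; exact: measurable_funX.
split.
  have -> : (fun x => complex.Re (f x)^-1) = (fun x => complex.Re (f x) *
      (complex.Re (f x) ^+ 2 + complex.Im (f x) ^+ 2)^-1).
    by apply/funext => x; case: (f x) => a b.
  exact: measurable_funM.
have -> : (fun x => complex.Im (f x)^-1) = (fun x => - (complex.Im (f x) *
    (complex.Re (f x) ^+ 2 + complex.Im (f x) ^+ 2)^-1)).
  by apply/funext => x; case: (f x) => a b.
apply: measurableT_comp; last exact: measurable_funM.
exact: oppr_measurable.
Qed.

Lemma cmeasurable_normc2 f : cmeasurable f -> measurable_fun D (fun x => normc (f x) ^+ 2).
Proof.
move=> [f1 f2].
have -> : (fun x => normc (f x) ^+ 2) =
  (fun x => complex.Re (f x) ^+ 2 + complex.Im (f x) ^+ 2).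
  by apply/funext => x; rewrite normc_sqr.
by apply: measurable_funD; exact: measurable_funX.
Qed.

Definition norm2 f : R := rint (fun x => normc (f x) ^+ 2).

Lemma cbounded_norm2 f : cbounded f -> rintegrable (fun x => normc (f x) ^+ 2).
Proof.
move=> [mf [C hC]]; apply: (@rintegrable_bounded _ _ (C ^+ 2)).
  exact: cmeasurable_normc2.
move=> x Dx; rewrite ger0_norm ?sqr_ge0// ler_pXn2r ?nnegrE ?normc_ge0 ?hC//.
by rewrite (le_trans _ (hC x Dx))// normc_ge0.
Qed.

Lemma cboundedB_eI f (c : R[i]) (n : int) : cbounded f ->
  cbounded (fun x => f x - c * eI (n%:~R * x)).
Proof.
move=> [mf [C hC]]; split.
  have -> : (fun x => f x - c * eI (n%:~R * x)) = (fun x => f x + (- c) * eI (n%:~R * x)).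
    by apply/funext => x; rewrite mulNr.
  apply: cmeasurableD => //.
  exact: csmooth_measurable (csmoothM (csmooth_cst (- c)) (csmooth_eIn n%:~R)).
exists (C + normc c) => x Dx; rewrite (le_trans (normcB _ _))// lerD ?hC//.
by rewrite ComplexField.Normc.normcM normc_eI mulr1.
Qed.

Lemma normc_sub_sqr (a c e : R[i]) : normc e = 1 ->
  normc (a - c * e) ^+ 2 =
  normc a ^+ 2 + (normc c ^+ 2 - 2 * complex.Re (c^*%C * (a * e^*%C))).
Proof.
move=> /(congr1 (fun z => z ^+ 2)); rewrite !normc_sqr expr1n.
case: a c e => [a b] [u v] [p q] /= h.
have -> : u ^+ 2 + v ^+ 2 = (u ^+ 2 + v ^+ 2) * (p ^+ 2 + q ^+ 2) by rewrite h mulr1.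
ring.
Qed.

Lemma fc_mode (c : R[i]) (n m : int) :
  fc (fun x => c * eI (n%:~R * x)) m = c * (n == m)%:R.
Proof.
by rewrite -fc_eI; exact: (fcZ c m (csmooth_integrable (csmooth_eIn n%:~R))).
Qed.

(** Removing one Fourier mode lowers the square norm by exactly the square of
    that mode: the single step from which the Bessel inequality follows. *)
Lemma norm2_remove_mode f n : cbounded f ->
  norm2 (fun x => f x - fc f n * eI (n%:~R * x)) =
  norm2 f - 2 * pi * normc (fc f n) ^+ 2.
Proof.
move=> hf; set c := fc f n; have cf := cbounded_integrable hf.
have ce : cintegrable (fun x => c^*%C * (f x * eI (- (n%:~R * x)))).
  by apply: cintegrableZ; exact: cintegrableMs cf (csmooth_eInN _).
have pt x : normc (f x - c * eI (n%:~R * x)) ^+ 2 =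
    normc (f x) ^+ 2 + (normc c ^+ 2
      - 2 * complex.Re (c^*%C * (f x * eI (- (n%:~R * x))))).
  by rewrite -eIJ; apply: normc_sub_sqr; exact: normc_eI.
rewrite /norm2 (eq_rint (fun x _ => pt x)).
have iR := ce.1.
rewrite rintD; [|exact: cbounded_norm2|]; last first.
  by apply: rintegrableB; [exact: rintegrable_cst|exact: rintegrableZ].
rewrite rintB; [|exact: rintegrable_cst|exact: rintegrableZ].
have key : rint (fun x => complex.Re (c^*%C * (f x * eI (- (n%:~R * x))))) =
    2 * pi * normc c ^+ 2.
  transitivity (complex.Re (circle_int (fun x => c^*%C * (f x * eI (- (n%:~R * x)))))) => //.
  rewrite circle_intZ; last exact: cintegrableMs cf (csmooth_eInN n%:~R).
  have -> : circle_int (fun x => f x * eI (- (n%:~R * x))) = (2 * pi)%:C * c.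
    rewrite /c /fc mulrA -[X in _ = X * _]rmorphM mulfV ?rmorph1 ?mul1r//.
    exact: lt0r_neq0 pi2_gt0.
  by rewrite mulrCA [c^*%C * c]mulrC mulcJ -[X in complex.Re X]rmorphM.
by rewrite rint_cst rintZ// key; ring.
Qed.

Lemma bessel f (s : seq int) : cbounded f -> uniq s ->
  \sum_(n <- s) normc (fc f n) ^+ 2 <= (2 * pi)^-1 * norm2 f.
Proof.
elim: s f => [|n s IH] f hf /=.
  rewrite big_nil mulr_ge0 ?invr_ge0 ?(ltW pi2_gt0)//.
  by apply: rint_ge0 => x _; exact: sqr_ge0.
move=> /andP[ns us]; rewrite big_cons.
have := IH _ (cboundedB_eI (fc f n) n hf) us.
rewrite norm2_remove_mode// mulrBr mulKf; last exact: lt0r_neq0 pi2_gt0.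
rewrite lerBrDl; congr (_ + _ <= _); apply: eq_big_seq => m ms.
rewrite fcB; [|exact: cbounded_integrable|]; last first.
  exact: csmooth_integrable (csmoothM (csmooth_cst _) (csmooth_eIn _)).
rewrite fc_mode; have [nm|_] := eqVneq n m; first by rewrite nm ms in ns.
by rewrite mulr0 subr0.
Qed.

(** The squares are summable by the Bessel inequality. *)
Lemma riemann_lebesgue f (s : nat -> int) : cbounded f -> injective s ->
  normc (fc f (s k)) @[k --> \oo] --> (0 : R).
Proof.
move=> hf si.
have : cvgn (series (fun k => normc (fc f (s k)) ^+ 2)).
  apply: nondecreasing_is_cvgn.
    by apply: nondecreasing_series => k _ _; exact: sqr_ge0.
  exists ((2 * pi)^-1 * norm2 f) => _ [N _ <-].
  rewrite /series/= -(big_map s xpredT (fun n => normc (fc f n) ^+ 2)).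
  by apply: bessel => //; rewrite map_inj_uniq// iota_uniq.
move=> /cvg_series_cvg_0 h; apply/cvgrPdist_lt => e e0.
have e2 : 0 < e ^+ 2 by rewrite exprn_gt0.
move/cvgrPdist_lt : h => /(_ _ e2); apply: filterS => k.
rewrite !sub0r !normrN normrX ltr_pXn2r ?nnegrE// ?ltW//.
Qed.

End Bessel.

Section Inversion.
Context {R : realType}.
Implicit Types (f g d : R -> R[i]).

Lemma normc_eIM (x : R) (z : R[i]) : normc (eI x * z) = normc z.
Proof. by rewrite ComplexField.Normc.normcM normc_eI mul1r. Qed.

Lemma normc_MeI (x : R) (z : R[i]) : normc (z * eI x) = normc z.
Proof. by rewrite mulrC normc_eIM. Qed.

(** A crude form of Jordan's inequality: up to [pi / 4] the slope of [sin] is at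
    least [1 / 2], and beyond it [sin] exceeds [sin (pi / 4)], hence [1 / 2]. *)
Lemma sin_ge_quarter (y : R) : 0 <= y <= pi / 2 -> y / 4 <= sin y.
Proof.
move=> /andP[y0 y1].
have p0 := pi_gt0 R; have p2 := @pihalf_lt2 R.
have cs : cos (pi / 4) ^+ 2 = 2^-1 :> R.
  have := cos_mulr2n (pi / 4 : R).
  have -> : pi / 4 *+ 2 = pi / 2 :> R by rewrite mulr2n; move: (pi) => p; field.
  by rewrite cos_pihalf mulr2n => h; lra.
have c0 : 0 < cos (pi / 4 : R) by apply: cos_gt0_pihalf; apply/andP; split; lra.
have ch : 2^-1 <= cos (pi / 4 : R) by nra.
have [y4|y4] := leP y (pi / 4).
  have [c|c hc] := @MVT_segment R (@sin R) (@cos R) 0 y y0 (fun x _ => is_derive_sin x).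
    apply: continuous_subspaceT; exact: continuous_sin.
  rewrite sin0 !subr0 => ->; rewrite in_itv/= in hc; case/andP: hc => hc0 hc1.
  have : cos (pi / 4) <= cos c.
    by rewrite leNgt ltr_cos ?in_itv/=; [rewrite -leNgt; lra| |]; apply/andP; split; lra.
  nra.
have ss : sin (pi / 4) ^+ 2 = 2^-1 :> R by rewrite sin2cos2 cs; lra.
have s0 : 0 < sin (pi / 4 : R) by apply: sin_gt0_pihalf; apply/andP; split; lra.
have sh : 2^-1 <= sin (pi / 4 : R) by nra.
have : sin (pi / 4) < sin y.
  by rewrite ltr_sin ?in_itv/=; [lra| |]; apply/andP; split; lra.
lra.
Qed.

Lemma normc_eI_sub1_sqr (x : R) : normc (eI x - 1) ^+ 2 = 4 * sin (x / 2) ^+ 2.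
Proof.
have -> : x = (x / 2) *+ 2 by rewrite mulr2n; lra.
rewrite normc_sqr /eI/= cos_mulr2n sin_mulr2n mulr2n.
have -> : (x / 2) *+ 2 / 2 = x / 2 by rewrite mulr2n; lra.
have := cos2Dsin2 (x / 2); move: (cos _) (sin _) => c s h.
have -> : c ^+ 2 = 1 - s ^+ 2 by rewrite -h addrK.
rewrite mulr2n.
have e : c * s * (c * s) = (1 - s ^+ 2) * s ^+ 2 by rewrite -h; ring.
transitivity ((2 * s ^+ 2) ^+ 2 + 4 * (c * s * (c * s))); first by ring.
by rewrite e; ring.
Qed.

Lemma chord_ge (x : R) : 0 <= x <= pi -> x / 4 <= normc (eI x - 1).
Proof.
move=> /andP[x0 x1]; rewrite -(ler_pXn2r (n := 2)) ?nnegrE ?normc_ge0//; last lra.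
rewrite normc_eI_sub1_sqr.
have : x / 2 / 4 <= sin (x / 2) by apply: sin_ge_quarter; apply/andP; split; lra.
nra.
Qed.

Lemma eI_neq1 (x : R) : 0 < x < 2 * pi -> eI x != 1.
Proof.
move=> /andP[x0 x1]; apply/eqP => h.
have : normc (eI x - 1) = 0 by rewrite h subrr ComplexField.Normc.normc0.
have [xp|xp] := leP x pi.
  have : x / 4 <= normc (eI x - 1) by apply: chord_ge; apply/andP; split; lra.
  lra.
have h' : eI (2 * pi - x) = 1.
  by rewrite eID eI2pi mul1r -eIV h invr1.
have : (2 * pi - x) / 4 <= normc (eI (2 * pi - x) - 1).
  by apply: chord_ge; apply/andP; split; lra.
rewrite h' h; lra.
Qed.

Lemma csmooth_lipschitz f : csmooth f -> per2pi f ->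
  exists K, forall x y, normc (f x - f y) <= K * `|x - y|.
Proof.
move=> sf pf; have [C C0 hC] := csmooth_bounded (csmooth_cD sf) (per2pi_cD sf pf).
exists (2 * C) => x y; case: sf => f1 f2.
rewrite (le_trans (normc_le_ReIm _))// cReB cImB mulr_natl mulr2n mulrDl lerD//.
  apply: (mean_value_le (fun z => smooth_is_derive z f1)) => z _.
  exact: le_trans (normc_Re (cD f z)) (hC z).
apply: (mean_value_le (fun z => smooth_is_derive z f2)) => z _.
exact: le_trans (normc_Im (cD f z)) (hC z).
Qed.

(** On the circle the distance of two points is comparable with the chord. This
    makes the quotient in the inversion argument below bounded. *)
Lemma csmooth_chord f : csmooth f -> per2pi f ->
  exists K, forall x y, normc (f x - f y) <= K * normc (eI (x - y) - 1).
Proof.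
move=> sf pf; have [K0 hK0] := csmooth_lipschitz sf pf.
pose K := `|K0|; have hK x y : normc (f x - f y) <= K * `|x - y|.
  by rewrite (le_trans (hK0 x y))// ler_wpM2r// ler_norm.
exists (4 * K) => x y.
have [n /andP[n0 n1]] := reduce_2pi (x - y).
set z := x - y + _ in n0 n1.
have fz : f x = f (y + z) by rewrite -(per2pi_int n x pf) /z; congr f; ring.
have ez : eI (x - y) = eI z by rewrite /z [RHS]eID eIn2pi mulr1.
rewrite ez fz; have [zp|zp] := leP z pi.
  have := hK (y + z) y; have -> : y + z - y = z by ring.
  have : z / 4 <= normc (eI z - 1) by apply: chord_ge; rewrite n0.
  rewrite (ger0_norm n0); have : 0 <= K by rewrite /K.
  nra.
have := hK (y + z) (y + 2 * pi); rewrite (pf y).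
have -> : y + z - (y + 2 * pi) = - (2 * pi - z) by ring.
have zz : 0 <= 2 * pi - z by rewrite subr_ge0 ltW.
rewrite normrN (ger0_norm zz).
have : (2 * pi - z) / 4 <= normc (eI (2 * pi - z) - 1).
  by apply: chord_ge; rewrite zz/=; lra.
have -> : normc (eI (2 * pi - z) - 1) = normc (eI z - 1).
  rewrite eID eI2pi mul1r -eIJ -[RHS]normcJ; congr normc.
  by rewrite rmorphB rmorph1.
have : 0 <= K by rewrite /K.
nra.
Qed.

Definition symsum (a : int -> R[i]) (N : nat) : R[i] :=
  a 0 + \sum_(0 <= k < N) (a k.+1%:Z + a (- k.+1%:Z)).

Lemma symsumS a N : symsum a N.+1 = symsum a N + (a N.+1%:Z + a (- N.+1%:Z)).
Proof. by rewrite /symsum big_nat_recr//= addrA. Qed.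

Lemma fc_shift f (k n : int) : fc (fun x => f x * eI (k%:~R * x)) n = fc f (n - k).
Proof.
congr (_ * _); apply: eq_circle_int => x _; rewrite -mulrA -eID; congr (_ * eI _).
by rewrite rmorphB/=; ring.
Qed.

(** Pointwise convergence, by Chernoff's telescoping argument: dividing
    [f - f x0] by [e^{i (x - x0)} - 1] leaves a bounded function [g], and the
    partial Fourier sums of [f] at [x0] differ from [f x0] by two Fourier
    coefficients of [g], which tend to zero. *)
Lemma fourier_inversion_pointwise f x0 : csmooth f -> per2pi f ->
  normc (f x0 - symsum (fun n => fc f n * eI (n%:~R * x0)) N) @[N --> \oo] --> (0 : R).
Proof.
move=> sf pf; have [K hK] := csmooth_chord sf pf.
pose g x := (f x - f x0) * (eI (x - x0) - 1)^-1.
have sx0 : smooth (fun x => x - x0) := smoothB (@smooth_id R) (@smooth_cst R x0).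
have gb : cbounded g.
  split.
    apply: cmeasurableM.
      exact: csmooth_measurable (csmoothB sf (csmooth_cst _)).
    apply: cmeasurableV.
    exact: csmooth_measurable (csmoothB (csmooth_eI sx0) (csmooth_cst _)).
  exists K => x _; rewrite /g ComplexField.Normc.normcM ComplexField.Normc.normcV.
  have [->|e0] := eqVneq (normc (eI (x - x0) - 1)) 0.
    rewrite invr0 mulr0; have := hK (x0 + 1) x0.
    have : 0 <= normc (f (x0 + 1) - f x0) by exact: normc_ge0.
    have -> : x0 + 1 - x0 = 1 by ring.
    have p2 : 2 * pi > 1 :> R by have := @pi_ge2 R; lra.
    have : 0 < normc (eI 1 - 1 : R[i]).
      rewrite lt_neqAle normc_ge0 andbT eq_sym; apply/eqP => /ComplexField.Normc.eq0_normc/eqP.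
      by rewrite subr_eq0; apply/negP/eI_neq1; rewrite ltr01.
    nra.
  rewrite ler_pdivrMr; first exact: hK.
  by rewrite lt_neqAle eq_sym e0 normc_ge0.
have cg := cbounded_integrable gb.
have fg x : f x - f x0 = eI (- x0) * (g x * eI (1%:~R * x)) - g x.
  have [e1|e1] := eqVneq (eI (x - x0)) 1.
    have : normc (f x - f x0) <= 0.
      by rewrite (le_trans (hK x x0))// e1 subrr ComplexField.Normc.normc0 mulr0.
    rewrite le_eqVlt ltNge normc_ge0 orbF => /eqP/ComplexField.Normc.eq0_normc h.
    by rewrite /g h !mul0r mulr0 subrr.
  have e0 : eI (x - x0) - 1 != 0 by rewrite subr_eq0.
  rewrite -{1}[f x - f x0](mulfVK e0) -/(g x).
  by rewrite mul1r eID; ring.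
have cgs : cintegrable (fun x => eI (- x0) * (g x * eI (1%:~R * x))).
  by apply: cintegrableZ; exact: cintegrableMs cg (csmooth_eIn _).
have key n : fc f n - f x0 * (0 == n)%:R = eI (- x0) * fc g (n - 1) - fc g n.
  rewrite -(fc_mode (f x0)) -fcB; first last.
  - exact: csmooth_integrable (csmoothM (csmooth_cst _) (csmooth_eIn _)).
  - exact: csmooth_integrable.
  rewrite (@eq_fc _ _ (fun x => eI (- x0) * (g x * eI (1%:~R * x)) - g x)); last first.
    by move=> x _; rewrite mul0r eI0 mulr1 fg.
  rewrite fcB// (fcZ _ _ (cintegrableMs cg (csmooth_eIn 1%:~R))).
  by rewrite fc_shift.
have tel N : symsum (fun n => fc f n * eI (n%:~R * x0)) N - f x0 =
    eI (- x0) * eI (- N%:Z%:~R * x0) * fc g (- N%:Z - 1) - eI (N%:Z%:~R * x0) * fc g N%:Z.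
  elim: N => [|N IH].
    rewrite /symsum big_geq// addr0; have := key 0; rewrite eqxx mulr1 => h.
    by rewrite mul0r eI0 !mulr1 h oppr0 mul0r eI0 mulr1 mul1r.
  rewrite symsumS addrAC IH.
  have := key N.+1%:Z; have := key (- N.+1%:Z).
  have -> : (0 == - N.+1%:Z) = false by [].
  have -> : (0 == N.+1%:Z) = false by [].
  rewrite !mulr0 !subr0 => -> ->.
  have -> : N.+1%:Z - 1 = N%:Z by lia.
  have -> : - N.+1%:Z = - N%:Z - 1 by lia.
  have -> : eI (N.+1%:Z%:~R * x0) = eI (N%:Z%:~R * x0) * eI x0.
    by rewrite -eID; congr eI; rewrite -addn1 PoszD intrD; ring.
  have -> : eI ((- N%:Z - 1)%:~R * x0) = eI (- x0) * eI (- N%:Z%:~R * x0).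
    by rewrite -eID; congr eI; rewrite rmorphB rmorphN/=; ring.
  have -> : eI (- N.+1%:Z%:~R * x0) = eI (- x0) * eI (- N%:Z%:~R * x0).
    by rewrite -eID; congr eI; rewrite -addn1 PoszD intrD; ring.
  have e1 := eIMN x0; apply/eqP; rewrite -subr_eq0; apply/eqP.
  transitivity (eI (N%:Z%:~R * x0) * fc g N%:Z * (eI x0 * eI (- x0) - 1)).
    by ring.
  by rewrite e1 subrr mulr0.
apply/cvgrPdist_le => e e0; have e2 : 0 < e / 2 by lra.
have i1 : injective (fun N : nat => N%:Z) by move=> ? ? [].
have i2 : injective (fun N : nat => - N%:Z - 1) by move=> a b /addIr/oppr_inj[].
have /cvgrPdist_le/(_ _ e2) := riemann_lebesgue gb i1.
have /cvgrPdist_le/(_ _ e2) := riemann_lebesgue gb i2.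
apply: filterS2 => N; rewrite !sub0r !normrN !(ger0_norm (normc_ge0 _)) => h1 h2.
rewrite -normcN opprB tel (le_trans (normcB _ _))//.
rewrite -mulrA !normc_eIM; lra.
Qed.

Lemma sum_inv_sqr_tail (N M : nat) : (N <= M)%N ->
  \sum_(N <= k < M) (k.+1%:R ^+ 2)^-1 <= 2 / N.+1%:R :> R.
Proof.
move=> NM; suff : \sum_(N <= k < M) (k.+1%:R ^+ 2)^-1 <= 2 / N.+1%:R - 2 / M.+1%:R :> R.
  move/le_trans; apply; rewrite gerBl; exact: divr_ge0.
elim: M NM => [|M IH]; first by rewrite leqn0 => /eqP ->; rewrite big_geq// subrr.
rewrite leq_eqVlt => /orP[/eqP ->|]; first by rewrite big_geq// subrr.
rewrite ltnS => NM; rewrite big_nat_recr//=.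
have := IH NM; set S := \sum_(_ <= _ < _) _ => h.
suff h2 : (M.+1%:R ^+ 2)^-1 <= 2 / M.+1%:R - 2 / M.+2%:R :> R.
  by rewrite (le_trans (lerD h h2))// addrA subrK.
have -> : M.+2%:R = M.+1%:R + 1 :> R by rewrite -natr1.
have : 1 <= M.+1%:R :> R by rewrite ler1n.
move: (M.+1%:R) => x x1.
have -> : 2 / x - 2 / (x + 1) = 2 / (x * (x + 1)) :> R.
  by field; rewrite !gt_eqF//; lra.
rewrite ler_pdivlMr; last by nra.
rewrite mulrC ler_pdivrMr; nra.
Qed.

(** Uniform convergence with rate, from the quadratic decay of coefficients. *)
Lemma fourier_inversion f : csmooth f -> per2pi f ->
  exists C, forall N x,
    normc (f x - symsum (fun n => fc f n * eI (n%:~R * x)) N) <= C / N.+1%:R.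
Proof.
move=> sf pf; have sf' := csmooth_cD sf.
have [C C0 hC] := csmooth_bounded (csmooth_cD sf') (per2pi_cD sf' (per2pi_cD sf pf)).
exists (8 * C) => N x; apply/ler_addgt0Pl => e e0.
set S := symsum _.
have tail M : (N <= M)%N -> normc (S M - S N) <= 8 * C / N.+1%:R.
  move=> NM; rewrite /S /symsum (big_cat_nat _ NM)//= opprD addrACA subrr add0r addrAC subrr add0r.
  rewrite (le_trans (normc_sum _ _ _))//.
  rewrite (@le_trans _ _ (\sum_(N <= k < M) (4 * C) * (k.+1%:R ^+ 2)^-1))//.
    apply: ler_sum => k _; rewrite (le_trans (le_normcD _ _))//.
    rewrite !normc_MeI.
    have h1 := fc_decay sf pf hC (n := k.+1%:Z) isT.
    have h2 := fc_decay sf pf hC (n := - k.+1%:Z) isT.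
    rewrite rmorphN sqrrN in h2.
    have -> : 4 * C * (k.+1%:R ^+ 2)^-1 = 2 * C / k.+1%:R ^+ 2 + 2 * C / k.+1%:R ^+ 2 by ring.
    exact: lerD.
  rewrite -mulr_sumr; have := sum_inv_sqr_tail NM.
  have : 0 <= 4 * C by lra.
  move=> c4 h; rewrite (le_trans (ler_wpM2l c4 h))//.
  by have -> : 4 * C * (2 / N.+1%:R) = 8 * C / N.+1%:R by ring.
have /cvgrPdist_le/(_ _ e0)[M0 _ hM] := fourier_inversion_pointwise x sf pf.
have := hM (maxn M0 N) (leq_maxl _ _); rewrite sub0r normrN ger0_norm ?normc_ge0// => h1.
have h2 := tail (maxn M0 N) (leq_maxr _ _).
have -> : f x - S N = (f x - S (maxn M0 N)) + (S (maxn M0 N) - S N) by ring.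
by rewrite (le_trans (le_normcD _ _))// lerD.
Qed.

(** The Parseval formula when only one factor is smooth: the Fourier series of
    [f] converges uniformly and is integrated term by term against [d]. *)
Lemma fourier_pairing d f : cintegrable d -> csmooth f -> per2pi f ->
  exists C, forall N,
    normc (fc (fun x => d x * f x) 0 - symsum (fun n => fc f n * fc d (- n)) N)
      <= C / N.+1%:R.
Proof.
move=> hd sf pf; have [C hC] := fourier_inversion sf pf.
pose k x := `|complex.Re (d x)| + `|complex.Im (d x)|.
have ik : rintegrable k by case: hd => d1 d2; apply: rintegrableD; exact: rintegrable_norm.
exists (pi^-1 * (C * rint k)) => N.
pose S x := symsum (fun n => fc f n * eI (n%:~R * x)) N.
have sS : csmooth S.
  apply: csmoothD; first exact: csmoothM (csmooth_cst _) (csmooth_eIn _).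
  apply: csmooth_sum => j.
  by apply: csmoothD; exact: csmoothM (csmooth_cst _) (csmooth_eIn _).
have fcS : fc (fun x => d x * S x) 0 = symsum (fun n => fc f n * fc d (- n)) N.
  have mode (n : int) : fc (fun x => fc f n * (d x * eI (n%:~R * x))) 0 = fc f n * fc d (- n).
    by rewrite (fcZ _ _ (cintegrableMs hd (csmooth_eIn n%:~R))) fc_shift sub0r.
  have im (n : int) : cintegrable (fun x => fc f n * (d x * eI (n%:~R * x))).
    by apply: cintegrableZ; exact: cintegrableMs hd (csmooth_eIn _).
  rewrite (@eq_fc _ _ (fun x => fc f 0 * (d x * eI (0%:~R * x)) +
    \sum_(0 <= j < N) (fc f j.+1%:Z * (d x * eI (j.+1%:Z%:~R * x)) +
                       fc f (- j.+1%:Z) * (d x * eI ((- j.+1%:Z)%:~R * x))))); last first.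
    move=> x _; rewrite /S /symsum mulrDr mulr_sumr; congr (_ + _); first by ring.
    by apply: eq_bigr => j _; ring.
  have im2 j := cintegrableD (im j.+1%:Z) (im (- j.+1%:Z)).
  have [_ im3] := circle_int_sum (index_iota 0 N) im2.
  rewrite (fcD _ (im 0) im3) mode (fc_sum _ _ im2) /symsum; congr (_ + _).
  by apply: eq_bigr => j _; rewrite (fcD _ (im _) (im _)) !mode.
rewrite -fcS -fcB; [|exact: cintegrableMs|exact: cintegrableMs].
have -> : pi^-1 * (C * rint k) / N.+1%:R = pi^-1 * (C / N.+1%:R * rint k) by ring.
rewrite -rintZ//; apply: normc_fc.
- by apply: cintegrableB; exact: cintegrableMs.
- exact: rintegrableZ.
move=> x _; rewrite -mulrBr ComplexField.Normc.normcM mulrC.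
apply: ler_pM; [exact: normc_ge0|exact: normc_ge0|exact: hC|exact: normc_le_ReIm].
Qed.

End Inversion.

(** * Change of variables for Borel functions *)

Section Density.
Context {R : realType} (g : R -> R) (g0 : forall x, 0 <= g x)
  (mg : measurable_fun [set: measurableTypeR R] g).
Notation mu := (@lebesgue_measure R).
Local Open Scope ereal_scope.

Definition density (A : set (measurableTypeR R)) : \bar R :=
  \int[mu]_(x in A) (g x)%:E.

Let density0 : density set0 = 0.
Proof. by rewrite /density integral_set0. Qed.

Let density_ge0 A : 0 <= density A.
Proof. by apply: integral_ge0 => x _; rewrite lee_fin. Qed.

Let density_sigma_additive : semi_sigma_additive density.
Proof.
move=> /= F mF tF mUF; rewrite /density; apply: cvg_toP.
  apply: ereal_nondecreasing_is_cvgn => m n mn.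
  apply: lee_sum_nneg_natr => // k _ _; apply: integral_ge0 => /= x Fkx.
  by rewrite lee_fin.
rewrite ge0_integral_bigcup//=.
- by apply/measurable_funTS/measurableT_comp => //; exact: EFin_measurable.
- by move=> x _; rewrite lee_fin.
Qed.

HB.instance Definition _ := isMeasure.Build _ _ _
  density density0 density_ge0 density_sigma_additive.

Definition density_measure : {measure set (measurableTypeR R) -> \bar R} := density.

(** The layer-cake formula with a weight, a case of Tonelli's theorem. It
    reduces an integral to the integrals of the weight over superlevel sets. *)
Lemma ge0_layer_cake (G : R -> \bar R) : (forall x, 0 <= G x) ->
  measurable_fun [set: measurableTypeR R] G ->
  \int[mu]_x (G x * (g x)%:E) =
  \int[mu]_(s in `]0%R, +oo[) density [set x | s%:E < G x].
Proof.
move=> G0 mG; pose P := `]0%R, +oo[%classic : set (measurableTypeR R).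
pose B := [set z : measurableTypeR R * measurableTypeR R | P z.2 /\ z.2%:E < G z.1].
have mB : measurable B.
  have -> : B = (snd @^-1` P) `&` (setT `&` [set z | z.2%:E < G z.1]).
    by apply/seteqP; split=> [z [h1 h2]|z [h1 [_ h2]]].
  apply: measurableI.
    by rewrite -[X in measurable X]setTI; apply: measurable_snd => //; exact: measurable_itv.
  apply: measurable_lte => //; last exact: measurableT_comp mG measurable_fst.
  by apply/measurable_EFinP; exact: measurable_snd.
pose F z := (\1_B z * g z.1)%:E.
have F0 z : 0 <= F z by rewrite lee_fin mulr_ge0.
have mF : measurable_fun [set: measurableTypeR R * measurableTypeR R] F.
  apply/measurable_EFinP; apply: measurable_funM => //.
  exact: measurableT_comp mg measurable_fst.
have level x : mu [set s | B (x, s)] = G x.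
  have := G0 x; case e : (G x) => [r| |]// r0.
    have -> : [set s | B (x, s)] = `]0%R, r[%classic.
      by apply/seteqP; split=> s; rewrite /B /P/= !in_itv/= e lte_fin andbT; [case=> -> ->|case/andP].
    rewrite lebesgue_measure_itv/= lte_fin; case: ltP => [_|r0']; first by rewrite sube0.
    by apply/eqP; rewrite eq_le !lee_fin r0' -lee_fin r0.
  have -> : [set s | B (x, s)] = `]0%R, +oo[%classic.
    by apply/seteqP; split=> s; rewrite /B /P/= in_itv/= e ltry andbT; [case|].
  by rewrite lebesgue_measure_itv/= ltry.
transitivity (\int[mu]_x \int[mu]_s F (x, s)).
  apply: eq_integral => x _.
  have mBx : measurable [set s | B (x, s)].
    by have := measurable_xsection x mB; rewrite xsectionE.
  transitivity (\int[mu]_s ((\1_[set s | B (x, s)] s)%:E * (g x)%:E)); last first.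
    by apply: eq_integral => s _; rewrite /F EFinM !indicE; do 2 congr (_ * _).
  rewrite ge0_integralZr ?lee_fin//; last by apply/measurable_EFinP.
  rewrite integral_indic// setIT.
  exact: (congr1 (fun z => z * (g x)%:E) (esym (level x))).
rewrite (fubini_tonelli F mF F0) [RHS]integral_mkcond; apply: eq_integral => s _.
rewrite patchE /density; case: ifPn => sP; last first.
  apply: integral0_eq => x _; rewrite /F indicE memNset ?mul0r// => -[/= h _].
  by move: sP; rewrite mem_set.
rewrite [RHS]integral_mkcond; apply: eq_integral => x _; rewrite /F patchE indicE.
have -> : ((x, s) \in B) = (x \in [set x | s%:E < G x]).
  by apply/idP/idP; rewrite !inE; [case|move=> h; split=> //=; rewrite inE in sP].
by case: ifP; rewrite ?mul1r ?mul0r.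
Qed.

End Density.

Section Substitution.
Context {R : realType} (phi dphi : R -> R)
  (dphiP : forall x : R, is_derive x 1 phi (dphi x))
  (cdphi : continuous dphi) (dphi_gt0 : forall x, 0 < dphi x)
  (phi_surj : forall y, exists x, phi x = y).
Notation mu := (@lebesgue_measure R).

Lemma substitution_lt x y : x < y -> phi x < phi y.
Proof.
move=> xy; have [|c _ h] := MVT xy (fun z _ => dphiP z).
  apply: continuous_subspaceT => z.
  by apply/differentiable_continuous/derivable1_diffP; case: (dphiP z).
by rewrite -subr_gt0 h mulr_gt0// subr_gt0.
Qed.

Lemma substitution_le x y : (phi x <= phi y) = (x <= y).
Proof.
have [xy|yx|->] := ltgtP x y; last by rewrite lexx.
  by rewrite ltW// substitution_lt.
by apply/negbTE; rewrite -ltNge substitution_lt.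
Qed.

Let cphi : continuous phi.
Proof.
by move=> z; apply/differentiable_continuous/derivable1_diffP; case: (dphiP z).
Qed.

Let mphi : measurable_fun [set: measurableTypeR R] (phi : measurableTypeR R -> measurableTypeR R).
Proof. exact: continuous_measurable_fun. Qed.

Let mdphi : measurable_fun [set: measurableTypeR R] dphi.
Proof. exact: continuous_measurable_fun. Qed.

Let dphi_ge0 x : 0 <= dphi x.
Proof. exact: ltW. Qed.

(** The image under [phi] of the measure with density [dphi] is Lebesgue
    measure, because both give [b - a] to the interval [ ]a, b] ]. *)
Lemma density_preimage (A : set (measurableTypeR R)) : measurable A ->
  mu A = pushforward (density_measure dphi_ge0 mdphi)
    (phi : measurableTypeR R -> measurableTypeR R) A.
Proof.
move=> mA; apply: lebesgue_measure_unique => // _ [[a b] _ <-] /=.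
rewrite /pushforward/= /density.
have [al hal] := phi_surj a; have [be hbe] := phi_surj b; subst a b.
have -> : phi @^-1` `]phi al, phi be] = `]al, be]%classic.
  apply/seteqP; split=> x /=; rewrite !in_itv/= substitution_le !ltNge substitution_le//.
have [ab|ba] := ltP al be; last first.
  by rewrite !set_itv_ge ?integral_set0 ?measure0// bnd_simp -leNgt// substitution_le.
rewrite lebesgue_measure_itv/= lte_fin substitution_lt//.
rewrite integral_itv_obnd_cbnd; last exact/measurable_funTS/measurable_EFinP.
rewrite (@continuous_FTC2 _ _ phi)//; first exact: continuous_subspaceT.
- split=> [x _| |]; first by case: (dphiP x).
  + apply: cvg_at_right_filter; exact: cphi.
  + apply: cvg_at_left_filter; exact: cphi.
- by move=> x _; rewrite (is_derive1_fun dphiP).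
Qed.

Lemma ge0_substitutionT (G : R -> \bar R) : (forall x, (0 <= G x)%E) ->
  measurable_fun [set: measurableTypeR R] G ->
  (\int[mu]_x G x = \int[mu]_x (G (phi x) * (dphi x)%:E))%E.
Proof.
move=> G0 mG.
transitivity (\int[mu]_x (G x * (cst (1 : R) x)%:E))%E.
  by apply: eq_integral => x _; rewrite mule1.
have m1 : measurable_fun [set: measurableTypeR R] (cst (1 : R)) by exact: measurable_cst.
rewrite (ge0_layer_cake (fun=> ler01) m1 G0 mG).
rewrite (ge0_layer_cake dphi_ge0 mdphi (fun x => G0 (phi x)) (measurableT_comp mG mphi)).
apply: eq_integral => s _; rewrite {1}/density.
set L := [set x | (s%:E < G x)%E].
have mL : measurable (L : set (measurableTypeR R)).
  by rewrite -[L]setTI; apply: measurable_lte.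
by rewrite integral_cst// mul1e; exact: density_preimage mL.
Qed.

Lemma ge0_substitution (G : R -> \bar R) (a b : R) : (forall x, (0 <= G x)%E) ->
  measurable_fun [set: measurableTypeR R] G ->
  (\int[mu]_(x in `]phi a, phi b]) G x =
   \int[mu]_(x in `]a, b]) (G (phi x) * (dphi x)%:E))%E.
Proof.
move=> G0 mG; rewrite integral_mkcond ge0_substitutionT; first last.
- apply/(measurable_restrictT _ _).1 => //; exact: measurable_funTS.
- by move=> x; apply: erestrict_ge0.
rewrite [RHS]integral_mkcond; apply: eq_integral => x _.
rewrite !patchE; have -> : (phi x \in `]phi a, phi b]%classic) = (x \in `]a, b]%classic).
  by apply/idP/idP; rewrite !inE/= !in_itv/= substitution_le !ltNge substitution_le.
by case: ifP => //; rewrite mul0e.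
Qed.

End Substitution.

Section PeriodicSubstitution.
Context {R : realType}.
Notation mu := (@lebesgue_measure R).
Notation D := (`[0, 2 * pi]%classic : set (measurableTypeR R)).

Lemma ge0_integral_translate (G : R -> \bar R) (a b c : R) : (forall x, (0 <= G x)%E) ->
  measurable_fun [set: measurableTypeR R] G ->
  (\int[mu]_(x in `](a + c)%R, (b + c)%R]) G x = \int[mu]_(x in `]a, b]) G (x + c)%R)%E.
Proof.
move=> G0 mG.
have d (x : R) : is_derive x 1 (fun y => y + c) 1.
  by have := is_derive1D (is_derive1_id x) (is_derive1_cst c x); rewrite addr0.
rewrite (@ge0_substitution _ (fun x => x + c) (fun=> 1) d)//.
- by apply: eq_integral => x _; rewrite mule1.
- by move=> x; exact: cvg_cst.
- by move=> y; exists (y - c); rewrite subrK.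
Qed.

(** The window [ ]a, a + 2 * pi] ] is moved to [ ]0, 2 * pi] ] by cutting it at the
    multiple of the period that it contains. *)
Lemma ge0_integral_period (G : R -> \bar R) (a : R) : (forall x, (0 <= G x)%E) ->
  measurable_fun [set: measurableTypeR R] G -> per2pi G ->
  (\int[mu]_(x in `]a, (a + 2 * pi)%R]) G x = \int[mu]_(x in `]0%R, (2 * pi)%R]) G x)%E.
Proof.
move=> G0 mG pG.
have shift (n : int) (u v : R) :
  (\int[mu]_(x in `](u + n%:~R * (2 * pi))%R, (v + n%:~R * (2 * pi))%R]) G x =
   \int[mu]_(x in `]u, v]) G x)%E.
  by rewrite ge0_integral_translate//; apply: eq_integral => x _; rewrite per2pi_int.
have [n /andP[n0 n1]] := reduce_2pi a.
rewrite -(shift n) addrAC; set a' := a + _ in n0 n1 *.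
have setU (u v w : R) : (u <= v <= w)%R -> (\int[mu]_(x in `]u, w]) G x =
    \int[mu]_(x in `]u, v]) G x + \int[mu]_(x in `]v, w]) G x)%E.
  move=> /andP[uv vw]; rewrite -ge0_integral_setU//.
  - by rewrite -itv_bndbnd_setU// bnd_simp.
  - exact: measurable_funTS.
  - apply/disj_setPS => x [] /=; rewrite !in_itv/= => /andP[_ h1] /andP[h2 _].
    by move: (lt_le_trans h2 h1); rewrite ltxx.
rewrite (setU a' (2 * pi)); last by rewrite (ltW n1)/= lerDr.
rewrite (setU 0 a' (2 * pi)); last by rewrite n0 ltW.
have := shift 1 0 a'; rewrite mul1r add0r => ->.
exact: addeC.
Qed.

Context (phi : R -> R) (sphi : smooth phi) (dphi_gt0 : forall x, 0 < phi^`() x)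
  (phiD2pi : forall x, phi (x + 2 * pi) = phi x + 2 * pi).

Let phi_int (n : int) x : phi (x + n%:~R * (2 * pi)) = phi x + n%:~R * (2 * pi).
Proof.
have p : per2pi (fun x => phi x - x) by move=> y; rewrite phiD2pi; ring.
by have /= /eqP := per2pi_int n x p; rewrite subr_eq => /eqP ->; ring.
Qed.

Let phi_surj y : exists x, phi x = y.
Proof.
have [n /andP[n0 n1]] := reduce_2pi (y - phi 0).
have p0 := phiD2pi 0; rewrite add0r in p0.
have [| |x _ hx] := @IVT R phi 0 (2 * pi) (y + n%:~R * (2 * pi)) (ltW pi2_gt0).
- by apply: continuous_subspaceT; exact: smooth_continuous.
- have p := @pi2_gt0 R.
  by rewrite min_l ?max_r; [apply/andP; split; lra|lra|lra].
exists (x + (- n)%:~R * (2 * pi)); rewrite phi_int hx rmorphN; ring.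
Qed.

Let mphi : measurable_fun [set: measurableTypeR R] (phi : measurableTypeR R -> measurableTypeR R).
Proof. by apply: continuous_measurable_fun; exact: smooth_continuous. Qed.

Let mdphi : measurable_fun [set: measurableTypeR R] phi^`().
Proof. by apply: continuous_measurable_fun; apply: smooth_continuous; exact: smooth_derive1. Qed.

Lemma ge0_periodic_substitution (G : R -> R) : (forall x, 0 <= G x) ->
  measurable_fun [set: measurableTypeR R] G -> per2pi G ->
  (\int[mu]_(x in D) (G (phi x) * phi^`() x)%:E = \int[mu]_(x in D) (G x)%:E)%E.
Proof.
move=> G0 mG pG.
have mE : measurable_fun [set: measurableTypeR R] (EFin \o G) by exact/measurable_EFinP.
have mE' : measurable_fun [set: measurableTypeR R] (fun x => (G (phi x) * phi^`() x)%:E).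
  apply/measurable_EFinP; apply: measurable_funM => //.
  exact: (measurableT_comp mG mphi).
have cb : continuous phi^`() by apply: smooth_continuous; exact: smooth_derive1.
have := @ge0_substitution R phi phi^`() (fun x => smooth_is_derive x sphi) cb
  dphi_gt0 phi_surj (EFin \o G) 0 (2 * pi) G0 mE.
have := phiD2pi 0; rewrite add0r => ->.
rewrite ge0_integral_period//; last by move=> x /=; rewrite pG.
rewrite -integral_itv_obnd_cbnd; last exact: measurable_funTS.
move=> h; rewrite -[RHS]integral_itv_obnd_cbnd; last exact: measurable_funTS.
by rewrite [RHS]h; apply: eq_integral => x _; rewrite EFinM.
Qed.

(** Positive and negative parts are treated separately. *)
Lemma rint_substitution (F : R -> R) : measurable_fun [set: measurableTypeR R] F ->
  per2pi F -> rintegrable F ->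
  rintegrable (fun x => F (phi x) * phi^`() x) /\
  rint (fun x => F (phi x) * phi^`() x) = rint F.
Proof.
move=> mF pF iF.
have mFphi : measurable_fun [set: measurableTypeR R] (fun x => F (phi x)).
  exact: (measurableT_comp mF mphi).
have int (G : R -> R) : measurable_fun [set: measurableTypeR R] G -> per2pi G ->
    rintegrable G -> rintegrable (fun x => G (phi x) * phi^`() x).
  move=> mG pG iG; apply/integrableP; split.
    apply/measurable_EFinP/measurable_funTS; apply: measurable_funM => //.
    exact: (measurableT_comp mG mphi).
  have mn : measurable_fun [set: measurableTypeR R] (fun x => `|G x|).
    exact: measurableT_comp.
  have pn : per2pi (fun x => `|G x|) by move=> x; rewrite pG.
  have -> : (\int[mu]_(x in D) `|(EFin \o (fun x => (G (phi x) * phi^`() x)%R)) x| =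
      \int[mu]_(x in D) (`|G (phi x)| * phi^`() x)%:E)%E.
    by apply: eq_integral => x _ /=; rewrite normrM (gtr0_norm (dphi_gt0 x)).
  rewrite (@ge0_periodic_substitution (fun x => `|G x|))//.
  by case/integrableP : iG.
split; first exact: int.
pose P x := Num.max (F x) 0; pose N x := Num.max (- F x) 0.
have P0 x : 0 <= P x by rewrite le_max lexx orbT.
have N0 x : 0 <= N x by rewrite le_max lexx orbT.
have mP : measurable_fun [set: measurableTypeR R] P.
  by apply: measurable_maxr => //; exact: measurable_cst.
have mN : measurable_fun [set: measurableTypeR R] N.
  by apply: measurable_maxr; [exact: measurableT_comp|exact: measurable_cst].
have pP : per2pi P by move=> x; rewrite /P pF.
have pN : per2pi N by move=> x; rewrite /N pF.
have dom (G : R -> R) : measurable_fun [set: measurableTypeR R] G ->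
    (forall x, `|G x| <= `|F x|) -> rintegrable G.
  move=> mG hG; apply: (le_integrable _ _ _ iF) => //.
    exact/measurable_EFinP/measurable_funTS.
  by move=> x _ /=; rewrite lee_fin.
have iP : rintegrable P.
  apply: dom => // x; rewrite ger0_norm// /P.
  by case: (leP (F x) 0) => // ?; rewrite ler_norm.
have iN : rintegrable N.
  apply: dom => // x; rewrite ger0_norm// /N.
  by case: (leP (- F x) 0) => // ?; rewrite -normrN ler_norm.
have FPN x : F x = P x - N x.
  rewrite /P /N; case: (leP (F x) 0) => h1; case: (leP (- F x) 0) => h2; lra.
rewrite (@eq_rint _ F (fun x => P x - N x))// rintB//.
rewrite (@eq_rint _ _ (fun x => P (phi x) * phi^`() x - N (phi x) * phi^`() x)).
  rewrite rintB//; [|exact: int|exact: int].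
  by rewrite /rint /Rintegral !ge0_periodic_substitution.
by move=> x _; rewrite FPN mulrBl.
Qed.

(** The components are required to be Borel on the whole line since [phi] moves
    the fundamental domain. *)
Lemma circle_int_substitution (f : R -> R[i]) :
  measurable_fun [set: measurableTypeR R] (fun x => complex.Re (f x)) ->
  measurable_fun [set: measurableTypeR R] (fun x => complex.Im (f x)) ->
  per2pi f -> cintegrable f ->
  cintegrable (fun x => (phi^`() x)%:C * f (phi x)) /\
  circle_int (fun x => (phi^`() x)%:C * f (phi x)) = circle_int f.
Proof.
move=> m1 m2 pf [i1 i2].
have p1 : per2pi (fun x => complex.Re (f x)) by move=> x; rewrite pf.
have p2 : per2pi (fun x => complex.Im (f x)) by move=> x; rewrite pf.
have [j1 e1] := rint_substitution m1 p1 i1.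
have [j2 e2] := rint_substitution m2 p2 i2.
have hR : (fun x => complex.Re ((phi^`() x)%:C * f (phi x))) =
    fun x => complex.Re (f (phi x)) * phi^`() x.
  by apply/funext => x; rewrite cReM/= mul0r subr0 mulrC.
have hI : (fun x => complex.Im ((phi^`() x)%:C * f (phi x))) =
    fun x => complex.Im (f (phi x)) * phi^`() x.
  by apply/funext => x; rewrite cImM/= mul0r addr0 mulrC.
by split; [split; rewrite ?hR ?hI|rewrite !circle_intE hR hI e1 e2].
Qed.

End PeriodicSubstitution.

(** * The Hilbert space and its two halves in terms of Fourier coefficients *)

Section FourierCircle.
Context {R : realType}.
Implicit Types (u v w : cfun R) (c : R[i]).

Definition lift_integrable u := cintegrable (fun x => u (expi x)).

Lemma fourierD u v n : lift_integrable u -> lift_integrable v ->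
  fourier (cadd u v) n = fourier u n + fourier v n.
Proof. by move=> hu hv; rewrite !fourier_fc -fcD. Qed.

Lemma fourierZ c u n : lift_integrable u -> fourier (hscale c u) n = c * fourier u n.
Proof. by move=> hu; rewrite !fourier_fc -fcZ. Qed.

Lemma fourierB u v n : lift_integrable u -> lift_integrable v ->
  fourier (csub u v) n = fourier u n - fourier v n.
Proof. by move=> hu hv; rewrite !fourier_fc -fcB. Qed.

Lemma fourier0 n : fourier (@czero R) n = 0.
Proof.
rewrite fourier_fc /fc (@eq_circle_int _ _ (fun=> 0)) ?circle_int0 ?mulr0//.
by move=> x _; rewrite /czero mul0r.
Qed.

Lemma fourier_chi m n : fourier (@chi R m) n = (m == n)%:R.
Proof. by rewrite fourier_fc -fc_eI; apply: eq_fc => x _; rewrite chi_expi. Qed.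

Lemma csmooth_chi n : csmooth (fun x => @chi R n (expi x)).
Proof.
by apply: (csmooth_ext (f := fun x => eI (n%:~R * x))) (csmooth_eIn _) => x; rewrite chi_expi.
Qed.

(** The terms of the series whose sum is the squared norm, as real numbers. *)
Definition energy u (k : nat) : R :=
  k.+1%:R * (normc (fourier u k.+1%:Z) ^+ 2 + normc (fourier u (- k.+1%:Z)) ^+ 2).

Lemma energy_ge0 u k : 0 <= energy u k.
Proof. by rewrite mulr_ge0// addr_ge0// sqr_ge0. Qed.

Lemma inner_term_energy u k : inner_term u u k = (energy u k)%:C.
Proof.
rewrite /inner_term !mulcJ -(rmorphD (real_complex R)).
by rewrite -[k.+1%:R](rmorph_nat (real_complex R)) -(rmorphM (real_complex R)).
Qed.

Lemma Re_inner_term u : (fun k => complex.Re (inner_term u u k)) = energy u.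
Proof. by apply/funext => k; rewrite inner_term_energy. Qed.

Lemma hnormE u : hnorm u = Num.sqrt (limn (series (energy u))).
Proof.
by rewrite /hnorm /inner /series_sum /= Re_inner_term.
Qed.

Lemma hnorm_ge0 u : 0 <= hnorm u.
Proof. exact: sqrtr_ge0. Qed.

Lemma energy_series_nd u : nondecreasing_seq (series (energy u)).
Proof. by apply: nondecreasing_series => k _ _; exact: energy_ge0. Qed.

Lemma energy_cvgP u :
  cvgn (series (energy u)) <-> exists K, forall N, series (energy u) N <= K.
Proof.
split=> [h|[K hK]].
  by exists (limn (series (energy u))) => N; exact: nondecreasing_cvgn_le (energy_series_nd u) h N.
apply: nondecreasing_is_cvgn; first exact: energy_series_nd.
by exists K => _ [N _ <-].
Qed.

Lemma series_energy_ge0 u N : 0 <= series (energy u) N.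
Proof. by apply: sumr_ge0 => k _; exact: energy_ge0. Qed.

Lemma hnorm_sqr u : cvgn (series (energy u)) -> hnorm u ^+ 2 = limn (series (energy u)).
Proof.
move=> h; rewrite hnormE sqr_sqrtr//; apply: limr_ge => //.
by apply: nearW => N; exact: series_energy_ge0.
Qed.

Lemma series_energy_le u N : cvgn (series (energy u)) ->
  series (energy u) N <= hnorm u ^+ 2.
Proof.
by move=> h; rewrite hnorm_sqr//; exact: nondecreasing_cvgn_le (energy_series_nd u) h N.
Qed.

Lemma hnorm_le u (K : R) : 0 <= K -> (forall N, series (energy u) N <= K ^+ 2) ->
  hnorm u <= K.
Proof.
move=> K0 hK; have h : cvgn (series (energy u)) by apply/energy_cvgP; exists (K ^+ 2).
rewrite -(ler_pXn2r (n := 2))// ?nnegrE ?hnorm_ge0// hnorm_sqr//.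
by apply: limr_le => //; exact: nearW.
Qed.

Lemma H12_energy u : H12 u -> cvgn (series (energy u)).
Proof. by case=> _ _; rewrite Re_inner_term. Qed.

Lemma series_ge_term u k : energy u k <= series (energy u) k.+1.
Proof. by rewrite /series/= big_nat_recr//= lerDr; exact: series_energy_ge0. Qed.

(** Nonzero frequencies enter the squared norm with a weight at least one. *)
Lemma normc_fourier_le u n : H12 u -> n != 0 -> normc (fourier u n) <= hnorm u.
Proof.
move=> /H12_energy hu n0.
have [k hk] : exists k, n = k.+1%:Z \/ n = - k.+1%:Z.
  case: n n0 => [[|k]|k] // _; first by exists k; left.
  by exists k; right; rewrite NegzE.
rewrite -(ler_pXn2r (n := 2))// ?nnegrE ?normc_ge0 ?hnorm_ge0//.
rewrite (le_trans _ (series_energy_le k.+1 hu))// (le_trans _ (series_ge_term u k))//.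
have k1 : 1 <= k.+1%:R :> R by rewrite ler1n.
have h1 := sqr_ge0 (normc (fourier u k.+1%:Z)).
have h2 := sqr_ge0 (normc (fourier u (- k.+1%:Z))).
rewrite /energy; case: hk => ->; nra.
Qed.

Lemma square_integrable_rintegrable (f : R -> R) : square_integrable f -> rintegrable f.
Proof.
move=> [mf if2]; apply: (le_integrable _ _ _ (rintegrableD (rintegrable_cst 1) if2)) => //.
  exact/measurable_EFinP/measurable_funTS.
move=> x _ /=; rewrite lee_fin (le_trans _ (ler_norm _))//.
by have := sqr_ge0 (`|f x| - 1); rewrite -[f x ^+ 2]real_normK ?num_real//; nra.
Qed.

Lemma square_integrableD (f g : R -> R) : square_integrable f -> square_integrable g ->
  square_integrable (fun x => f x + g x).
Proof.
move=> [mf f2] [mg g2]; split; first exact: measurable_funD.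
apply: (le_integrable _ _ _ (rintegrableD (rintegrableZ 2 f2) (rintegrableZ 2 g2))) => //.
  apply/measurable_EFinP/measurable_funTS; apply: measurable_funX.
  exact: measurable_funD.
move=> x _ /=; rewrite lee_fin ger0_norm ?sqr_ge0// (le_trans _ (ler_norm _))//.
by have := sqr_ge0 (f x - g x); nra.
Qed.

Lemma square_integrableZ (c : R) (f : R -> R) : square_integrable f ->
  square_integrable (fun x => c * f x).
Proof.
move=> [mf f2]; split; first exact: measurable_funM.
have := rintegrableZ (c ^+ 2) f2; apply: eq_integrable => // x _ /=.
by rewrite exprMn.
Qed.

Lemma square_integrable_bounded (f : R -> R) (C : R) :
  measurable_fun [set: measurableTypeR R] f -> (forall x, `|f x| <= C) ->
  square_integrable f.
Proof.
move=> mf hC; split => //; apply: (@rintegrable_bounded _ _ (C ^+ 2)).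
  exact/measurable_funTS/measurable_funX.
move=> x _; rewrite normrX ler_pXn2r// ?nnegrE//.
exact: le_trans (normr_ge0 _) (hC x).
Qed.

Lemma H12_measurable u : H12 u ->
  measurable_fun [set: measurableTypeR R] (fun x => complex.Re (u (expi x))) /\
  measurable_fun [set: measurableTypeR R] (fun x => complex.Im (u (expi x))).
Proof. by move=> [[m1 _] [m2 _] _]. Qed.

Lemma H12_lift_integrable u : H12 u -> lift_integrable u.
Proof. by move=> [h1 h2 _]; split; exact: square_integrable_rintegrable. Qed.

Lemma H12_of_energy u :
  square_integrable (fun x => complex.Re (u (expi x))) ->
  square_integrable (fun x => complex.Im (u (expi x))) ->
  (exists K, forall N, series (energy u) N <= K) -> H12 u.
Proof.
by move=> h1 h2 /energy_cvgP h3; split => //; rewrite Re_inner_term.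
Qed.

Lemma normcD_sqr (a b : R[i]) : normc (a + b) ^+ 2 <= 2 * normc a ^+ 2 + 2 * normc b ^+ 2.
Proof.
have h := le_normcD a b; have h0 := normc_ge0 (a + b).
by have := sqr_ge0 (normc a - normc b); nra.
Qed.

Lemma energyD u v k : lift_integrable u -> lift_integrable v ->
  energy (cadd u v) k <= 2 * energy u k + 2 * energy v k.
Proof.
move=> hu hv; rewrite /energy !fourierD//.
have h1 := normcD_sqr (fourier u k.+1%:Z) (fourier v k.+1%:Z).
have h2 := normcD_sqr (fourier u (- k.+1%:Z)) (fourier v (- k.+1%:Z)).
have k0 : 0 <= k.+1%:R :> R by [].
move: (k.+1%:R) k0 h1 h2 => x x0 h1 h2; nra.
Qed.

Lemma energyZ c u k : lift_integrable u -> energy (hscale c u) k = normc c ^+ 2 * energy u k.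
Proof.
move=> hu; rewrite /energy !fourierZ// !ComplexField.Normc.normcM; ring.
Qed.

Lemma H12D u v : H12 u -> H12 v -> H12 (cadd u v).
Proof.
move=> hu hv; have [u1 u2 _] := hu; have [v1 v2 _] := hv.
apply: H12_of_energy.
- by under eq_fun do rewrite cReD; exact: square_integrableD.
- by under eq_fun do rewrite cImD; exact: square_integrableD.
have /energy_cvgP[K hK] := H12_energy hu; have /energy_cvgP[L hL] := H12_energy hv.
exists (2 * K + 2 * L) => N; have := hK N; have := hL N.
rewrite /series/= => h1 h2.
rewrite (@le_trans _ _ (\sum_(0 <= k < N) (2 * energy u k + 2 * energy v k)))//.
  by apply: ler_sum => k _; apply: energyD; exact: H12_lift_integrable.
by rewrite big_split/= -!mulr_sumr; lra.
Qed.

Lemma H12Z c u : H12 u -> H12 (hscale c u).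
Proof.
move=> hu; have [u1 u2 _] := hu; apply: H12_of_energy.
- rewrite (_ : (fun x => _) = (fun x => complex.Re c * complex.Re (u (expi x)) +
    (- complex.Im c) * complex.Im (u (expi x)))).
    by apply: square_integrableD; exact: square_integrableZ.
  by apply/funext => x; rewrite cReM mulNr.
- rewrite (_ : (fun x => _) = (fun x => complex.Re c * complex.Im (u (expi x)) +
    complex.Im c * complex.Re (u (expi x)))).
    by apply: square_integrableD; exact: square_integrableZ.
  by apply/funext => x; rewrite cImM.
have /energy_cvgP[K hK] := H12_energy hu.
exists (normc c ^+ 2 * K) => N; rewrite /series/=.
under eq_bigr do rewrite (energyZ _ _ (H12_lift_integrable hu)).
by rewrite -mulr_sumr ler_wpM2l ?sqr_ge0//; exact: hK.
Qed.

Lemma csubE u v : csub u v = cadd u (hscale (-1) v).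
Proof. by apply/funext => z; rewrite /csub /cadd /hscale mulN1r. Qed.

Lemma H12B u v : H12 u -> H12 v -> H12 (csub u v).
Proof. by move=> hu hv; rewrite csubE; exact: H12D hu (H12Z _ hv). Qed.

(** Quadratic decay of the coefficients makes the terms of the squared norm
    decay cubically; they are summed by comparison with inverse squares. *)
Lemma energy_of_coeff u (C : R) N :
  (forall n, n != 0 -> n%:~R ^+ 2 * normc (fourier u n) <= C) ->
  series (energy u) N <= 4 * C ^+ 2.
Proof.
move=> hC; have e k : energy u k <= 2 * C ^+ 2 * (k.+1%:R ^+ 2)^-1.
  have h1 : k.+1%:R ^+ 2 * normc (fourier u k.+1%:Z) <= C := hC k.+1%:Z isT.
  have h2 : k.+1%:R ^+ 2 * normc (fourier u (- k.+1%:Z)) <= C.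
    by have := hC (- k.+1%:Z) isT; rewrite mulrNz sqrrN.
  have k1 : 1 <= k.+1%:R :> R by rewrite ler1n.
  rewrite /energy; move: (normc_ge0 (fourier u k.+1%:Z)) h1.
  move: (normc_ge0 (fourier u (- k.+1%:Z))) h2.
  move: (normc (fourier u (- k.+1%:Z))) (normc (fourier u k.+1%:Z)) k1.
  move: (k.+1%:R) => x b a x1 b0 h2 a0 h1.
  have x0 : 0 < x by lra.
  rewrite ler_pdivlMr ?exprn_gt0//.
  have xa : 0 <= x ^+ 2 * a by rewrite mulr_ge0// sqr_ge0.
  have xb : 0 <= x ^+ 2 * b by rewrite mulr_ge0// sqr_ge0.
  have C0 := le_trans xa h1.
  have a2 : (x ^+ 2 * a) ^+ 2 <= C ^+ 2 by rewrite ler_pXn2r// nnegrE.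
  have b2 : (x ^+ 2 * b) ^+ 2 <= C ^+ 2 by rewrite ler_pXn2r// nnegrE.
  have x34 : x ^+ 3 <= x ^+ 4 by rewrite [x ^+ 4]exprS ler_peMl// exprn_ge0// ltW.
  have -> : x * (a ^+ 2 + b ^+ 2) * x ^+ 2 = x ^+ 3 * (a ^+ 2 + b ^+ 2) by ring.
  have : x ^+ 3 * (a ^+ 2 + b ^+ 2) <= x ^+ 4 * (a ^+ 2 + b ^+ 2).
    by rewrite ler_wpM2r// addr_ge0// sqr_ge0.
  have -> : x ^+ 4 * (a ^+ 2 + b ^+ 2) = (x ^+ 2 * a) ^+ 2 + (x ^+ 2 * b) ^+ 2 by ring.
  lra.
rewrite /series/= (@le_trans _ _ (\sum_(0 <= k < N) 2 * C ^+ 2 * (k.+1%:R ^+ 2)^-1))//.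
  by apply: ler_sum => k _; exact: e.
rewrite -mulr_sumr; have := @sum_inv_sqr_tail R 0 N (leq0n N).
by have := sqr_ge0 C; nra.
Qed.

Lemma H12_smooth u : csmooth (fun x => u (expi x)) -> H12 u.
Proof.
move=> su; have pu : per2pi (fun x => u (expi x)) by move=> x; rewrite expiD2pi.
have [C C0 hC] := csmooth_bounded su pu.
have su' := csmooth_cD su.
have [K K0 hK] := csmooth_bounded (csmooth_cD su') (per2pi_cD su' (per2pi_cD su pu)).
apply: H12_of_energy.
- apply: (@square_integrable_bounded _ C).
    by apply: continuous_measurable_fun; exact: smooth_continuous su.1.
  by move=> x; exact: le_trans (normc_Re _) (hC x).
- apply: (@square_integrable_bounded _ C).
    by apply: continuous_measurable_fun; exact: smooth_continuous su.2.
  by move=> x; exact: le_trans (normc_Im _) (hC x).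
exists (4 * (2 * K) ^+ 2) => N; apply: energy_of_coeff => n n0.
have := fc_decay su pu hK n0; rewrite fourier_fc ler_pdivlMr 1?mulrC//.
by rewrite exprn_even_gt0/= ?intr_eq0.
Qed.

Lemma H12_chi n : H12 (@chi R n).
Proof. by apply: H12_smooth; exact: csmooth_chi. Qed.

Lemma H12_zero : H12 (@czero R).
Proof. by apply: H12_smooth; exact: csmooth_cst. Qed.

End FourierCircle.

Section HardySpaces.
Context {R : realType}.
Implicit Types (u v w : cfun R) (c : R[i]).

(** The two halves are treated together, the Boolean selecting the sign of the
    frequencies; [Hs true] and [Hs false] are convertible to [Hplus] and
    [Hminus]. *)
Definition freq (s : bool) (k : nat) : int := if s then k.+1%:Z else - k.+1%:Z.

Definition Hs (s : bool) : set (cfun R) := closed_span (fun k => chi (freq s k)).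

Lemma freq_inj s : injective (freq s).
Proof. by case: s => a b; rewrite /freq => h; lia. Qed.

Lemma freq_negb s j k : (freq s k == freq (~~ s) j) = false.
Proof. by case: s; rewrite /freq/=; apply/negbTE/eqP; lia. Qed.

Lemma freq_neq0 s k : freq s k != 0.
Proof. by case: s. Qed.

Lemma int_freq (n : int) : n != 0 -> exists s k, n = freq s k.
Proof.
case: n => [[|k]|k] // _; first by exists true, k.
by exists false, k; rewrite NegzE.
Qed.

Lemma energy_freq s u k : energy u k =
  k.+1%:R * (normc (fourier u (freq s k)) ^+ 2 + normc (fourier u (freq (~~ s) k)) ^+ 2).
Proof. by case: s => //; rewrite /energy addrC. Qed.

Definition psum (s : bool) (c : nat -> R[i]) (N : nat) : cfun R :=
  fun z => \sum_(k < N) c k * chi (freq s k) z.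

Lemma csmooth_psum s (c : nat -> R[i]) N : csmooth (fun x => psum s c N (expi x)).
Proof.
by apply: csmooth_sum => i; exact: csmoothM (csmooth_cst _) (csmooth_chi _).
Qed.

Lemma H12_psum s (c : nat -> R[i]) N : H12 (psum s c N).
Proof. by apply: H12_smooth; exact: csmooth_psum. Qed.

Lemma fourier_psum s (c : nat -> R[i]) N n :
  fourier (psum s c N) n = \sum_(k < N) c k * (freq s k == n)%:R.
Proof.
rewrite fourier_fc /psum fc_sum.
  apply: eq_bigr => k _; rewrite -fc_mode; apply: eq_fc => x _.
  by rewrite chi_expi.
by move=> i; exact: csmooth_integrable (csmoothM (csmooth_cst _) (csmooth_chi _)).
Qed.

Lemma fourier_psum_same s (c : nat -> R[i]) N j :
  fourier (psum s c N) (freq s j) = if (j < N)%N then c j else 0.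
Proof.
rewrite fourier_psum; case: ifP => jN.
  rewrite (bigD1 (Ordinal jN))//= eqxx mulr1 big1 ?addr0// => k kj.
  rewrite (inj_eq (@freq_inj s)); have [kj'|] := eqVneq (k : nat) j; last by rewrite mulr0.
  by case/eqP: kj; apply: val_inj.
rewrite big1// => k _; rewrite (inj_eq (@freq_inj s)).
have [kj|] := eqVneq (k : nat) j; last by rewrite mulr0.
by rewrite -kj ltn_ord in jN.
Qed.

Lemma fourier_psum_opp s (c : nat -> R[i]) N j : fourier (psum s c N) (freq (~~ s) j) = 0.
Proof. by rewrite fourier_psum big1// => k _; rewrite freq_negb mulr0. Qed.

Lemma Hs_fourier_opp s u j : Hs s u -> fourier u (freq (~~ s) j) = 0.
Proof.
move=> [hu happ]; apply: normc_eq0 => e e0; have [N [c hc]] := happ e e0.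
have hp := H12_psum s c N.
have := normc_fourier_le (H12B hu hp) (freq_neq0 (~~ s) j).
rewrite fourierB; [|exact: H12_lift_integrable hu|exact: H12_lift_integrable hp].
by rewrite fourier_psum_opp subr0 => /le_trans; apply; exact: ltW.
Qed.

(** The squared error is a tail of the convergent series of the squared norm. *)
Lemma hnorm_psum_cvg s u : H12 u -> (forall j, fourier u (freq (~~ s) j) = 0) ->
  hnorm (csub u (psum s (fun k => fourier u (freq s k)) N)) @[N --> \oo] --> (0 : R).
Proof.
move=> hu h0; set c := fun k => fourier u (freq s k).
have eN N k : energy (csub u (psum s c N)) k = if (k < N)%N then 0 else energy u k.
  have hp := H12_psum s c N.
  rewrite !(energy_freq s) !(fourierB _ (H12_lift_integrable hu) (H12_lift_integrable hp)).
  rewrite fourier_psum_opp h0 subr0 fourier_psum_same; case: ifP => _.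
    by rewrite subrr ComplexField.Normc.normc0 expr0n addr0 mulr0.
  by rewrite subr0.
have hc := H12_energy hu; set L := limn (series (energy u)) in hc.
have ser N M : series (energy (csub u (psum s c N))) M <= L - series (energy u) N.
  have [NM|MN] := leqP N M; last first.
    rewrite /series/= big_nat big1 => [|k /andP[_ kM]].
      by rewrite subr_ge0; exact: nondecreasing_cvgn_le (energy_series_nd u) hc N.
    by rewrite eN (ltn_trans kM MN).
  rewrite lerBrDl; apply: le_trans (nondecreasing_cvgn_le (energy_series_nd u) hc M).
  rewrite /series/= (big_cat_nat _ NM)//= [X in _ <= X](big_cat_nat _ NM)//= lerD2l.
  rewrite [X in X + _]big_nat big1 ?add0r; last first.
    by move=> k /andP[_ kN]; rewrite eN kN.
  rewrite big_nat [X in _ <= X]big_nat ler_sum// => k /andP[Nk _].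
  by rewrite eN ltnNge Nk.
apply/cvgrPdist_le => e e0; have e2 : 0 < e ^+ 2 by rewrite exprn_gt0.
have /cvgrPdist_le/(_ _ e2) := hc; apply: filterS => N hN.
rewrite sub0r normrN ger0_norm ?hnorm_ge0//; apply: hnorm_le; first exact: ltW.
by move=> M; rewrite (le_trans (ser N M))// (le_trans (ler_norm _) hN).
Qed.

(** Closed spans are replaced by a condition on coefficients in all that follows. *)
Lemma HsP s u : Hs s u <-> H12 u /\ forall j, fourier u (freq (~~ s) j) = 0.
Proof.
split=> [h|[hu h0]]; first by split; [case: h|move=> j; exact: Hs_fourier_opp].
split=> // e e0; have /cvgrPdist_lt/(_ _ e0)[N _ hN] := hnorm_psum_cvg hu h0.
exists N, (fun k => fourier u (freq s k)); have := hN N (leqnn N).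
by rewrite sub0r normrN ger0_norm ?hnorm_ge0.
Qed.

Lemma Hs_zero s : Hs s (@czero R).
Proof. by apply/HsP; split; [exact: H12_zero|move=> j; rewrite fourier0]. Qed.

Lemma HsD s u v : Hs s u -> Hs s v -> Hs s (cadd u v).
Proof.
move=> /HsP[hu u0] /HsP[hv v0]; apply/HsP; split; first exact: H12D hu hv.
by move=> j; rewrite (fourierD _ (H12_lift_integrable hu) (H12_lift_integrable hv)) u0 v0 addr0.
Qed.

Lemma HsZ s c u : Hs s u -> Hs s (hscale c u).
Proof.
move=> /HsP[hu u0]; apply/HsP; split; first exact: H12Z hu.
by move=> j; rewrite (fourierZ _ _ (H12_lift_integrable hu)) u0 mulr0.
Qed.

Lemma HsB s u v : Hs s u -> Hs s v -> Hs s (csub u v).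
Proof. by move=> hu hv; rewrite csubE; exact: HsD hu (HsZ _ hv). Qed.

Lemma Hs_chi s k : Hs s (chi (freq s k)).
Proof.
apply/HsP; split; first exact: H12_chi.
by move=> j; rewrite fourier_chi freq_negb.
Qed.

Lemma series_sum_single (a : nat -> R[i]) k : (forall j, j != k -> a j = 0) ->
  series_sum a = a k.
Proof.
move=> h; have aux (g : R[i] -> R) : g 0 = 0 -> limn (series (fun j => g (a j))) = g (a k).
  move=> g0; apply/cvg_lim => //; apply: cvg_near_cst.
  exists k.+1 => // N /= kN; rewrite /series/= (bigD1_seq k)/= ?iota_uniq ?mem_index_iota//.
  by rewrite big1 ?addr0// => j jk; rewrite h.
by rewrite /series_sum !aux//; case: (a k).
Qed.

Lemma inner_single u v s k :
  (forall n, n != 0 -> n != freq s k -> fourier v n = 0) ->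
  inner u v = k.+1%:R * (fourier u (freq s k) * (fourier v (freq s k))^*%C).
Proof.
move=> hv; rewrite /inner (series_sum_single (k := k)) => [|j jk].
  rewrite /inner_term; case: s hv => hv; rewrite /freq.
    by rewrite (hv (- k.+1%:Z)) ?rmorph0 ?mulr0 ?addr0.
  by rewrite (hv k.+1%:Z) ?rmorph0 ?mulr0 ?add0r.
rewrite /inner_term !hv ?rmorph0 ?mulr0 ?addr0 ?mulr0//.
  by apply: contra jk; case: s {hv}; rewrite /freq => /eqP h; apply/eqP; lia.
by apply: contra jk; case: s {hv}; rewrite /freq => /eqP h; apply/eqP; lia.
Qed.

Lemma inner_chi u s k : inner u (chi (freq s k)) = k.+1%:R * fourier u (freq s k).
Proof.
rewrite (@inner_single u _ s k) => [|n _ nk]; rewrite fourier_chi.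
  by rewrite eqxx rmorph1 mulr1.
by rewrite eq_sym (negPf nk).
Qed.
Lemma inner_eq0 u v : (forall n : int, n != 0 -> fourier u n * (fourier v n)^*%C = 0) ->
  inner u v = 0.
Proof.
move=> h; rewrite /inner (series_sum_single (k := 0)) => [|j _].
all: by rewrite /inner_term !h// addr0 mulr0.
Qed.

(** The orthogonality conditions defining the projection only involve the
    coefficients in the chosen half. *)
Lemma proj_specP s u w : lift_integrable u -> Hs s w ->
  (forall v, Hs s v -> inner (csub u w) v = 0) <->
  (forall k, fourier w (freq s k) = fourier u (freq s k)).
Proof.
move=> iu hw; have iw := H12_lift_integrable hw.1; split=> [h k|h v hv].
  have := h _ (Hs_chi s k); rewrite inner_chi => /eqP; rewrite mulf_eq0 pnatr_eq0/=.
  by rewrite (fourierB _ iu iw) subr_eq0 => /eqP.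
apply: inner_eq0 => n n0; have [s' [k ->]] := int_freq n0.
have [->|ss] := eqVneq s' s; first by rewrite (fourierB _ iu iw) h subrr mul0r.
have -> : s' = ~~ s by case: s s' ss {h hv hw} => -[].
by rewrite (Hs_fourier_opp _ hv) rmorph0 mulr0.
Qed.

Lemma proj_Hs s u : Hs s (proj (Hs s) u).
Proof.
by rewrite /proj; case: xgetP => [w _ []//|_]; exact: Hs_zero.
Qed.

(** [proj] picks some representative, with a default value if there is none, so
    its coefficients are known as soon as one candidate [w] is exhibited. *)
Lemma proj_fourier s u w : lift_integrable u -> Hs s w ->
  (forall k, fourier w (freq s k) = fourier u (freq s k)) ->
  forall k, fourier (proj (Hs s) u) (freq s k) = fourier u (freq s k).
Proof.
move=> iu hw /(proj_specP iu hw) hsp; rewrite /proj.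
case: xgetP => [w' _ [hw' /(proj_specP iu hw')]//|/(_ w)[]].
by split.
Qed.

(** For functions that are not smooth, the alternative is left open here and
    decided by the nonvanishing of a coefficient in [Zop_Aop]. *)
Lemma proj_fourier_or s u : lift_integrable u ->
  (forall k, fourier (proj (Hs s) u) (freq s k) = fourier u (freq s k)) \/
  proj (Hs s) u = @czero R.
Proof.
move=> iu; rewrite /proj; case: xgetP => [w _ [hw /(proj_specP iu hw)]|_]; first by left.
by right.
Qed.

End HardySpaces.

Section HalfSeries.
Context {R : realType}.
Implicit Types (u v w : cfun R) (c : R[i]).
Notation D := (`[0, 2 * pi]%classic : set (measurableTypeR R)).

Lemma series_quadratic (a : nat -> R) (B : R) :
  (forall k, `|a k| <= B * (k.+1%:R ^+ 2)^-1) ->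
  cvgn (series a) /\ forall N, `|limn (series a) - series a N| <= 2 * B / N.+1%:R.
Proof.
move=> h; have B0 : 0 <= B by have := h 0; rewrite expr1n invr1 mulr1; apply: le_trans.
have tail N M : (N <= M)%N -> `|series a M - series a N| <= 2 * B / N.+1%:R.
  move=> NM; rewrite sub_series_geq// (le_trans (ler_norm_sum _ _ _))//.
  rewrite (@le_trans _ _ (\sum_(N <= k < M) B * (k.+1%:R ^+ 2)^-1))//.
    by apply: ler_sum => k _; exact: h.
  rewrite -mulr_sumr [2 * B]mulrC -mulrA ler_wpM2l//.
  exact: sum_inv_sqr_tail.
have cv : cvgn (series a).
  apply: normed_cvg; apply: nondecreasing_is_cvgn.
    by apply: nondecreasing_series => k _ _; exact: normr_ge0.
  exists (2 * B) => _ [N _ <-]; rewrite /series/=.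
  rewrite (@le_trans _ _ (\sum_(0 <= k < N) B * (k.+1%:R ^+ 2)^-1))//.
    by apply: ler_sum => k _; exact: h.
  rewrite -mulr_sumr [2 * B]mulrC ler_wpM2l//.
  by have := @sum_inv_sqr_tail R 0 N (leq0n N); rewrite divr1.
split=> // N; apply/ler_addgt0Pl => e e0.
have /cvgrPdist_le/(_ _ e0)[M _ hM] := cv.
have := hM (maxn M N) (leq_maxl _ _); have := tail N (maxn M N) (leq_maxr _ _).
move=> h1 h2; have -> : limn (series a) - series a N =
  (limn (series a) - series a (maxn M N)) + (series a (maxn M N) - series a N) by ring.
by rewrite (le_trans (ler_normD _ _))// lerD.
Qed.

(** The projections of a smooth function exist: each half of its Fourier series
    converges uniformly, which determines the coefficients of the sum. *)
Lemma smooth_half s (f : R -> R[i]) : csmooth f -> per2pi f ->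
  exists2 w, Hs s w & forall k, fourier w (freq s k) = fc f (freq s k).
Proof.
move=> sf pf; have sf' := csmooth_cD sf.
have [C C0 hC] := csmooth_bounded (csmooth_cD sf') (per2pi_cD sf' (per2pi_cD sf pf)).
pose c k := fc f (freq s k); pose B := 2 * C.
have hc k : normc (c k) <= B * (k.+1%:R ^+ 2)^-1.
  have := fc_decay sf pf hC (freq_neq0 s k); congr (_ <= _ * (_)^-1).
  by rewrite /freq; case: s {c} => //=; rewrite mulrNz sqrrN.
pose t k (z : circle R) := c k * chi (freq s k) z.
pose w : cfun R := fun z => series_sum (fun k => t k z).
have ht k x : normc (t k (expi x)) <= B * (k.+1%:R ^+ 2)^-1.
  by rewrite /t chi_expi normc_MeI.
have hR x := series_quadratic (fun k => le_trans (normc_Re _) (ht k x)).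
have hI x := series_quadratic (fun k => le_trans (normc_Im _) (ht k x)).
have psE N x : psum s c N (expi x) = series (fun k => complex.Re (t k (expi x))) N
    +i* series (fun k => complex.Im (t k (expi x))) N.
  rewrite /psum /series/= !big_mkord; apply: complex_ext => /=.
    by elim/big_rec2 : _ => [//|i a b _ <-]; rewrite cReD.
  by elim/big_rec2 : _ => [//|i a b _ <-]; rewrite cImD.
have err N x : normc (w (expi x) - psum s c N (expi x)) <= 4 * B / N.+1%:R.
  rewrite (le_trans (normc_le_ReIm _))// psE cReB cImB /w /series_sum/=.
  have -> : 4 * B / N.+1%:R = 2 * B / N.+1%:R + 2 * B / N.+1%:R by ring.
  by apply: lerD; [exact: (hR x).2|exact: (hI x).2].
have m1 : measurable_fun [set: measurableTypeR R] (fun x => complex.Re (w (expi x))).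
  apply: (@measurable_fun_cvg _ _ _ _ (fun N x => complex.Re (psum s c N (expi x)))) => //.
    move=> N; apply: continuous_measurable_fun.
    exact: smooth_continuous (csmooth_psum s c N).1.
  move=> x _; have -> : (fun N => complex.Re (psum s c N (expi x))) =
      series (fun k => complex.Re (t k (expi x))).
    by apply/funext => N; rewrite psE.
  exact: (hR x).1.
have m2 : measurable_fun [set: measurableTypeR R] (fun x => complex.Im (w (expi x))).
  apply: (@measurable_fun_cvg _ _ _ _ (fun N x => complex.Im (psum s c N (expi x)))) => //.
    move=> N; apply: continuous_measurable_fun.
    exact: smooth_continuous (csmooth_psum s c N).2.
  move=> x _; have -> : (fun N => complex.Im (psum s c N (expi x))) =
      series (fun k => complex.Im (t k (expi x))).
    by apply/funext => N; rewrite psE.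
  exact: (hI x).1.
have wb x : normc (w (expi x)) <= 4 * B.
  have := err 0 x; rewrite /psum big_ord0 subr0 divr1//.
have i1 := square_integrable_bounded m1 (fun x => le_trans (normc_Re _) (wb x)).
have i2 := square_integrable_bounded m2 (fun x => le_trans (normc_Im _) (wb x)).
have iw : lift_integrable w by split; exact: square_integrable_rintegrable.
have fw n (l : R[i]) M : (forall N, (M <= N)%N -> fourier (psum s c N) n = l) ->
    fourier w n = l.
  move=> hl; apply/eqP; rewrite -subr_eq0; apply/eqP; apply: normc_eq0 => e e0.
  have [M' hM'] : exists M', 2 * (4 * B) / M'.+1%:R <= e.
    exists (Num.truncn (2 * (4 * B) / e)).
    rewrite ler_pdivrMr// [e * _]mulrC -ler_pdivrMr//; apply: ltW; exact: truncnS_gt.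
  rewrite -(hl (maxn M M') (leq_maxl _ _)) -fourierB//; last first.
    exact: H12_lift_integrable (H12_psum _ _ _).
  rewrite fourier_fc; apply: (le_trans _ hM').
  have -> : 2 * (4 * B) / M'.+1%:R = 2 * (4 * B / M'.+1%:R) by ring.
  apply: normc_fc_bounded.
    apply: cintegrableB => //; exact: H12_lift_integrable (H12_psum _ _ _).
  move=> x _; rewrite (le_trans (err _ x))// ler_wpM2l//.
    by rewrite mulr_ge0// mulr_ge0// ltW.
  by rewrite lef_pV2 ?posrE// ler_nat ltnS leq_maxr.
have fs k : fourier w (freq s k) = c k.
  by apply: (fw _ _ k.+1) => N kN; rewrite fourier_psum_same kN.
have fo k : fourier w (freq (~~ s) k) = 0.
  by apply: (fw _ _ 0) => N _; rewrite fourier_psum_opp.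
exists w => //; apply/HsP; split=> //; apply: H12_of_energy => //.
exists (4 * B ^+ 2) => N; apply: energy_of_coeff => n n0.
have n2 : 0 < (n%:~R : R) ^+ 2 by rewrite exprn_even_gt0/= ?intr_eq0.
rewrite mulrC -ler_pdivlMr//; move: (fc_decay sf pf hC n0).
have [s' [k ->]] := int_freq n0.
have [->|ss] := eqVneq s' s; first by rewrite fs.
have -> : s' = ~~ s.
  by case: s s' ss {c t w ht hR hI psE err m1 m2 wb i1 i2 iw fw fs fo hc} => -[].
move=> h; rewrite fo ComplexField.Normc.normc0; exact: le_trans (normc_ge0 _) h.
Qed.

Lemma circle_int_ae (f g : R -> R[i]) : cmeasurable f -> cmeasurable g ->
  {ae (@lebesgue_measure R), forall x, f x = g x} -> circle_int f = circle_int g.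
Proof.
move=> [f1 f2] [g1 g2] h; rewrite !circle_intE /rint /Rintegral.
have aux (p : R[i] -> R) : measurable_fun D (fun x => p (f x)) ->
    measurable_fun D (fun x => p (g x)) ->
    (\int[lebesgue_measure]_(x in D) (p (f x))%:E =
     \int[lebesgue_measure]_(x in D) (p (g x))%:E)%E.
  move=> mf mg; apply: ae_eq_integral => //; try exact/measurable_EFinP.
  case: h => N [mN N0 hN]; exists N; split=> // x /= hx; apply: hN => /= hf.
  by apply: hx => _; rewrite hf.
by rewrite !aux.
Qed.

(** An additive constant contributes at frequency zero only. *)
Lemma class_eq_fourier u v (n : int) : lift_integrable u -> lift_integrable v ->
  class_eq u v -> n != 0 -> fourier u n = fourier v n.
Proof.
move=> iu iv [c huv] n0; pose cc : R -> R[i] := fun=> c.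
have icc : cintegrable cc by exact: csmooth_integrable (csmooth_cst c).
transitivity (fc (fun x => v (expi x) + cc x) n).
  rewrite fourier_fc /fc; congr (_ * _).
  have meas (f : R -> R[i]) : cintegrable f -> cmeasurable f.
    by move=> [? ?]; split; exact: rintegrable_measurable.
  apply: circle_int_ae.
  - by apply: meas; exact: cintegrableMs iu (csmooth_eInN _).
  - by apply: meas; exact: cintegrableMs (cintegrableD iv icc) (csmooth_eInN _).
  - case: huv => N [mN N0 hN]; exists N; split=> // x /= hx; apply: hN => /= hf.
    by apply: hx; rewrite hf.
rewrite fcD// fourier_fc -[RHS]addr0; congr (_ + _).
have := fc_mode c 0 n; rewrite eq_sym (negPf n0) mulr0 => <-.
by apply: eq_fc => x _; rewrite mul0r eI0 mulr1.
Qed.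

End HalfSeries.

(** * Composition with a diffeomorphism of the circle *)

Section KernelBound.
Context {R : realType} (f : R -> R) (sf : smooth f) (f_gt0 : forall x, 0 < f^`() x)
  (fD2pi : forall x, f (x + 2 * pi) = f x + 2 * pi).

Lemma per2pi_lift_derive1 : per2pi f^`().
Proof.
have pg : per2pi (fun x => f x - x) by move=> x; rewrite fD2pi; ring.
have sg : smooth (fun x => f x - x) := smoothB sf (@smooth_id R).
have e : (fun x => f x - x)^`() = fun x => f^`() x - 1.
  exact: is_derive1_fun (fun x => is_derive1B (smooth_is_derive x sf) (is_derive1_id x)).
by move=> x; have := per2pi_derive1 sg pg x; rewrite e => /addIr.
Qed.

Lemma lift_derive1_lower : exists2 c, 0 < c <= 1 & forall x, c <= f^`() x.
Proof.
have sV : smooth (fun x => (f^`() x)^-1).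
  by apply: smoothV => [x|]; [rewrite gt_eqF|exact: smooth_derive1].
have pV : per2pi (fun x => (f^`() x)^-1) by move=> x; rewrite per2pi_lift_derive1.
have [B B0 hB] := per2pi_bounded (smooth_continuous sV) pV.
exists (Num.min 1 B^-1) => [|x]; first by rewrite lt_min ltr01 invr_gt0 B0 ge_min lexx.
rewrite ge_min; apply/orP; right; rewrite -[leRHS]invrK lef_pV2 ?posrE ?invr_gt0//.
exact: le_trans (ler_norm _) (hB x).
Qed.

(** The derivative of [E' E], for [E] the reciprocal of the phase speed, in the
    factored form used to estimate it in [kernel_decay]. *)
Lemma kernel_alg (u v w : R) : - u * w ^+ 3 + 3 * v ^+ 2 * w ^+ 4 =
  - (u * (w * w) + v * (- (v * (w * w)) * w + w * - (v * (w * w)))) * w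
  + - (v * (w * w)) * - (v * (w * w)).
Proof. by ring. Qed.

(** The phase [k f x + l x] has derivative at least a multiple of [k + l], so
    integrating by parts twice gives decay in [k + l]. *)
Lemma kernel_decay : exists2 C, 0 < C & forall k l : nat, (0 < k)%N -> (0 < l)%N ->
  normc (fc (fun x => eI (k%:R * f x)) (- l%:Z)) <= C / (k + l)%:R ^+ 2.
Proof.
have [c /andP[c0 c1] hc] := lift_derive1_lower.
have sf1 := smooth_derive1 sf; have sf2 := smooth_derive1 sf1.
have pf1 := per2pi_lift_derive1; have pf2 := per2pi_derive1 sf1 pf1.
have [C2 C20 hC2] := per2pi_bounded (smooth_continuous sf2) pf2.
have [C3 C30 hC3] := per2pi_bounded (smooth_continuous (smooth_derive1 sf2)) (per2pi_derive1 sf2 pf2).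
exists (2 * (C3 / c ^+ 3 + 3 * C2 ^+ 2 / c ^+ 4)) => [|k l k0 l0].
  by rewrite mulr_gt0// addr_gt0// divr_gt0 ?mulr_gt0 ?exprn_gt0.
have kr : 0 < k%:R :> R by rewrite ltr0n.
have lr : 0 < l%:R :> R by rewrite ltr0n.
have klE : (k + l)%:R = k%:R + l%:R :> R by rewrite natrD.
rewrite klE.
pose theta x := k%:R * f x + l%:R * x.
pose T x := k%:R * f^`() x + l%:R.
have dth (x : R) : is_derive x 1 theta (T x).
  have := is_derive1D (is_derive1M (is_derive1_cst k%:R x) (smooth_is_derive x sf))
    (is_derive1M (is_derive1_cst l%:R x) (is_derive1_id x)).
  by rewrite !mul0r !add0r mulr1.
have sth : smooth theta.
  by apply: smoothD; apply: smoothM;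
    [exact: smooth_cst|exact: sf|exact: smooth_cst|exact: smooth_id].
have sT : smooth T by rewrite -(is_derive1_fun dth); exact: smooth_derive1 sth.
have T_ge x : c * (k%:R + l%:R) <= T x.
  by rewrite /T mulrDr lerD// ?[c * _]mulrC ?ler_wpM2l ?(ltW kr) ?hc// ger_pMr.
have T_gt0 x : 0 < T x by rewrite (lt_le_trans _ (T_ge x))// mulr_gt0// addr_gt0.
have T_neq0 x : T x != 0 by rewrite gt_eqF.
(* Integrating by parts divides by the phase speed [T] and differentiates. *)
pose E x := (T x)^-1; have TE x : T x * E x = 1 by rewrite /E mulfV.
pose E1 x := - (k%:R * f^`()^`() x * (E x * E x)).
have dT (x : R) : is_derive x 1 T (k%:R * f^`()^`() x).
  have := is_derive1D (is_derive1M (is_derive1_cst k%:R x) (smooth_is_derive x sf1))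
    (is_derive1_cst l%:R x).
  by rewrite mul0r add0r addr0.
have dE (x : R) : is_derive x 1 E (E1 x) := is_derive1_inv (T_neq0 x) (dT x).
have sE : smooth E := smoothV T_neq0 sT.
have sE1 : smooth E1 by rewrite -(is_derive1_fun dE); exact: smooth_derive1 sE.
pose H x := E1 x * E x.
pose H1 x := - (k%:R * f^`()^`()^`() x) * (E x) ^+ 3
  + 3 * (k%:R * f^`()^`() x) ^+ 2 * (E x) ^+ 4.
have dH (x : R) : is_derive x 1 H (H1 x).
  have d2 : is_derive x 1 (fun y => k%:R * f^`()^`() y) (k%:R * f^`()^`()^`() x).
    have := is_derive1M (is_derive1_cst k%:R x) (smooth_is_derive x sf2).
    by rewrite mul0r add0r.
  have h := is_derive1M (is_derive1N (is_derive1M d2 (is_derive1M (dE x) (dE x)))) (dE x).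
  have e : H1 x = - (k%:R * f^`()^`()^`() x * (E x * E x)
      + k%:R * f^`()^`() x * (E1 x * E x + E x * E1 x)) * E x + E1 x * E1 x.
    exact: kernel_alg.
  by rewrite e; exact: h.
have sH : smooth H := smoothM sE1 sE.
have pe : per2pi (fun x => eI (theta x)).
  move=> x; rewrite /theta fD2pi.
  have -> : k%:R * (f x + 2 * pi) + l%:R * (x + 2 * pi) =
    k%:R * f x + l%:R * x + (k + l)%:Z%:~R * (2 * pi) by rewrite [_%:~R]klE; ring.
  by rewrite eID eIn2pi mulr1.
have pT : per2pi T by move=> x; rewrite /T pf1.
have pE : per2pi E by move=> x; rewrite /E pT.
have pE1 : per2pi E1 by move=> x; rewrite /E1 pf2 pE.
have se := csmooth_eI sth.
have parts (a a' : R -> R) : smooth a -> (forall x : R, is_derive x 1 a (a' x)) ->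
    per2pi a -> circle_int (fun x => 'i * (T x * a x)%:C * eI (theta x)) =
    - circle_int (fun x => (a' x)%:C * eI (theta x)).
  move=> sa da pa; have csa := csmooth_real sa.
  have sa' : smooth a' by rewrite -(is_derive1_fun da); exact: smooth_derive1.
  have := circle_int_cD (csmoothM csa se) _.
  rewrite (cDM csa se) (cD_real sa) (cD_eI sth) (is_derive1_fun da) (is_derive1_fun dth).
  have p0 : per2pi (fun x => (a x)%:C * eI (theta x)) by move=> x; rewrite pa pe.
  move=> /(_ p0); rewrite circle_intD.
  - move=> /eqP; rewrite addrC addr_eq0 => /eqP <-; apply: eq_circle_int => x _.
    by rewrite (rmorphM (real_complex R)); ring.
  - exact: csmooth_integrable (csmoothM (csmooth_real sa') se).
  - apply: csmooth_integrable; apply: csmoothM csa _; apply: csmoothM se.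
    exact: csmoothM (csmooth_cst _) (csmooth_real sT).
have ie (a : R -> R) : smooth a -> cintegrable (fun x => (a x)%:C * eI (theta x)).
  by move=> sa; exact: csmooth_integrable (csmoothM (csmooth_real sa) se).
have ie1 : cintegrable (fun x => eI (theta x)) := csmooth_integrable se.
have sH1 : smooth H1 by rewrite -(is_derive1_fun dH); exact: smooth_derive1 sH.
have eq1 : 'i * circle_int (fun x => eI (theta x)) = - circle_int (fun x => (E1 x)%:C * eI (theta x)).
  transitivity (circle_int (fun x => 'i * (T x * E x)%:C * eI (theta x))); last first.
    exact: parts sE dE pE.
  rewrite -(circle_intZ 'i ie1); apply: eq_circle_int => x _.
  by rewrite TE mulr1.
have eq2 : 'i * circle_int (fun x => (E1 x)%:C * eI (theta x)) =
    - circle_int (fun x => (H1 x)%:C * eI (theta x)).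
  have pH : per2pi H by move=> x; rewrite /H pE1 pE.
  transitivity (circle_int (fun x => 'i * (T x * H x)%:C * eI (theta x))); last first.
    exact: parts sH dH pH.
  rewrite -(circle_intZ 'i (ie _ sE1)); apply: eq_circle_int => x _.
  have -> : T x * H x = E1 x by rewrite /H mulrCA TE mulr1.
  by rewrite mulrA.
have eq3 : circle_int (fun x => eI (theta x)) = - circle_int (fun x => (H1 x)%:C * eI (theta x)).
  have i2 : 'i * 'i = -1 :> R[i] by rewrite -expr2 sqr_i.
  by rewrite -eq2 -[circle_int (fun x => (E1 x)%:C * _)]opprK -eq1 mulrN mulrA i2 mulN1r opprK.
have -> : fc (fun x => eI (k%:R * f x)) (- l%:Z) =
    - fc (fun x => (H1 x)%:C * eI (theta x)) 0.
  rewrite /fc -mulrN; congr (_ * _).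
  rewrite (@eq_circle_int _ _ (fun x => eI (theta x))); last first.
    by move=> x _; rewrite -eID /theta; congr eI; rewrite mulrNz mulNr opprK.
  rewrite eq3; congr (- _); apply: eq_circle_int => x _.
  by rewrite mul0r oppr0 eI0 mulr1.
rewrite normcN -[leRHS]mulrA; apply: normc_fc_bounded; first exact: ie.
move=> x _; rewrite normc_MeI normcR.
have s0 : 0 < k%:R + l%:R :> R by rewrite addr_gt0.
have E0 : 0 < E x by rewrite invr_gt0.
have EB : E x <= (c * (k%:R + l%:R))^-1 by rewrite lef_pV2 ?posrE// mulr_gt0.
have h2 := hC2 x; have h3 := hC3 x.
rewrite (le_trans (ler_normD _ _))// [leRHS]mulrDl lerD//.
  rewrite normrM normrN normrM (gtr0_norm kr) normrX (gtr0_norm E0).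
  rewrite (@le_trans _ _ ((k%:R + l%:R) * C3 * (c * (k%:R + l%:R))^-1 ^+ 3))//.
    apply: ler_pM; rewrite ?mulr_ge0 ?exprn_ge0 ?(ltW kr) ?(ltW E0)//.
      by apply: ler_pM; rewrite ?(ltW kr)// lerDl ltW.
    by rewrite ler_pXn2r// nnegrE ?(ltW E0)// invr_ge0 mulr_ge0// ltW.
  rewrite le_eqVlt; apply/orP; left; apply/eqP; field; rewrite !gt_eqF//.
rewrite normrM normrM !normrX normrM (gtr0_norm kr) (gtr0_norm E0) ger0_norm//.
rewrite (@le_trans _ _ (3 * ((k%:R + l%:R) * C2) ^+ 2 * (c * (k%:R + l%:R))^-1 ^+ 4))//.
  apply: ler_pM; rewrite ?mulr_ge0 ?exprn_ge0 ?(ltW kr) ?(ltW E0)//.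
    rewrite ler_wpM2l// ler_pXn2r// ?nnegrE ?mulr_ge0 ?(ltW kr) ?(ltW s0) ?(ltW C20)//.
    by apply: ler_pM; rewrite ?(ltW kr)// lerDl ltW.
  by rewrite ler_pXn2r// nnegrE ?(ltW E0)// invr_ge0 mulr_ge0// ltW.
rewrite le_eqVlt; apply/orP; left; apply/eqP; field; rewrite !gt_eqF//.
Qed.

End KernelBound.

Section Composition.
Context {R : realType} (h : circle R -> circle R) (hd : diff_plus h).
Implicit Types (u v d : cfun R).

(** An increasing lift of a bijection of the circle has degree one: a larger
    jump over a period would make the intermediate value theorem produce a
    second preimage. *)
Lemma diff_plus_lift : exists f : R -> R,
  [/\ smooth f, is_lift h f, forall x, 0 < f^`() x &
      forall x, f (x + 2 * pi) = f x + 2 * pi].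
Proof.
have [_ [g _ [hK _]] [f [sf lf] f0]] := hd.
exists f; split=> // x.
have cf : continuous f by exact: smooth_continuous.
have p2 := @pi2_gt0 R.
have hlt : f x < f (x + 2 * pi).
  have xlt : x < x + 2 * pi by rewrite ltrDl.
  have [|c _ hc] := MVT xlt (fun y _ => smooth_is_derive y sf).
    exact: continuous_subspaceT.
  by rewrite -subr_gt0 hc mulr_gt0// addrAC subrr add0r.
have e1 : eI (f (x + 2 * pi) - f x) = 1.
  have e : expi (f (x + 2 * pi)) = expi (f x) by rewrite -!lf expiD2pi.
  have /= := congr1 (@sval _ _) e; rewrite -/(eI _) -/(eI _) => e'.
  by rewrite eID e' eIMN.
case: (ltgtP (f (x + 2 * pi)) (f x + 2 * pi)) => // hc.
  have hh : 0 < f (x + 2 * pi) - f x < 2 * pi by rewrite subr_gt0 hlt/= ltrBlDl.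
  by move: (eI_neq1 hh); rewrite e1 eqxx.
have xle : x <= x + 2 * pi by rewrite lerDl ltW.
have [| |y] := @IVT R f x (x + 2 * pi) (f x + 2 * pi) xle.
- exact: continuous_subspaceT.
- by rewrite min_l ?max_r ?(ltW hlt)// lerDl (ltW p2)/= ltW.
rewrite in_itv/= => /andP[y1 y2] hy.
have xy : x < y.
  by rewrite lt_neqAle y1 andbT; apply/eqP => xy; move: hy; rewrite -xy => /eqP; rewrite -subr_eq0; apply/negP; rewrite lt_eqF//; lra.
have yx : y < x + 2 * pi.
  by rewrite lt_neqAle y2 andbT; apply/eqP => xy'; move: hc; rewrite -xy' hy ltxx.
have e : expi y = expi x.
  by apply: (can_inj hK); rewrite !lf hy expiD2pi.
have /= := congr1 (@sval _ _) e; rewrite -/(eI _) -/(eI _) => e'.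
have hh : 0 < y - x < 2 * pi by rewrite subr_gt0 xy/= ltrBlDl.
by move: (eI_neq1 hh); rewrite eID e' eIMN eqxx.
Qed.

Lemma Vop_chi_lift (f : R -> R) (n : int) x : is_lift h f ->
  Vop h (chi n) (expi x) = eI (n%:~R * f x).
Proof. by move=> lf; rewrite /Vop/= lf chi_expi. Qed.

(** Measurability on the whole line, since lifts of diffeomorphisms move the
    fundamental domain. *)
Definition borel_lift u :=
  measurable_fun [set: measurableTypeR R] (fun x => complex.Re (u (expi x))) /\
  measurable_fun [set: measurableTypeR R] (fun x => complex.Im (u (expi x))).

Lemma borel_liftM (f g : R -> R[i]) :
  measurable_fun [set: measurableTypeR R] (fun x => complex.Re (f x)) ->
  measurable_fun [set: measurableTypeR R] (fun x => complex.Im (f x)) ->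
  csmooth g ->
  measurable_fun [set: measurableTypeR R] (fun x => complex.Re (f x * g x)) /\
  measurable_fun [set: measurableTypeR R] (fun x => complex.Im (f x * g x)).
Proof.
move=> m1 m2 [g1 g2].
have n1 : measurable_fun [set: measurableTypeR R] (fun x => complex.Re (g x)).
  by apply: continuous_measurable_fun; exact: smooth_continuous g1.
have n2 : measurable_fun [set: measurableTypeR R] (fun x => complex.Im (g x)).
  by apply: continuous_measurable_fun; exact: smooth_continuous g2.
split.
  have -> : (fun x => complex.Re (f x * g x)) = (fun x =>
      complex.Re (f x) * complex.Re (g x) - complex.Im (f x) * complex.Im (g x)).
    by apply/funext => x; rewrite cReM.
  by apply: measurable_funB; exact: measurable_funM.
have -> : (fun x => complex.Im (f x * g x)) = (fun x =>
    complex.Re (f x) * complex.Im (g x) + complex.Im (f x) * complex.Re (g x)).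
  by apply/funext => x; rewrite cImM.
by apply: measurable_funD; exact: measurable_funM.
Qed.

(** Fourier coefficients of [d \o h], rewritten as pairings of [d] with smooth
    functions by substituting the inverse diffeomorphism. *)
Lemma compose_kernel : exists G : int -> R -> R[i],
  (forall n, csmooth (G n) /\ per2pi (G n)) /\
  forall d, borel_lift d -> lift_integrable d ->
    lift_integrable (Vop h d) /\
    forall n, fourier (Vop h d) n = fc (fun x => d (expi x) * G n x) 0.
Proof.
have [_ [g [p sp lp] [hK _]] _] := hd.
have [f [sf lf f0 fD]] := diff_plus_lift.
have gE x : eI (p x) = sval (g (expi x)) by rewrite lp.
have sp' := smooth_derive1 sp.
have ep : per2pi (fun x => eI (p x)) by move=> x; rewrite !gE expiD2pi.
have pp' : per2pi p^`().
  move=> x; have := per2pi_cD (csmooth_eI sp) ep x; rewrite (cD_eI sp).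
  rewrite (ep x) => /(mulIf (eI_neq0 _)).
  have i0 : 'i != 0 :> R[i] by rewrite eq_complex/= oner_eq0 andbF.
  by move=> /(mulfI i0)/complexI.
have pf x : eI (p (f x)) = eI x.
  by rewrite gE -lf hK.
have ppf x : p^`() (f x) * f^`() x = 1.
  have spf := smooth_comp sp sf.
  have d1 := is_derive1_fun (fun y => is_derive1_compose (smooth_is_derive _ sp) (smooth_is_derive y sf)).
  have := cD_eI spf; rewrite d1 => e1.
  have := cD_eI (@smooth_id R); rewrite (is_derive1_fun (@is_derive1_id R)) => e2.
  have e3 : (fun x => eI (p (f x))) = (fun x => eI x) by apply/funext.
  rewrite e3 e2 in e1; have := congr1 (fun F => F x) e1.
  rewrite /= pf => /(mulIf (eI_neq0 _)).
  have i0 : 'i != 0 :> R[i] by rewrite eq_complex/= oner_eq0 andbF.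
  by move=> /(mulfI i0)/complexI ->.
pose G (n : int) x := (p^`() x)%:C * eI (- n%:~R * p x).
have sG n : csmooth (G n).
  apply: csmoothM; first exact: csmooth_real.
  apply: csmooth_eI; exact: smoothM (@smooth_cst R _) sp.
have eIn (x y : R) (n : int) : eI x = eI y -> eI (- n%:~R * x) = eI (- n%:~R * y).
  by move=> e; rewrite -mulrNz -!eI_exprz e.
have pG n : per2pi (G n).
  by move=> x; rewrite /G pp' (eIn _ _ n (ep x)).
exists G; split=> [n|d [m1 m2] id]; first by [].
have key n : cintegrable (fun x => Vop h d (expi x) * eI (- (n%:~R * x))) /\
    circle_int (fun x => Vop h d (expi x) * eI (- (n%:~R * x))) =
    circle_int (fun x => d (expi x) * G n x).
  have [k1 k2] := borel_liftM m1 m2 (sG n).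
  have pd : per2pi (fun x => d (expi x) * G n x) by move=> x; rewrite expiD2pi pG.
  have [i1 <-] := circle_int_substitution sf f0 fD k1 k2 pd (cintegrableMs id (sG n)).
  have e x : (f^`() x)%:C * (d (expi (f x)) * G n (f x)) =
      Vop h d (expi x) * eI (- (n%:~R * x)).
    rewrite /Vop/= lf /G (eIn _ _ n (pf x)) mulNr.
    transitivity (d (expi (f x)) * eI (- (n%:~R * x)) *
      ((p^`() (f x))%:C * (f^`() x)%:C)); first by ring.
    by rewrite -(rmorphM (real_complex R)) ppf rmorph1 mulr1.
  split; first exact: cintegrable_ext e i1.
  by apply: eq_circle_int => x _; rewrite e.
split=> [|n].
  apply: (cintegrable_ext _ (key 0).1) => x.
  by rewrite mul0r oppr0 eI0 mulr1.
rewrite fourier_fc /fc (key n).2; congr (_ * _); apply: eq_circle_int => x _.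
by rewrite mul0r oppr0 eI0 mulr1.
Qed.

Lemma borel_lift_H12 u : H12 u -> borel_lift u.
Proof. exact: H12_measurable. Qed.

Lemma Vop_lift_integrable d : H12 d -> lift_integrable (Vop h d).
Proof.
move=> hu; have [G [_ key]] := compose_kernel.
exact: (key d (borel_lift_H12 hu) (H12_lift_integrable hu)).1.
Qed.

Lemma Vop_chi0 n : n != 0 -> fourier (Vop h (chi 0)) n = 0.
Proof.
move=> n0; rewrite fourier_fc; have := fc_mode (1 : R[i]) 0 n.
rewrite eq_sym (negPf n0) mulr0 => <-; apply: eq_fc => x _.
by rewrite /Vop/= /chi expr0z mul0r eI0 mulr1.
Qed.

(** By [compose_kernel] the coefficients of [d \o h] are pairings of [d] with
    smooth functions, and these can be computed mode by mode. *)
Lemma compose_fourier d n : Hs true d -> n != 0 -> exists C, forall N,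
  normc (fourier (Vop h d) n -
    \sum_(k < N) fourier d k.+1%:Z * fourier (Vop h (chi k.+1%:Z)) n) <= C / N.+1%:R.
Proof.
move=> hsd n0; have [G [sG key]] := compose_kernel.
have hu := hsd.1; have id := H12_lift_integrable hu.
have [_ kd] := key d (borel_lift_H12 hu) id.
have kchi m : fourier (Vop h (chi m)) n = fc (G n) (- m).
  have hm := H12_chi (R := R) m.
  rewrite (key _ (borel_lift_H12 hm) (H12_lift_integrable hm)).2 -[- m]sub0r -fc_shift.
  by apply: eq_fc => x _; rewrite chi_expi mulrC.
have [C hC] := fourier_pairing id (sG n).1 (sG n).2.
exists C => N; have := hC N; rewrite -kd; congr (normc (_ - _) <= _).
rewrite /symsum big_mkord.
have -> : fc (G n) 0 = 0 by have := kchi 0; rewrite oppr0 => <-; exact: Vop_chi0.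
rewrite mul0r add0r; apply: eq_bigr => k _.
rewrite opprK -!fourier_fc kchi.
have -> : fourier d (- k.+1%:Z) = 0 by exact: (Hs_fourier_opp k hsd).
by rewrite mulr0 add0r mulrC.
Qed.

End Composition.

(** * Injectivity of composition on the positive half *)

Section Injectivity.
Context {R : realType}.

Lemma conjcM (z w : R[i]) : (z * w)^*%C = z^*%C * w^*%C.
Proof. exact: rmorphM. Qed.

Lemma conjcB (z w : R[i]) : (z - w)^*%C = z^*%C - w^*%C.
Proof. exact: rmorphB. Qed.

Lemma fc0E (f : R -> R[i]) : fc f 0 = ((2 * pi)^-1)%:C * circle_int f.
Proof.
by congr (_ * _); apply: eq_circle_int => x _; rewrite mul0r oppr0 eI0 mulr1.
Qed.

Lemma fc0_substitution (f : R -> R) (F : R -> R[i]) : smooth f ->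
  (forall x, 0 < f^`() x) -> (forall x, f (x + 2 * pi) = f x + 2 * pi) ->
  measurable_fun [set: measurableTypeR R] (fun x => complex.Re (F x)) ->
  measurable_fun [set: measurableTypeR R] (fun x => complex.Im (F x)) ->
  per2pi F -> cintegrable F ->
  fc (fun x => (f^`() x)%:C * F (f x)) 0 = fc F 0.
Proof.
move=> sf f0 fD m1 m2 pF iF; rewrite !fc0E.
by rewrite (circle_int_substitution sf f0 fD m1 m2 pF iF).2.
Qed.

Lemma conjcR (a : R) : (a%:C)^*%C = a%:C.
Proof. by apply: complex_ext; rewrite /= ?oppr0. Qed.

Lemma conjci : ('i : R[i])^*%C = - 'i.
Proof. by apply: complex_ext; rewrite /= ?oppr0. Qed.

Lemma le_add_invn (a b C : R) : (forall N : nat, a <= b + C / N.+1%:R) -> a <= b.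
Proof.
move=> h; apply/ler_addgt0Pl => e e0; rewrite addrC.
pose N := Num.truncn (`|C| / e).
rewrite (le_trans (h N))// lerD2l (@le_trans _ _ (`|C| / N.+1%:R))//.
  by rewrite ler_wpM2r ?invr_ge0// ler_norm.
by rewrite ler_pdivrMr// [e * _]mulrC -ler_pdivrMr//; apply: ltW; exact: truncnS_gt.
Qed.

Lemma cauchy_schwarz_weighted (x y w : nat -> R) N :
  (forall k, 0 <= x k) -> (forall k, 0 <= y k) -> (forall k, 0 < w k) ->
  (\sum_(k < N) x k * y k) ^+ 2 <=
  (\sum_(k < N) w k * x k ^+ 2) * (\sum_(k < N) (w k)^-1 * y k ^+ 2).
Proof.
move=> x0 y0 w0; elim: N => [|N IH]; first by rewrite !big_ord0 mul0r expr0n.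
rewrite !big_ord_recr/=; move: IH.
set S := \sum_(i < N) x i * y i; set A := \sum_(i < N) w i * _; set B := \sum_(i < N) (w i)^-1 * _.
have S0 : 0 <= S by apply: sumr_ge0 => i _; rewrite mulr_ge0.
have A0 : 0 <= A by apply: sumr_ge0 => i _; rewrite mulr_ge0 ?sqr_ge0// ltW.
have B0 : 0 <= B by apply: sumr_ge0 => i _; rewrite mulr_ge0 ?sqr_ge0// invr_ge0 ltW.
move: (x N) (y N) (w N) (x0 N) (y0 N) (w0 N) => {x0 y0 w0} p q v p0 q0 v0 IH.
have vV : v * v^-1 = 1 by rewrite mulfV// gt_eqF.
have vV0 : 0 < v^-1 by rewrite invr_gt0.
move: (v^-1) vV vV0 => u vu u0.
pose P := A * (u * q ^+ 2); pose Q := B * (v * p ^+ 2).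
have P0 : 0 <= P by rewrite mulr_ge0// mulr_ge0 ?sqr_ge0// ltW.
have Q0 : 0 <= Q by rewrite mulr_ge0// mulr_ge0 ?sqr_ge0// ltW.
have PQ : (S * (p * q)) ^+ 2 <= P * Q.
  have -> : P * Q = (A * B) * (p * q) ^+ 2.
    rewrite /P /Q; transitivity (A * B * (p * q) ^+ 2 * (v * u)); first by ring.
    by rewrite vu mulr1.
  by rewrite exprMn ler_wpM2r// sqr_ge0.
have SP : 2 * (S * (p * q)) <= P + Q.
  have PQ0 := addr_ge0 P0 Q0; have SP0 : 0 <= S * (p * q) by rewrite !mulr_ge0.
  have := sqr_ge0 (P - Q); rewrite leNgt => h; apply/negP => hlt; move: h; apply/negP; rewrite negbK.
  by nra.
have -> : (A + v * p ^+ 2) * (B + u * q ^+ 2) =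
    A * B + (P + Q) + (v * u) * (p * q) ^+ 2 by rewrite /P /Q; ring.
by rewrite vu mul1r; nra.
Qed.

Context (h : circle R -> circle R) (hd : diff_plus h) (d : cfun R) (hsd : Hs true d).

Let dk (k : nat) : R[i] := fourier d k.+1%:Z.
Let M (j k : nat) : R[i] := fourier (Vop h (chi k.+1%:Z)) (- j.+1%:Z).
Let W (N j : nat) : R[i] := \sum_(k < N) dk k * M j k.
Let b (j : nat) : R[i] := fourier (Vop h d) (- j.+1%:Z).
Let S (N : nat) : R := \sum_(k < N) k.+1%:R * normc (dk k) ^+ 2.

Let S_le N : S N <= hnorm d ^+ 2.
Proof.
apply: le_trans (series_energy_le N (H12_energy hsd.1)).
rewrite /S /series/= big_mkord; apply: ler_sum => k _.
by rewrite /energy ler_wpM2l// lerDl sqr_ge0.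
Qed.

Let S_nd N N' : (N <= N')%N -> S N <= S N'.
Proof.
move=> NN; rewrite /S -!(big_mkord xpredT (fun k => k.+1%:R * normc (dk k) ^+ 2)).
rewrite [X in _ <= X](big_cat_nat _ NN)//= lerDl; apply: sumr_ge0 => k _.
by rewrite mulr_ge0 ?sqr_ge0.
Qed.

(** The entries of the off-diagonal block are bounded by [C / (j + k) ^+ 2]
    ([kernel_decay]); the Cauchy-Schwarz inequality with weights [k], which turn
    the coefficients of [d] into its norm, leaves three powers of [j]. *)
Lemma offdiagonal_decay : exists2 K, 0 <= K &
  forall N j, j.+1%:R ^+ 3 * normc (W N j) ^+ 2 <= K.
Proof.
have [f [sf lf f0 fD]] := diff_plus_lift hd.
have [C C0 hC] := kernel_decay sf f0 fD.
have ME j k : normc (M j k) <= C / (k.+1 + j.+1)%:R ^+ 2.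
  rewrite /M fourier_fc; apply: le_trans (hC k.+1 j.+1 isT isT).
  rewrite le_eqVlt; apply/orP; left; apply/eqP; congr normc; apply: eq_fc => x _.
  by rewrite (Vop_chi_lift _ _ lf).
exists (hnorm d ^+ 2 * (2 * C ^+ 2)) => [|N j].
  by rewrite mulr_ge0 ?sqr_ge0// mulr_ge0// sqr_ge0.
have j0 : 0 < j.+1%:R ^+ 3 :> R by rewrite exprn_gt0// ltr0n.
have W1 : normc (W N j) <= \sum_(k < N) normc (dk k) * normc (M j k).
  rewrite (le_trans (normc_sum _ _ _))//; apply: ler_sum => k _.
  by rewrite ComplexField.Normc.normcM.
have W2 : normc (W N j) ^+ 2 <= hnorm d ^+ 2 *
    \sum_(k < N) (k.+1%:R)^-1 * normc (M j k) ^+ 2.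
  apply: (@le_trans _ _ ((\sum_(k < N) normc (dk k) * normc (M j k)) ^+ 2)).
    rewrite ler_pXn2r// ?nnegrE ?normc_ge0//.
    by apply: sumr_ge0 => k _; rewrite mulr_ge0 ?normc_ge0.
  have := @cauchy_schwarz_weighted (fun k => normc (dk k)) (fun k => normc (M j k))
    (fun k => k.+1%:R) N (fun k => normc_ge0 _) (fun k => normc_ge0 _) (fun k => ltr0Sn _ _).
  move/le_trans; apply; apply: ler_wpM2r; last exact: S_le.
  by apply: sumr_ge0 => k _; rewrite mulr_ge0 ?invr_ge0 ?sqr_ge0.
rewrite (le_trans (ler_wpM2l (ltW j0) W2))// mulrCA ler_wpM2l ?sqr_ge0// mulr_sumr.
apply: (@le_trans _ _ (\sum_(k < N) C ^+ 2 * (k.+1%:R ^+ 2)^-1)); last first.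
  rewrite -mulr_sumr [2 * _]mulrC ler_wpM2l ?sqr_ge0//.
  have := @sum_inv_sqr_tail R 0 N (leq0n N); rewrite divr1 big_mkord//.
apply: ler_sum => k _.
have k0 : 0 < k.+1%:R :> R by rewrite ltr0n.
have jj0 : 0 < j.+1%:R :> R by rewrite ltr0n.
have m0 := normc_ge0 (M j k).
have := ME j k; rewrite natrD; move: (normc (M j k)) m0 => m m0.
move: (k.+1%:R) k0 (j.+1%:R) jj0 j0 => x x0 y y0 y30 hm.
have s0 : 0 < x + y by rewrite addr_gt0.
have m2 : m ^+ 2 <= (C / (x + y) ^+ 2) ^+ 2.
  by rewrite ler_pXn2r// nnegrE// divr_ge0 ?(ltW C0)// exprn_ge0// ltW.
have x1V : 0 <= x^-1 by rewrite invr_ge0 ltW.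
apply: (@le_trans _ _ (y ^+ 3 * (x^-1 * (C / (x + y) ^+ 2) ^+ 2))).
  by rewrite ler_wpM2l ?(ltW y30)// ler_wpM2l.
have -> : y ^+ 3 * (x^-1 * (C / (x + y) ^+ 2) ^+ 2) =
    C ^+ 2 * (x ^+ 2)^-1 * (x * y ^+ 3 / (x + y) ^+ 4).
  by field; rewrite !gt_eqF.
rewrite ler_piMr//; first by rewrite mulr_ge0 ?sqr_ge0// invr_ge0 sqr_ge0.
rewrite ler_pdivrMr ?exprn_gt0// mul1r.
have -> : (x + y) ^+ 4 = x * y ^+ 3 + (x ^+ 4 + 4 * x ^+ 3 * y + 6 * x ^+ 2 * y ^+ 2
  + 3 * x * y ^+ 3 + y ^+ 4) by ring.
by rewrite lerDl !addr_ge0// ?mulr_ge0 ?exprn_ge0// ltW.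
Qed.

Context (vanish : forall k : nat, fourier (Vop h d) k.+1%:Z = 0).

(** Composition preserves the form [sum n u_n (v_n)^*%C], which is positive on the
    positive half and negative on the negative one. Applied to [d] and to its
    truncation at [N] this gives [S N] on one side, and on the other side minus a
    sum over negative frequencies, as [d \o h] has no positive ones. *)
Lemma symplectic_identity N : exists C, forall L,
  normc ((S N)%:C + \sum_(j < L) j.+1%:R * (b j * (W N j)^*%C)) <= C / L.+1%:R.
Proof.
have [f [sf lf f0 fD]] := diff_plus_lift hd.
pose P x := psum true dk N (expi x).
have sP : csmooth P := csmooth_psum true dk N.
have pP : per2pi P by move=> x; rewrite /P expiD2pi.
pose w x := P (f x).
have sw : csmooth w := csmooth_comp sP sf.
have pw : per2pi w by move=> x; rewrite /w /P fD expiD2pi.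
have sg : csmooth (fun x => (cD w x)^*%C) := csmooth_conj (csmooth_cD sw).
have pg : per2pi (fun x => (cD w x)^*%C) by move=> x; rewrite (per2pi_cD sw pw).
have hu := hsd.1; have id := H12_lift_integrable hu.
have iV := Vop_lift_integrable hd hu.
have [C hC] := fourier_pairing iV sg pg.
exists C => L; have := hC L; congr (_ <= _).
have fw n : fourier (Vop h (psum true dk N)) n = \sum_(k < N) dk k * fourier (Vop h (chi k.+1%:Z)) n.
  rewrite fourier_fc.
  rewrite (@eq_fc _ _ (fun x => \sum_(k < N) dk k * eI (k.+1%:Z%:~R * f x))); last first.
    by move=> x _; rewrite /Vop/= /psum lf; apply: eq_bigr => k _; rewrite chi_expi.
  have sk (k : 'I_N) : csmooth (fun x => eI (k.+1%:Z%:~R * f x)).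
    by apply: csmooth_eI; exact: smoothM (@smooth_cst R _) sf.
  have ik (k : 'I_N) := csmooth_integrable (sk k).
  rewrite (fc_sum _ _ (fun k : 'I_N => cintegrableZ (dk k) (ik k))).
  apply: eq_bigr => k _; rewrite (fcZ _ _ (ik k)).
  congr (_ * _); rewrite fourier_fc; apply: eq_fc => x _.
  by rewrite (Vop_chi_lift _ _ lf).
have fcw n : fc w n = fourier (Vop h (psum true dk N)) n.
  by rewrite fourier_fc; apply: eq_fc => x _; rewrite /w /P /Vop/= lf.
have fcg (n : int) : fc (fun x => (cD w x)^*%C) n = 'i * n%:~R * (fc w (- n))^*%C.
  have sN : csmooth (fun x => cD w x * eI (n%:~R * x)).
    exact: csmoothM (csmooth_cD sw) (csmooth_eIn _).
  have -> : fc (fun x => (cD w x)^*%C) n = (fc (cD w) (- n))^*%C.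
    rewrite /fc conjcM conjcR; congr (_ * _).
    rewrite -circle_int_conj; last first.
      exact: cintegrableMs (csmooth_integrable (csmooth_cD sw)) (csmooth_eInN _).
    apply: eq_circle_int => x _; rewrite conjcM; congr (_ * _).
    by rewrite eIJ opprK mulrNz mulNr.
  rewrite fc_cD// !conjcM mulrNz rmorphN rmorph_int; congr (_ * _).
  by rewrite conjci mulrNN.
pose F x := d (expi x) * (cD P x)^*%C.
have scP : csmooth (fun x => (cD P x)^*%C) := csmooth_conj (csmooth_cD sP).
have iF : cintegrable F := cintegrableMs id scP.
have [m1 m2] := borel_liftM (H12_measurable hu).1 (H12_measurable hu).2 scP.
have pF : per2pi F by move=> x; rewrite /F expiD2pi (per2pi_cD sP pP).
have left : fc (fun x => Vop h d (expi x) * (cD w x)^*%C) 0 = - 'i * (S N)%:C.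
  transitivity (fc F 0).
    have e := fc0_substitution sf f0 fD m1 m2 pF iF.
    apply: (etrans _ e).
    apply: eq_fc => x _.
    have ew : cD w x = (f^`() x)%:C * cD P (f x).
      by have e1 := cD_comp sP sf; exact: (congr1 (fun F => F x) e1).
    have eV : Vop h d (expi x) = d (expi (f x)) by rewrite /Vop/= lf.
    have gen (A B V : R[i]) : A = (f^`() x)%:C * B -> V = d (expi (f x)) ->
        V * A^*%C = (f^`() x)%:C * (d (expi (f x)) * B^*%C).
      by move=> -> ->; rewrite conjcM conjcR mulrCA.
    exact: (gen _ _ _ ew eV).
  have cP x : (cD P x)^*%C = \sum_(k < N) (- 'i * k.+1%:R * (dk k)^*%C) * eI ((- k.+1%:Z)%:~R * x).
    have PE : P = fun x => \sum_(k < N) dk k * eI (k.+1%:Z%:~R * x).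
      by apply/funext => y; rewrite /P /psum; apply: eq_bigr => k _; rewrite chi_expi.
    have sk (k : 'I_N) : csmooth (fun x => dk k * eI (k.+1%:Z%:~R * x)).
      exact: csmoothM (csmooth_cst _) (csmooth_eIn _).
    have e (k : 'I_N) : cD (fun x => dk k * eI (k.+1%:Z%:~R * x)) x =
        dk k * ('i * k.+1%:R * eI (k.+1%:Z%:~R * x)).
      rewrite (cDZ _ (csmooth_eIn _)) (cD_eI (@smooth_mul _ _)) derive1_mul.
      by rewrite (rmorph_int (real_complex R)).
    rewrite PE (cD_sum _ sk) rmorph_sum; apply: eq_bigr => k _.
    apply: (etrans (congr1 (@conjc R) (e k))).
    have -> : (- k.+1%:Z)%:~R * x = - (k.+1%:Z%:~R * x) by rewrite mulrNz mulNr.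
    rewrite !conjcM eIJ conjci.
    have -> : (k.+1%:R : R[i])^*%C = k.+1%:R.
      by rewrite -[k.+1%:R](rmorph_nat (real_complex R)) conjcR.
    by move: ((dk k)^*%C) (eI _) => A B; ring.
  rewrite (@eq_fc _ _ (fun x => \sum_(k < N) (- 'i * k.+1%:R * (dk k)^*%C) *
      (d (expi x) * eI ((- k.+1%:Z)%:~R * x)))); last first.
    by move=> x _; rewrite /F cP mulr_sumr; apply: eq_bigr => k _; rewrite mulrCA.
  have ik (k : 'I_N) := cintegrableMs id (csmooth_eIn ((- k.+1%:Z)%:~R)).
  rewrite (fc_sum _ _ (fun k : 'I_N => cintegrableZ _ (ik k))).
  have SE : (S N)%:C = \sum_(k < N) k.+1%:R * (dk k * (dk k)^*%C).
    rewrite /S (rmorph_sum (real_complex R)); apply: eq_bigr => k _.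
    by rewrite mulcJ (rmorphM (real_complex R)) (rmorph_nat (real_complex R)).
  rewrite SE mulr_sumr; apply: eq_bigr => k _.
  rewrite (fcZ _ _ (ik k)) fc_shift sub0r opprK -fourier_fc -/(dk k).
  by move: (dk k) ((dk k)^*%C) => A B; ring.
rewrite left.
have -> : symsum (fun n => fc (fun x => (cD w x)^*%C) n * fc (fun x => Vop h d (expi x)) (- n)) L =
    'i * \sum_(j < L) j.+1%:R * (b j * (W N j)^*%C).
  rewrite /symsum big_mkord fcg mulr0 mul0r mul0r add0r mulr_sumr; apply: eq_bigr => j _.
  rewrite !fcg -!fourier_fc opprK vanish mulr0 addr0 fcw fw -/(W N j) -/(b j).
  by rewrite -[j.+1%:Z%:~R]/(j.+1%:R); ring.
have -> : - 'i * (S N)%:C - 'i * \sum_(j < L) j.+1%:R * (b j * (W N j)^*%C) =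
  - ('i * ((S N)%:C + \sum_(j < L) j.+1%:R * (b j * (W N j)^*%C))) by ring.
by rewrite normcN ComplexField.Normc.normcM normc_i mul1r.
Qed.

(** As [N] grows, [W N j] tends to [b j], so that the symplectic identity
    identifies the limit of the nonnegative [S N] with minus a sum of squares. The
    passage to the limit under the sum is dominated by [offdiagonal_decay]. *)
Lemma composition_injective k : fourier d k.+1%:Z = 0.
Proof.
have [K K0 hK] := offdiagonal_decay.
have bW j : exists C, forall N, normc (b j - W N j) <= C / N.+1%:R.
  exact: compose_fourier.
pose r (j : nat) := Num.sqrt (K / j.+1%:R ^+ 3).
have r0 j : 0 <= r j by exact: sqrtr_ge0.
have j3 j : 0 < j.+1%:R ^+ 3 :> R by rewrite exprn_gt0// ltr0n.
have r2 j : r j ^+ 2 = K / j.+1%:R ^+ 3 by rewrite sqr_sqrtr// divr_ge0// ltW.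
have Wr N j : normc (W N j) <= r j.
  rewrite -(ler_pXn2r (n := 2))// ?nnegrE ?normc_ge0// r2 ler_pdivlMr//.
  by rewrite mulrC; exact: hK.
have br j : normc (b j) <= r j.
  have [C hC] := bW j; apply: (@le_add_invn _ _ C) => N.
  have -> : b j = W N j + (b j - W N j) by ring.
  by rewrite (le_trans (le_normcD _ _))// lerD.
pose T N j := j.+1%:R * (b j * (W N j)^*%C).
have TK N j : normc (T N j) <= K * (j.+1%:R ^+ 2)^-1.
  rewrite /T ComplexField.Normc.normcM normc_nat ComplexField.Normc.normcM normcJ.
  apply: (@le_trans _ _ (j.+1%:R * (r j * r j))).
    by rewrite ler_wpM2l// ler_pM// normc_ge0.
  rewrite -expr2 r2 le_eqVlt; apply/orP; left; apply/eqP.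
  have : j.+1%:R != 0 :> R by rewrite pnatr_eq0.
  by move: (j.+1%:R) => z z0; field.
have ReT N j : - complex.Re (T N j) <= j.+1%:R * (r j * normc (b j - W N j)).
  have -> : T N j = (j.+1%:R * normc (b j) ^+ 2)%:C - j.+1%:R * (b j * (b j - W N j)^*%C).
    have e : (j.+1%:R * normc (b j) ^+ 2)%:C = j.+1%:R * (b j * (b j)^*%C).
      by rewrite mulcJ (rmorphM (real_complex R)) (rmorph_nat (real_complex R)).
    rewrite e conjcB /T.
    by move: (b j) ((b j)^*%C) ((W N j)^*%C) => p q s; ring.
  rewrite cReB opprB /= lerBlDr.
  apply: (@le_trans _ _ (normc (j.+1%:R * (b j * (b j - W N j)^*%C)))).
    exact: le_trans (ler_norm _) (normc_Re _).
  rewrite ComplexField.Normc.normcM normc_nat ComplexField.Normc.normcM normcJ.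
  apply: (@le_trans _ _ (j.+1%:R * (r j * normc (b j - W N j)))).
    by rewrite ler_wpM2l// ler_wpM2r// normc_ge0.
  by rewrite lerDl mulr_ge0// sqr_ge0.
(* The terms below [L] are compared with their limits, which are nonnegative; those
   beyond [L] are estimated by their absolute values. *)
have step N L : S N <= \sum_(j < L) j.+1%:R * (r j * normc (b j - W N j)) + 2 * K / L.+1%:R.
  have [C hC] := symplectic_identity N.
  apply: (@le_add_invn _ _ `|C|) => L'.
  pose L2 := maxn L L'.
  have := hC L2; rewrite -(big_mkord xpredT (fun j => T N j)) (big_cat_nat _ (leq_maxl L L'))//=.
  set X := \sum_(0 <= j < L) _; set Y := \sum_(L <= j < L2) _ => hh.
  have hY : normc Y <= 2 * K / L.+1%:R.
    rewrite (le_trans (normc_sum _ _ _))//.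
    apply: (@le_trans _ _ (\sum_(L <= j < L2) K * (j.+1%:R ^+ 2)^-1)).
      by apply: ler_sum => j _; exact: TK.
    rewrite -mulr_sumr [2 * K]mulrC -mulrA ler_wpM2l//.
    exact: sum_inv_sqr_tail (leq_maxl _ _).
  have hX : - complex.Re X <= \sum_(j < L) j.+1%:R * (r j * normc (b j - W N j)).
    rewrite /X big_mkord (big_morph _ cReD (erefl : complex.Re (0 : R[i]) = 0)) -sumrN.
    by apply: ler_sum => j _; exact: ReT.
  have hS : complex.Re ((S N)%:C + (X + Y)) <= `|C| / L'.+1%:R.
    apply: (le_trans (ler_norm _)); apply: (le_trans (normc_Re _)); apply: (le_trans hh).
    apply: (@le_trans _ _ (`|C| / L2.+1%:R)).
      by rewrite ler_wpM2r ?invr_ge0// ler_norm.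
    by rewrite ler_wpM2l// lef_pV2 ?posrE// ler_nat ltnS leq_maxr.
  move: hS; rewrite !cReD/=.
  have := le_trans (ler_norm _) (le_trans (normc_Re (- Y)) _).
  move=> /(_ (2 * K / L.+1%:R)); rewrite normcN => /(_ hY).
  have -> : complex.Re (- Y) = - complex.Re Y by case: (Y).
  move: hX; move: (2 * K / L.+1%:R) (`|C| / L'.+1%:R) (\sum_(j < L) _) => p q s h1 h2 h3.
  lra.
have S0 N : S N <= 0.
  apply: (@le_add_invn _ _ (2 * K)) => L; rewrite add0r.
  have [E hE] : exists E, forall N',
      \sum_(j < L) j.+1%:R * (r j * normc (b j - W N' j)) <= E / N'.+1%:R.
    elim: (L) => [|l [E hE]]; first by exists 0 => N'; rewrite big_ord0 mul0r.
    have [C hC] := bW l; exists (E + l.+1%:R * (r l * C)) => N'.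
    rewrite big_ord_recr/= mulrDl lerD// -!mulrA ler_wpM2l// ler_wpM2l//.
  apply: (@le_add_invn _ _ `|E|) => N'.
  rewrite (le_trans (S_nd (leq_maxl N N')))// (le_trans (step _ L))// addrC lerD2l.
  rewrite (le_trans (hE _))//; apply: (@le_trans _ _ (`|E| / (maxn N N').+1%:R)).
    by rewrite ler_wpM2r ?invr_ge0// ler_norm.
  by rewrite ler_wpM2l// lef_pV2 ?posrE// ler_nat ltnS leq_maxr.
have := S0 k.+1; rewrite /S big_ord_recr/= => h1.
apply: ComplexField.Normc.eq0_normc; apply/eqP; rewrite -sqrf_eq0.
have k0 : 0 < k.+1%:R :> R by rewrite ltr0n.
have hk : k.+1%:R * normc (dk k) ^+ 2 <= 0.
  apply: le_trans h1; rewrite lerDr; apply: sumr_ge0 => i _.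
  by rewrite mulr_ge0// sqr_ge0.
by rewrite eq_le sqr_ge0 andbT -(pmulr_rle0 _ k0).
Qed.

End Injectivity.

(** * Bounded operators and the period map *)

Section Blocks.
Context {R : realType}.
Implicit Types (u v w : cfun R) (T : cfun R -> cfun R).

(** On a vector of the form [A_h v] the operator [Z_h] can be evaluated without
    solving any equation: [A_h] being injective, the chosen preimage of [A_h v]
    agrees with [v] modulo constants, so that [Z_h (A_h v) = B_h v]. *)
Lemma Zop_Aop (h : circle R -> circle R) v k0 : diff_plus h -> Hs true v ->
  csmooth (fun x => v (expi x)) -> fourier (Vop h v) (freq true k0) != 0 ->
  forall j, fourier (Zop h (Aop h v)) (freq false j) = fourier (Vop h v) (freq false j).
Proof.
move=> hd hv sv nz; have [f [sf lf f0 fD]] := diff_plus_lift hd.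
have sV : csmooth (fun x => Vop h v (expi x)).
  apply: (csmooth_ext _ (csmooth_comp sv sf)) => x.
  by rewrite /Vop/= lf.
have pV : per2pi (fun x => Vop h v (expi x)) by move=> x; rewrite expiD2pi.
have iv := Vop_lift_integrable hd hv.1.
have [w1 hw1 ew1] := smooth_half true sV pV.
have [w2 hw2 ew2] := smooth_half false sV pV.
have fV n : fc (fun x => Vop h v (expi x)) n = fourier (Vop h v) n by rewrite fourier_fc.
have eA : forall k, fourier (Aop h v) (freq true k) = fourier (Vop h v) (freq true k).
  by apply: (proj_fourier iv hw1) => k; rewrite ew1 fV.
have hA : Hs true (Aop h v) := proj_Hs true (Vop h v).
pose a := Ainv h (Aop h v).
have [ha ca] : Hs true a /\ class_eq (Aop h a) (Aop h v).
  apply: (xgetI (P := [set v' | Hs true v' /\ class_eq (Aop h v') (Aop h v)]) (@czero R) (x := v)).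
  split=> //; exists 0; exists set0; split; [exact: measurable0|exact: measure0|].
  by move=> x /= hx; apply: hx; rewrite addr0.
have ia := Vop_lift_integrable hd ha.1.
have hAa : Hs true (Aop h a) := proj_Hs true (Vop h a).
have ce n : n != 0 -> fourier (Aop h a) n = fourier (Aop h v) n.
  apply: (class_eq_fourier _ _ ca); [exact: H12_lift_integrable hAa.1|].
  exact: H12_lift_integrable hA.1.
(* The alternative is that the projection defining [Aop h a] takes its default value. *)
have eAa : forall k, fourier (Aop h a) (freq true k) = fourier (Vop h a) (freq true k).
  have [//|z] := proj_fourier_or true ia.
  have az : Aop h a = @czero R := z.
  have e0 := ce (freq true k0) (freq_neq0 _ _).
  have e1 : fourier (Aop h a) (freq true k0) = 0 by rewrite az fourier0.
  have e2 := etrans (esym (eA k0)) (etrans (esym e0) e1).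
  by exfalso; move/eqP: nz; apply; exact: e2.
have hd' : Hs true (csub a v) := HsB ha hv.
have Vsub : Vop h (csub a v) = csub (Vop h a) (Vop h v) by [].
have van k : fourier (Vop h (csub a v)) k.+1%:Z = 0.
  rewrite Vsub (fourierB _ ia iv); apply/eqP; rewrite subr_eq0; apply/eqP.
  exact: etrans (esym (eAa k)) (etrans (ce _ (freq_neq0 true k)) (eA k)).
have dz k : fourier (csub a v) k.+1%:Z = 0 := composition_injective hd hd' van k.
have eB n : n != 0 -> fourier (Vop h a) n = fourier (Vop h v) n.
  move=> n0; apply/eqP; rewrite -subr_eq0 -(fourierB _ ia iv) -Vsub; apply/eqP.
  have [C hC] := compose_fourier hd hd' n0.
  apply: normc_eq0 => e e0; apply: (@le_trans _ _ 0); last exact: ltW.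
  apply: (@le_add_invn _ _ _ C) => N; rewrite add0r.
  by have := hC N; rewrite big1 ?subr0// => k _; rewrite dz mul0r.
move=> j; rewrite -(eB _ (freq_neq0 false j)).
apply: (proj_fourier ia hw2) => k; rewrite ew2 fV eB//; exact: freq_neq0.
Qed.

Lemma Zop_Hs h w : Hs false (Zop h w).
Proof. exact: (proj_Hs false). Qed.

Lemma Zop_id w j : fourier (Zop (@idfun (circle R)) w) (freq false j) = 0.
Proof.
have ha : Hs true (Ainv idfun w).
  by rewrite /Ainv; case: xgetP => [a _ []//|_]; exact: Hs_zero.
rewrite /Zop /Bop (_ : Vop idfun (Ainv idfun w) = Ainv idfun w)//.
rewrite (@proj_fourier _ false _ (@czero R)).
- exact: (Hs_fourier_opp j ha).
- exact: H12_lift_integrable ha.1.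
- exact: Hs_zero.
- by move=> k; rewrite fourier0 (Hs_fourier_opp k ha).
Qed.

Lemma hnormZ_le (a : R) u (K : R) : H12 u -> 0 <= K -> 0 < a -> hnorm u <= a * K ->
  hnorm (hscale (a^-1)%:C u) <= K.
Proof.
move=> hu K0 a0 h; have iu := H12_lift_integrable hu.
apply: hnorm_le => // N; rewrite /series/=.
under eq_bigr do rewrite (energyZ _ _ iu) normcR ger0_norm ?invr_ge0 ?(ltW a0)//.
rewrite -mulr_sumr exprVn mulrC ler_pdivrMr ?exprn_gt0// mulrC -exprMn.
apply: le_trans (series_energy_le N (H12_energy hu)) _.
by rewrite ler_pXn2r// nnegrE ?hnorm_ge0// mulr_ge0// ltW.
Qed.

Lemma hnorm_zero : hnorm (@czero R) <= 0.
Proof.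
apply: hnorm_le => // N; rewrite /series/= big1 ?expr0n// => k _.
by rewrite /energy !fourier0 ComplexField.Normc.normc0 expr0n addr0 mulr0.
Qed.

Lemma hnorm_le_opnorm T u (e : R) : Hs true u -> hnorm u <= 1 ->
  (opnorm T <= e%:E)%E -> hnorm (T u) <= e.
Proof.
move=> hu u1 hT; rewrite -lee_fin; apply: le_trans hT.
by apply: ereal_sup_ubound; exists u.
Qed.

Section BoundedOperator.
Context (T : cfun R -> cfun R) (bT : bounded_operator T).

Lemma bounded_Hs u : Hs true u -> Hs false (T u).
Proof. by case: bT => h _ _ _; exact: h. Qed.

Lemma bounded_linear (a : R[i]) u v n : Hs true u -> Hs true v -> n != 0 ->
  fourier (T (cadd (hscale a u) v)) n = a * fourier (T u) n + fourier (T v) n.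
Proof.
case: bT => [hT _ lin _] hu hv n0.
have iu := H12_lift_integrable (bounded_Hs hu).1.
have iv := H12_lift_integrable (bounded_Hs hv).1.
have iau : lift_integrable (hscale a (T u)) := cintegrableZ a iu.
rewrite (class_eq_fourier _ _ (lin a u v hu hv) n0).
- by rewrite fourierD// fourierZ.
- exact: H12_lift_integrable (bounded_Hs (HsD (HsZ a hu) hv)).1.
- exact: cintegrableD iau iv.
Qed.

Lemma bounded_zero n : n != 0 -> fourier (T (@czero R)) n = 0.
Proof.
move=> n0; have := bounded_linear 1 (Hs_zero true) (Hs_zero true) n0.
rewrite (_ : cadd (hscale 1 (@czero R)) (@czero R) = @czero R); last first.
  by apply/funext => z; rewrite /cadd /hscale /czero mulr0 addr0.
by rewrite mul1r => /eqP; rewrite -subr_eq0 opprD addrA subrr sub0r oppr_eq0 => /eqP.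
Qed.

Lemma bounded_scale (a : R[i]) u n : Hs true u -> n != 0 ->
  fourier (T (hscale a u)) n = a * fourier (T u) n.
Proof.
move=> hu n0; have := bounded_linear a hu (Hs_zero true) n0.
rewrite bounded_zero// addr0 => <-; congr (fourier (T _) n).
by apply/funext => z; rewrite /cadd /hscale /czero addr0.
Qed.

(** Homogeneity extends the bound from the unit ball; single coefficients are
    all that is needed later. *)
Lemma bounded_fourier : exists2 K, 0 <= K & forall u (e : R) n, Hs true u ->
  0 < e -> hnorm u <= e -> n != 0 -> normc (fourier (T u) n) <= e * K.
Proof.
have [_ _ _ fT] := bT.
have [K KE] : exists K, opnorm T = K%:E.
  have : ((hnorm (T (@czero R)))%:E <= opnorm T)%E.
    apply: ereal_sup_ubound; exists (@czero R); last exact: erefl.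
    by split; [exact: (Hs_zero true)|exact: le_trans hnorm_zero ler01].
  by move: fT; case: (opnorm T) => [K| |]// _ _; exists K.
exists `|K| => // u e n hu e0 ue n0.
pose u' := hscale (e^-1)%:C u; have hu' : Hs true u' := HsZ _ hu.
have -> : u = hscale e%:C u'.
  apply/funext => z; rewrite /u' /hscale mulrA -(rmorphM (real_complex R)).
  by rewrite mulfV ?rmorph1 ?mul1r// gt_eqF.
rewrite bounded_scale// ComplexField.Normc.normcM normcR gtr0_norm// ler_wpM2l ?(ltW e0)//.
apply: (le_trans (normc_fourier_le (bounded_Hs hu').1 n0)).
apply: (@le_trans _ _ K); last exact: ler_norm.
apply: hnorm_le_opnorm => //; last by rewrite KE.
by apply: hnormZ_le => //; [exact: hu.1|rewrite mulr1].
Qed.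

End BoundedOperator.

(** An element of the positive half whose coefficients are those of a smooth
    function is controlled by the derivative of that function: Bessel's
    inequality and [n <= n ^ 2]. *)
Lemma hnorm_half_le w (g : R -> R[i]) (B : R) : Hs true w -> csmooth g -> per2pi g ->
  0 <= B -> (forall x, normc (cD g x) <= B) ->
  (forall k, fourier w (freq true k) = fc g (freq true k)) -> hnorm w <= B.
Proof.
move=> hw sg pg B0 hB hg; apply: hnorm_le => // N.
have cb : cbounded (cD g).
  split; first exact: csmooth_measurable (csmooth_cD sg).
  by exists B => x _; exact: hB.
have us : uniq [seq freq true k | k <- index_iota 0 N].
  by rewrite map_inj_uniq ?iota_uniq//; exact: freq_inj.
have n2 : norm2 (cD g) <= 2 * pi * B ^+ 2.
  rewrite -rint_cst; apply: le_rint; [exact: cbounded_norm2|exact: rintegrable_cst|].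
  by move=> x _; rewrite ler_pXn2r// ?nnegrE ?normc_ge0.
have bs : \sum_(n <- [seq freq true k | k <- index_iota 0 N]) normc (fc (cD g) n) ^+ 2 <= B ^+ 2.
  apply: (le_trans (bessel cb us)); rewrite mulrC ler_pdivrMr ?pi2_gt0// mulrC.
  exact: n2.
rewrite big_map in bs; apply: le_trans bs; rewrite /series/=; apply: ler_sum => k _.
rewrite (energy_freq true) (Hs_fourier_opp k hw) ComplexField.Normc.normc0 expr0n addr0 hg.
rewrite fc_cD// (ComplexField.Normc.normcM ('i * _) (fc g _)).
rewrite (ComplexField.Normc.normcM 'i) normc_i mul1r -(rmorph_int (real_complex R)) normcR.
rewrite exprMn ler_wpM2r ?sqr_ge0// /freq -[k.+1%:Z%:~R]/(k.+1%:R : R) ger0_norm//.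
by rewrite expr2 ler_peMr// ler1n.
Qed.

End Blocks.

(** * First-order expansion of the modes along a path *)

Section Modes.
Context {R : realType}.

Lemma between_norm_le (x y : R) : Num.min 0 y <= x <= Num.max 0 y -> `|x| <= `|y|.
Proof.
have [y0|y0] := leP 0 y => /andP[h1 h2].
  by rewrite !ger0_norm.
by rewrite !ler0_norm ?lerN2// ltW.
Qed.

Lemma eI_lip (y : R) : normc (eI y - 1) <= 2 * `|y|.
Proof.
have h1 := mean_value_le (C := 1) (a := 0) (b := y) (@is_derive_cos R)
  (fun x _ => etrans (congr1 (fun z => z <= 1) (normrN (sin x))) (sin_max x)).
have h2 := mean_value_le (C := 1) (a := 0) (b := y) (@is_derive_sin R) (fun x _ => cos_max x).
rewrite subr0 cos0 in h1; rewrite subr0 sin0 subr0 in h2.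
apply: (le_trans (normc_le_ReIm _)); rewrite cReB cImB/= /eI/= subr0.
lra.
Qed.

Lemma eI_lin (y : R) : normc (eI y - 1 - 'i * y%:C) <= 2 * y ^+ 2.
Proof.
have c1 (x : R) : `|cos x - 1| <= `|x|.
  have := mean_value_le (C := 1) (a := 0) (b := x) (@is_derive_cos R)
    (fun x _ => etrans (congr1 (fun z => z <= 1) (normrN (sin x))) (sin_max x)).
  by rewrite subr0 cos0 mul1r.
have s1 (x : R) : `|sin x| <= `|x|.
  have := mean_value_le (C := 1) (a := 0) (b := x) (@is_derive_sin R) (fun x _ => cos_max x).
  by rewrite !subr0 sin0 mul1r subr0.
have c2 := mean_value_le (C := `|y|) (a := 0) (b := y) (@is_derive_cos R)
  (fun x hx => etrans (congr1 (fun z => z <= _) (normrN (sin x)))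
    (le_trans (s1 x) (between_norm_le hx))).
have s2 := mean_value_le (C := `|y|) (a := 0) (b := y)
  (fun x => is_derive1B (is_derive_sin x) (is_derive1_id x))
  (fun x hx => le_trans (c1 x) (between_norm_le hx)).
rewrite subr0 cos0 -expr2 real_normK ?num_real// in c2.
rewrite subr0 sin0 subr0 subr0 -expr2 real_normK ?num_real// in s2.
apply: (le_trans (normc_le_ReIm _)).
rewrite !(cReB, cImB) cReM cImM /eI/= !(mul0r, mul1r, mulr0, oppr0, subr0, add0r, addr0).
lra.
Qed.

Context (m : int) (r : R) (rE : r = m%:~R) (r0 : 0 <= r).
Context (p a : R -> R) (t d0 d1 eta : R).
Context (sp : smooth p) (sa : smooth a).
Notation mode := (fun x => eI (r * p x)).
Context (pp : per2pi mode).
Context (h0 : forall x, `|p x - x| <= d0) (h1 : forall x, `|p^`() x - 1| <= d1).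

Let smode : csmooth mode.
Proof. exact: csmooth_eI (smoothM (@smooth_cst R r) sp). Qed.

Let sbase : csmooth (fun x => eI (r * x)).
Proof. exact: csmooth_eIn. Qed.

Let mode_split x : eI (r * p x) = eI (r * (p x - x)) * eI (r * x).
Proof. by rewrite -eID; congr (eI _); ring. Qed.

Let rh0 x : `|r * (p x - x)| <= r * d0.
Proof. by rewrite (normrM r) (ger0_norm r0); exact: (ler_wpM2l r0 (h0 x)). Qed.

Let fc_base n : fc (fun x => eI (r * x)) n = (m == n)%:R.
Proof. by rewrite rE; exact: fc_eI. Qed.

(** The expansion [eI (r p) = eI (r x) (1 + 'i r (p - x) + O((p - x) ^+ 2))] with
    [p - x] replaced by [t a]; the factor [eI (r x)] shifts frequencies by [m]. *)
Lemma fc_mode_expansion n : (forall x, `|p x - x - t * a x| <= eta) -> n != m ->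
  normc (fc mode n - t%:C * ('i * r%:C * fc (fun x => (a x)%:C) (n - m))) <=
  2 * (2 * (r * d0) ^+ 2 + r * eta).
Proof.
move=> h2 nm; pose c : R[i] := t%:C * ('i * r%:C).
have sA := csmooth_real sa.
have sAe : csmooth (fun x => (a x)%:C * eI (r * x)) := csmoothM sA sbase.
have e1 : t%:C * ('i * r%:C * fc (fun x => (a x)%:C) (n - m)) =
    fc (fun x => c * ((a x)%:C * eI (r * x))) n.
  rewrite (fcZ c n (csmooth_integrable sAe)) -(fc_shift (fun x => (a x)%:C) m n).
  by rewrite mulrA -rE.
have e2 : fc mode n = fc (fun x => eI (r * p x) - eI (r * x)) n.
  rewrite (fcB n (csmooth_integrable smode) (csmooth_integrable sbase)) fc_base.
  by rewrite eq_sym (negPf nm) subr0.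
have s1 := csmoothB smode sbase.
have s2 := csmoothM (csmooth_cst c) sAe.
rewrite e1 e2 -(fcB n (csmooth_integrable s1) (csmooth_integrable s2)).
apply: (normc_fc_bounded n (csmooth_integrable (csmoothB s1 s2))) => x _.
set y := r * (p x - x).
have -> : eI (r * p x) - eI (r * x) - c * ((a x)%:C * eI (r * x)) =
  (eI y - 1 - 'i * y%:C + 'i * (y - r * (t * a x))%:C) * eI (r * x).
  by rewrite mode_split -/y /c !(rmorphB, rmorphM (real_complex R)); ring.
rewrite (normc_MeI (r * x)); apply: (le_trans (le_normcD _ _)); apply: lerD.
  apply: (le_trans (eI_lin y)); rewrite ler_pM2l//.
  by rewrite -(real_normK (num_real y)) ler_pXn2r ?nnegrE ?(le_trans _ (rh0 x)).
rewrite (ComplexField.Normc.normcM 'i) normc_i mul1r normcR.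
by rewrite /y -mulrBr normrM ger0_norm// ler_wpM2l.
Qed.

(** Used to see that the coefficient at [m] does not vanish for small [t]. *)
Lemma fc_mode_diag : normc (fc mode m - 1) <= 2 * (2 * (r * d0)).
Proof.
have e : 1 = fc (fun x => eI (r * x)) m by rewrite fc_base eqxx.
rewrite e -(fcB m (csmooth_integrable smode) (csmooth_integrable sbase)).
apply: (normc_fc_bounded m (csmooth_integrable (csmoothB smode sbase))) => x _.
have -> : eI (r * p x) - eI (r * x) = (eI (r * (p x - x)) - 1) * eI (r * x).
  by rewrite mode_split; ring.
rewrite (normc_MeI (r * x)); apply: (le_trans (eI_lip _)).
by rewrite ler_pM2l.
Qed.

Let cD_mode x : cD mode x = 'i * (r * p^`() x)%:C * eI (r * p x).
Proof.
rewrite (cD_eI (smoothM (@smooth_cst R r) sp)).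
rewrite (is_derive1_fun (fun y => is_derive1M (is_derive1_cst r y) (smooth_is_derive y sp))).
by rewrite mul0r add0r.
Qed.

(** This bound and the next one enter [hnorm_half_le]: they keep [A_h v] in a ball
    and make it converge to [v], for [v] a multiple of a mode. *)
Lemma normc_cD_mode x : normc (cD mode x) <= r * (1 + d1).
Proof.
rewrite cD_mode (normc_MeI (r * p x)) (ComplexField.Normc.normcM 'i) normc_i mul1r normcR.
rewrite normrM ger0_norm// ler_wpM2l//.
rewrite -[p^`() x](subrK 1) addrC (le_trans (ler_normD _ _))// normr1 lerD2l; exact: h1.
Qed.

Lemma normc_cD_mode_diff x :
  normc (cD (fun x => eI (r * p x) - eI (r * x)) x) <= r * (d1 + 2 * (r * d0)).
Proof.
rewrite (cDB smode sbase) cD_mode (cD_eI (@smooth_mul R r)) derive1_mul.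
have -> : 'i * (r * p^`() x)%:C * eI (r * p x) - 'i * r%:C * eI (r * x) =
  'i * (r%:C * ((p^`() x - 1)%:C * eI (r * p x) + (eI (r * (p x - x)) - 1) * eI (r * x))).
  by rewrite mode_split !(rmorphB, rmorphM (real_complex R), rmorph1); ring.
rewrite (ComplexField.Normc.normcM 'i) normc_i mul1r (ComplexField.Normc.normcM r%:C) normcR.
rewrite ger0_norm// ler_wpM2l//; apply: (le_trans (le_normcD _ _)); apply: lerD.
  by rewrite (normc_MeI (r * p x)) normcR.
rewrite (normc_MeI (r * x)); apply: (le_trans (eI_lip _)).
by rewrite ler_pM2l.
Qed.

End Modes.

(** * The derivative of the period map along a path *)

Section Path.
Context {R : realType}.
Implicit Types (A : circle R -> R) (h : R -> circle R -> circle R).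

Lemma partials_space (f : R -> R -> R) t n :
  partials (nseq n false) f t = derive1n n (f t).
Proof. by elim: n => //= n ->. Qed.

Lemma jointly_smooth_slice d (f : R -> R -> R) t : jointly_smooth d f -> `|t| < d ->
  smooth (f t).
Proof.
move=> hf td n x; have [_ _] := hf (nseq n false) t x td.
by rewrite partials_space.
Qed.

(** The expansion of the path is used for the functions with arbitrary tolerance,
    and with tolerance 1 where only a Lipschitz bound in [t] is needed. *)
Lemma path_expansion h A : smooth_field A -> path_with_field h A ->
  exists2 C, 0 < C & forall e, 0 < e -> \forall t \near (0 : R),
    diff_plus (h t) /\ exists p, [/\ smooth p, is_lift (h t) p,
      forall x, `|p x - x| <= C * `|t|, forall x, `|p^`() x - 1| <= C * `|t| &
      forall x, `|p x - x - t * A (expi x)| <= e * `|t|].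
Proof.
move=> sA [phi [d [d0 hphi _ js hexp]]]; pose a x := A (expi x).
have sa : smooth a := sA.
have pa : per2pi a by move=> x; rewrite /a expiD2pi.
have [C C0 hC] := per2pi_bounded (smooth_continuous sa) pa.
have [C' C0' hC'] := per2pi_bounded (smooth_continuous (smooth_derive1 sa)) (per2pi_derive1 sa pa).
have slice t : `|t| < d -> smooth (phi t) := jointly_smooth_slice js.
have der t : `|t| < d ->
    derive1n 1 (fun y => phi t y - (y + t * a y)) = fun x => (phi t)^`() x - (1 + t * a^`() x).
  move=> td; apply: is_derive1_fun => x.
  apply: (is_derive_eq (is_derive1B (smooth_is_derive x (slice t td))
    (is_derive1D (is_derive1_id x) (is_derive1M (is_derive1_cst t x) (smooth_is_derive x sa))))).
  by rewrite mul0r add0r.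
have tri (u b s c : R) : `|u - s * b| <= 1 * `|s| -> `|b| <= c -> `|u| <= (c + 1) * `|s|.
  move=> h1 h2; rewrite -[u](subrK (s * b)) mulrDl addrC.
  apply: (le_trans (ler_normD _ _)); apply: lerD; last exact: h1.
  by rewrite normrM mulrC; apply: ler_wpM2r.
exists (C + C' + 1) => [|e e0]; first by rewrite !addr_gt0.
have hd : \forall t \near (0 : R), `|t| < d.
  by have := @nbhs0_lt R R d d0.
near=> t.
have td : `|t| < d by near: t.
split; first by case: (hphi t td).
have st := slice t td; exists (phi t); split; [exact: st|by case: (hphi t td)| | |].
- move=> x; apply: (@le_trans _ _ ((C + 1) * `|t|)); last by rewrite ler_wpM2r// lerD2r lerDl ltW.
  apply: (tri _ (a x)); last exact: hC.
  have H : forall y, `|derive1n 0 (fun y => phi t y - (y + t * a y)) y| <= 1 * `|t|.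
    by near: t; exact: hexp.
  by have := H x; rewrite /= opprD addrA.
- move=> x; apply: (@le_trans _ _ ((C' + 1) * `|t|)); last by rewrite ler_wpM2r// lerD2r lerDr ltW.
  apply: (tri _ (a^`() x)); last exact: hC'.
  have H : forall y, `|derive1n 1 (fun y => phi t y - (y + t * a y)) y| <= 1 * `|t|.
    by near: t; exact: hexp.
  by have := H x; rewrite (der t td) opprD addrA.
- move=> x; have H : forall y, `|derive1n 0 (fun y => phi t y - (y + t * a y)) y| <= e * `|t|.
    by near: t; exact: hexp.
  by have := H x; rewrite /= opprD addrA.
Unshelve. all: by end_near. Qed.

Lemma Aop_mode (g : circle R -> circle R) (c : R) k : diff_plus g ->
  let v := hscale c%:C (chi (freq true k)) in
  [/\ Hs true (Aop g v), 
      forall j, fourier (Aop g v) (freq true j) = c%:C * fourier (Vop g (chi (freq true k))) (freq true j)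
    & forall n, fourier (Vop g v) n = c%:C * fourier (Vop g (chi (freq true k))) n].
Proof.
move=> hg v; have hchi : Hs true (chi (freq true k)) := @Hs_chi R true k.
have hv : Hs true v := HsZ _ hchi.
have ic := Vop_lift_integrable hg hchi.1.
have eV n : fourier (Vop g v) n = c%:C * fourier (Vop g (chi (freq true k))) n.
  exact: (fourierZ c%:C n ic).
have [f [sf lf _ _]] := diff_plus_lift hg.
have sv : csmooth (fun x => v (expi x)).
  exact: csmoothM (csmooth_cst c%:C) (csmooth_chi (freq true k)).
have sV : csmooth (fun x => Vop g v (expi x)).
  apply: (csmooth_ext _ (csmooth_comp sv sf)) => x.
  by rewrite /Vop/= lf.
have pV : per2pi (fun x => Vop g v (expi x)) by move=> x; rewrite expiD2pi.
have [w hw ew] := smooth_half true sV pV.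
split; [exact: proj_Hs|move=> j|exact: eV].
rewrite -eV; apply: (proj_fourier (Vop_lift_integrable hg hv.1) hw) => i.
by rewrite ew -fourier_fc.
Qed.

End Path.

Section Derivative.
Context {R : realType} (A : circle R -> R) (h : R -> circle R -> circle R).
Context (sA : smooth_field A) (hA : path_with_field h A).
Context (Zdot : cfun R -> cfun R) (hZ : is_Zdot h Zdot).

Let X t u := csub (hscale (t^-1)%:C (csub (Zop (h t) u) (Zop (h 0) u))) (Zdot u).

Lemma opnorm_near (e : R) : 0 < e -> \forall t \near (0 : R)^', (opnorm (X t) <= e%:E)%E.
Proof.
move=> e0; have : nbhs (0%E : \bar R) [set y | (y < e%:E)%E].
  by apply: (@open_ereal_lt' R 0%E e%:E); rewrite lte_fin.
move=> hn; near=> t; apply: ltW; near: t; exact: (hZ.2 _ hn).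
Unshelve. all: by end_near. Qed.

(** The operator [Z_h] is tested on the moving vector [A_h v] with [v] a fixed
    multiple of a mode, small enough for [A_h v] to stay in the unit ball. There
    the difference quotient is close to [Zdot], and its coefficients are those of
    [v \o h] divided by [t]; finally [A_h v] tends to [v] in norm. *)
Lemma Zdot_mode k j :
  fourier (Zdot (chi (freq true k))) (freq false j) =
  'i * (k.+1%:R : R)%:C * field_hat A (freq false j - freq true k).
Proof.
have bT := hZ.1.
have [C C0 hC] := path_expansion sA hA.
have [K K0 hK] := bounded_fourier bT.
have hid : h 0 = idfun by case: hA => phi [d []].
have sa : smooth (fun x => A (expi x)) := sA.
set m := freq true k; set n := freq false j.
have nm : n != m by rewrite eq_sym; exact/negbT/freq_negb.
have n0 : n != 0 := freq_neq0 false j.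
have [r [rE r1]] : exists r : R, r = m%:~R /\ 1 <= r.
  by exists k.+1%:R; split=> //; rewrite ler1n.
have -> : (k.+1%:R : R) = r by rewrite rE.
have r0 : 0 < r := lt_le_trans ltr01 r1.
(* With this factor the derivative of [v \o h] is bounded by 1 once [p'] is at most 2. *)
pose c := (2 * r)^-1.
have c0 : 0 < c by rewrite invr_gt0 mulr_gt0.
have cr : c * r = 2^-1 by rewrite /c invfM -mulrA mulVf ?mulr1// gt_eqF.
have hchi : Hs true (chi m) := @Hs_chi R true k.
pose v := hscale c%:C (chi m); have hv : Hs true v := HsZ _ hchi.
pose W := 'i * r%:C * field_hat A (n - m).
suff key : fourier (Zdot v) n - c%:C * W = 0.
  move/eqP: key; rewrite /v (bounded_scale bT _ hchi n0) -mulrBr mulf_eq0 => /orP[|].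
    by move=> /eqP/complexI c00; move: c0; rewrite c00 ltxx.
  by rewrite subr_eq0 => /eqP.
(* The total error at a parameter [t] with [`|t| <= e] is at most [e * B]. *)
pose B := 2 + 2 * r * C ^+ 2 + (C + 2 * (r * C)) * K.
have rC : 0 < r * C by rewrite mulr_gt0.
have B0 : 0 < B.
  have q1 := mulr_ge0 (ltW r0) (sqr_ge0 C).
  have q2 : 0 <= (C + 2 * (r * C)) * K by rewrite mulr_ge0// addr_ge0 ?mulr_ge0// ltW.
  rewrite /B; lra.
apply: normc_eq0 => e0 e00; pose e := e0 / B.
have eP : 0 < e by rewrite divr_gt0.
have H1 (a b : R) : 0 < a -> 0 < b -> \forall t \near (0 : R)^', a * `|t| < b.
  move=> a0 b0; have := @dnbhs0_lt R R (b / a) (divr_gt0 b0 a0).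
  by apply: filterS => s; rewrite ltr_pdivlMr// mulrC.
have [t [tn0 [te [t1 [t2 [opX [ht [p [sp lp hp0 hp1 hp2]]]]]]]]] : exists t, t != 0 /\
    `|t| <= e /\ C * `|t| <= 1 /\ 4 * (r * (C * `|t|)) < 1 /\ (opnorm (X t) <= e%:E)%E /\
    diff_plus (h t) /\ exists p, [/\ smooth p, is_lift (h t) p,
      forall x, `|p x - x| <= C * `|t|, forall x, `|p^`() x - 1| <= C * `|t| &
      forall x, `|p x - x - t * A (expi x)| <= e * `|t|].
  apply: (@filter_ex _ (0 : R)^'); near=> t.
  split; first by near: t; exact: nbhs_dnbhs_neq.
  split; first by rewrite -[leLHS]mul1r; apply: ltW; near: t; exact: H1.
  split; first by apply: ltW; near: t; exact: H1.
  split; first by rewrite !mulrA; near: t; apply: H1; rewrite // !mulr_gt0.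
  split; first by near: t; exact: opnorm_near.
  by near: t; apply: nbhs_dnbhs; exact: hC.
pose mode x := eI (r * p x).
have eM i : fourier (Vop (h t) (chi m)) i = fc mode i.
  by rewrite fourier_fc; apply: eq_fc => x _; rewrite (Vop_chi_lift m x lp) -rE.
have pm : per2pi mode.
  have modeE x : mode x = Vop (h t) (chi m) (expi x) by rewrite (Vop_chi_lift m x lp) -rE.
  by move=> x; rewrite !modeE expiD2pi.
have sm : csmooth mode := csmooth_eI (smoothM (@smooth_cst R r) sp).
have [hu eu eV] := Aop_mode c k ht.
rewrite -/m -/v in hu eu eV; set u := Aop (h t) v in hu eu.
have {}eu i : fourier u (freq true i) = c%:C * fc mode (freq true i).
  by rewrite (eu i) eM.
have {}eV i : fourier (Vop (h t) v) i = c%:C * fc mode i by rewrite (eV i) eM.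
have diag := fc_mode_diag rE (ltW r0) sp hp0.
have nz : fourier (Vop (h t) v) m != 0.
  rewrite eV mulf_neq0//; first by apply/eqP => /complexI cz; move: c0; rewrite cz ltxx.
  apply/eqP => z; move: diag; rewrite -/mode z sub0r normcN => diag.
  have : normc (1 : R[i]) = 1 by rewrite -[1]eI0 normc_eI.
  lra.
have sv : csmooth (fun x => v (expi x)) := csmoothM (csmooth_cst c%:C) (csmooth_chi m).
have eZ : fourier (Zop (h t) u) n = c%:C * fc mode n.
  exact: etrans (Zop_Aop ht hv sv nz j) (eV n).
have sg : csmooth (fun x => c%:C * mode x) := csmoothM (csmooth_cst c%:C) sm.
have pg : per2pi (fun x => c%:C * mode x) by move=> x; rewrite (pm x).
have u1 : hnorm u <= 1.
  apply: (hnorm_half_le hu sg pg ler01) => [x|i].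
    rewrite (cDZ c%:C sm) ComplexField.Normc.normcM normcR gtr0_norm//.
    apply: (@le_trans _ _ (c * (r * 2))); last by rewrite mulrA cr mulVf.
    apply: (ler_wpM2l (ltW c0)); apply: (le_trans (normc_cD_mode (ltW r0) sp hp1 x)).
    by apply: (ler_wpM2l (ltW r0)); move: t1; lra.
  by rewrite (eu i) (fcZ c%:C _ (csmooth_integrable sm)).
have sb : csmooth (fun x => eI (r * x)) := csmooth_eIn r.
have pb : per2pi (fun x => eI (r * x)) by rewrite rE; exact: per2pi_eIn.
have smb : csmooth (fun x => mode x - eI (r * x)) := csmoothB sm sb.
have sd : csmooth (fun x => c%:C * (mode x - eI (r * x))) := csmoothM (csmooth_cst c%:C) smb.
have pd : per2pi (fun x => c%:C * (mode x - eI (r * x))) by move=> x; rewrite (pm x) (pb x).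
have dv : Hs true (csub u v) := HsB hu hv.
have D0 : 0 < (C + 2 * (r * C)) * `|t|.
  by rewrite mulr_gt0 ?normr_gt0// addr_gt0// mulr_gt0.
have uv : hnorm (csub u v) <= (C + 2 * (r * C)) * `|t|.
  apply: (hnorm_half_le dv sd pd (ltW D0)) => [x|i].
    rewrite (cDZ c%:C smb) ComplexField.Normc.normcM normcR gtr0_norm//.
    have := normc_cD_mode_diff (ltW r0) sp hp0 hp1 x; rewrite -/mode => hx.
    apply: (le_trans (ler_wpM2l (ltW c0) hx)); rewrite [leLHS]mulrA cr.
    rewrite (_ : C * `|t| + 2 * (r * (C * `|t|)) = (C + 2 * (r * C)) * `|t|); last by ring.
    lra.
  have iu := H12_lift_integrable hu.1; have iv := H12_lift_integrable hv.1.
  rewrite (fourierB _ iu iv) (eu i) (fcZ c%:C _ (csmooth_integrable smb)).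
  rewrite (fcB _ (csmooth_integrable sm) (csmooth_integrable sb)) mulrBr.
  rewrite (fourierZ _ _ (H12_lift_integrable hchi.1)) fourier_chi.
  by rewrite rE fc_eI.
have e1 : normc (fourier (Zdot u) n - fourier (Zdot v) n) <= (C + 2 * (r * C)) * `|t| * K.
  have uE : u = cadd (hscale 1 (csub u v)) v.
    by apply/funext => z; rewrite /cadd /hscale /csub mul1r subrK.
  rewrite {1}uE (bounded_linear bT 1 dv hv n0) mul1r addrK.
  exact: hK _ _ _ dv D0 uv n0.
have hZu : Hs false (csub (hscale (t^-1)%:C (csub (Zop (h t) u) (Zop (h 0) u))) (Zdot u)).
  by apply: (HsB (HsZ _ (HsB _ _)) (bounded_Hs bT hu)); exact: Zop_Hs.
have e2 : normc ((t^-1)%:C * (c%:C * fc mode n) - fourier (Zdot u) n) <= e.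
  have -> : (t^-1)%:C * (c%:C * fc mode n) - fourier (Zdot u) n = fourier (X t u) n.
    have h1 : Hs false (Zop (h t) u) := Zop_Hs _ _.
    have h2 : Hs false (Zop (h 0) u) := Zop_Hs _ _.
    have i1 := H12_lift_integrable h1.1; have i2 := H12_lift_integrable h2.1.
    have i12 := H12_lift_integrable (HsB h1 h2).1.
    have i3 := H12_lift_integrable (HsZ (t^-1)%:C (HsB h1 h2)).1.
    have i4 := H12_lift_integrable (bounded_Hs bT hu).1.
    have z0 : fourier (Zop (h 0) u) n = 0 by rewrite hid; exact: Zop_id.
    have q1 : fourier (csub (Zop (h t) u) (Zop (h 0) u)) n = c%:C * fc mode n.
      exact: (etrans (fourierB n i1 i2) (etrans (congr2 (fun a b => a - b) eZ z0) (subr0 _))).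
    have q2 := etrans (fourierZ (t^-1)%:C n i12) (congr1 (fun z => (t^-1)%:C * z) q1).
    exact: esym (etrans (fourierB n i3 i4) (congr1 (fun z => z - fourier (Zdot u) n) q2)).
  apply: (le_trans (normc_fourier_le hZu.1 n0)).
  exact: hnorm_le_opnorm hu u1 opX.
have e3 : normc ((t^-1)%:C * (c%:C * fc mode n) - c%:C * W) <= 2 * r * C ^+ 2 * `|t| + e.
  have hm := fc_mode_expansion rE (ltW r0) sp sa hp0 hp2 nm.
  have eW : W = 'i * r%:C * fc (fun x => (A (expi x))%:C) (n - m).
    by rewrite /W /field_hat fourier_fc.
  rewrite -eW -/mode in hm.
  have -> : (t^-1)%:C * (c%:C * fc mode n) - c%:C * W =
      (c / t)%:C * (fc mode n - t%:C * W).
    have tt : (t^-1)%:C * t%:C = 1 by rewrite -(rmorphM (real_complex R)) mulVf ?rmorph1.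
    have alg (x y z w : R[i]) : x * y = 1 -> x * (z * w) - z * W = z * x * (w - y * W).
      by move=> xy; rewrite -{1}[W]mul1r -xy; ring.
    by rewrite (rmorphM (real_complex R)); exact: alg.
  rewrite ComplexField.Normc.normcM normcR normrM (normfV t) (gtr0_norm c0).
  have s0 : 0 < `|t| by rewrite normr_gt0.
  have ct : 0 <= c / `|t| by rewrite divr_ge0// ltW.
  apply: (le_trans (ler_wpM2l ct hm)).
  rewrite le_eqVlt; apply/orP; left; apply/eqP.
  move: s0; generalize `|t| => s s0.
  transitivity (c * r * 2 * (2 * r * C ^+ 2 * s + e)); last by rewrite cr mulVf ?mul1r.
  by field; rewrite gt_eqF.
(* First-order expansion, operator-norm convergence, and [A_h v] close to [v]. *)
have -> : fourier (Zdot v) n - c%:C * W =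
    ((t^-1)%:C * (c%:C * fc mode n) - c%:C * W)
    - ((t^-1)%:C * (c%:C * fc mode n) - fourier (Zdot u) n)
    - (fourier (Zdot u) n - fourier (Zdot v) n).
  move: ((t^-1)%:C * _) (c%:C * W) => x y.
  by move: (fourier (Zdot u) n) (fourier (Zdot v) n) => z w; ring.
apply: (le_trans (normcB _ _)); apply: (le_trans (lerD (normcB _ _) (lexx _))).
apply: (le_trans (lerD (lerD e3 e2) e1)).
rewrite (_ : e0 = e * B); last by rewrite divfK// gt_eqF.
rewrite /B.
have q1 := ler_wpM2l (mulr_ge0 (mulr_ge0 (ler0n R 2) (ltW r0)) (sqr_ge0 C)) te.
have q2 : (C + 2 * (r * C)) * `|t| * K <= (C + 2 * (r * C)) * K * e.
  rewrite mulrAC ler_wpM2l// mulr_ge0// addr_ge0 ?(ltW C0)//.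
  by rewrite mulr_ge0// ltW.
apply: (le_trans (lerD (lerD (lerD q1 (lexx e)) (lexx e)) q2)).
by rewrite le_eqVlt; apply/orP; left; apply/eqP; ring.
Unshelve. all: by end_near. Qed.
End Derivative.

Section Matrix.
Context {R : realType} (A : circle R -> R) (h : R -> circle R -> circle R).
Context (sA : smooth_field A) (hA : path_with_field h A).
Context (Zdot : cfun R -> cfun R) (hZ : is_Zdot h Zdot).
Notation sqrtn n := (Num.sqrt (n%:R : R)).

Lemma e_plusE k : @e_plus R k.+1 = hscale ((sqrtn k.+1)^-1)%:C (chi (freq true k)).
Proof. by []. Qed.

Lemma e_minusE j : @e_minus R j.+1 = hscale ((sqrtn j.+1)^-1)%:C (chi (freq false j)).
Proof. by []. Qed.

Lemma sqrtn_neq0 n : sqrtn n.+1 != 0.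
Proof. by rewrite gt_eqF// sqrtr_gt0. Qed.

Lemma sqrtn_sqr n : sqrtn n * sqrtn n = n%:R.
Proof. by rewrite -expr2 sqr_sqrtr. Qed.

Lemma Hs_e_plus k : Hs true (@e_plus R k.+1).
Proof. by rewrite e_plusE; exact: HsZ (@Hs_chi R true k). Qed.

Lemma Zdot_e_plus k j : fourier (Zdot (e_plus k.+1)) (freq false j) =
  'i%C * (sqrtn k.+1)%:C * field_hat A (- (k.+1 + j.+1)%:Z).
Proof.
rewrite e_plusE (bounded_scale hZ.1 _ (@Hs_chi R true k) (freq_neq0 false j)).
rewrite (Zdot_mode sA hA hZ k j) -/('i%C).
have -> : freq false j - freq true k = - (k.+1 + j.+1)%:Z.
  by rewrite PoszD opprD addrC.
have <- : ((sqrtn k.+1)^-1)%:C * (k.+1%:R : R)%:C = (sqrtn k.+1)%:C.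
  by rewrite -(rmorphM (real_complex R)) -{2}(sqrtn_sqr k.+1) mulKf// sqrtn_neq0.
by rewrite !mulrA (mulrC _ 'i%C).
Qed.

Lemma inner_e_minus u j :
  inner u (e_minus j.+1) = (sqrtn j.+1)%:C * fourier u (freq false j).
Proof.
have fe n : fourier (@e_minus R j.+1) n = ((sqrtn j.+1)^-1)%:C * (freq false j == n)%:R.
  rewrite e_minusE -fourier_chi; apply: fourierZ.
  exact: H12_lift_integrable (@Hs_chi R false j).1.
rewrite (@inner_single R u _ false j) => [|n _ nj]; rewrite fe.
  rewrite eqxx mulr1 conjcR mulrCA [RHS]mulrC; congr (_ * _).
  rewrite -(rmorph_nat (real_complex R)) -(rmorphM (real_complex R)).
  by rewrite -{1}(sqrtn_sqr j.+1) mulfK// sqrtn_neq0.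
by rewrite eq_sym (negPf nj) mulr0.
Qed.

End Matrix.

Theorem proposition4p5 (R : realType) (A : circle R -> R)
    (hA : smooth_field A)
    (h : R -> circle R -> circle R) (hh : path_with_field h A)
    (Zdot : cfun R -> cfun R) (hZ : is_Zdot h Zdot) :
  (forall m l : nat, (0 < m)%N -> (0 < l)%N ->
     inner (Zdot (e_plus m)) (e_minus l)
     = 'i%C * (Num.sqrt ((m * l)%:R : R))%:C * field_hat A (- (m + l)%:Z))
  /\
  (forall m : nat, (0 < m)%N ->
     hnorm (csub (Zdot (e_plus m))
       (fun z => 'i%C * \sum_(1 <= l < N.+1)
          (Num.sqrt ((m * l)%:R : R))%:C * field_hat A (- (m + l)%:Z)
          * e_minus l z)) @[N --> \oo] --> (0 : R)).
Proof.
have sqrtM m l : (Num.sqrt ((m * l)%:R : R))%:C =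
    (Num.sqrt (m%:R : R))%:C * (Num.sqrt (l%:R : R))%:C.
  by rewrite natrM sqrtrM// (rmorphM (real_complex R)).
split=> [[//|k] [//|j] _ _|[//|k] _].
  rewrite inner_e_minus (Zdot_e_plus hA hh hZ k j) sqrtM.
  ring.
have hT : Hs false (Zdot (e_plus k.+1)) := bounded_Hs hZ.1 (Hs_e_plus k).
pose S N z : R[i] := 'i%C * \sum_(1 <= l < N.+1)
  (Num.sqrt ((k.+1 * l)%:R : R))%:C * field_hat A (- (k.+1 + l)%:Z) * e_minus l z.
suff SE : S = psum false (fun j => fourier (Zdot (e_plus k.+1)) (freq false j)).
  apply: (eq_ind_r (fun P => hnorm (csub (Zdot (e_plus k.+1)) (P N)) @[N --> \oo] --> (0 : R)) _ SE).
  exact: hnorm_psum_cvg hT.1 (fun j => Hs_fourier_opp j hT).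
apply/funext => N; apply/funext => z.
rewrite /S /psum big_add1 big_mkord mulr_sumr; apply: eq_bigr => j _.
rewrite (Zdot_e_plus hA hh hZ k j) sqrtM /e_minus /hscale rmorphV ?unitfE ?sqrtn_neq0//.
by rewrite /freq; field; rewrite fmorph_eq0; exact: sqrtn_neq0.
Qed.
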